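(* Let $p>1$ be fixed, let $\mathbf{y}_1,\mathbf{y}_2,\ldots$ be independent random vectors with common distribution $F$ on $\mathbb{R}^p$, and let $\mathbf{z}_{i,j}=(\mathbf{y}_i+\mathbf{y}_j)/2$ for $i<j$. Assume that (a) the density of $\mathbf{z}_{i,j}$ is continuous and bounded, and (b) the spatial median of $\mathbf{z}_{i,j}$ is unique and equal to $\boldsymbol{\mu}_{\mathrm{HL}}=\mathbf{0}$. Let $$\mathbf{q}_n=\binom{n}{2}^{-1}\sum_{1\le i<j\le n}\frac{\mathbf{z}_{i,j}}{\|\mathbf{z}_{i,j}\|}.$$ Then, as $n\to\infty$, $$\sqrt{n}\,\mathbf{q}_n\stackrel{d}{\longrightarrow}N_p(\mathbf{0},4\mathbf{B}),\qquad\text{where}\quad \mathbf{B}=\mathbb{E}\left\{\left(\|\mathbf{z}_{1,2}\|^{-1}\mathbf{z}_{1,2}\right)\left(\|\mathbf{z}_{2,3}\|^{-1}\mathbf{z}_{2,3}^{\top}\right)\right\}.$$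
   Context: $\|\cdot\|$ is the Euclidean norm. A spatial median of a $p$-variate random vector $\mathbf{z}$ is a minimizer over $\boldsymbol{\mu}\in\mathbb{R}^p$ of $\mathbb{E}\{\|\mathbf{z}-\boldsymbol{\mu}\|-\|\mathbf{z}\|\}$ (this expectation always exists). The statistic $\mathbf{q}_n$ is called the spatial signed-rank test statistic. *)

(* Defs.v *)
From HB Require Import structures.
From mathcomp Require Import all_boot all_order all_algebra finmap.
From mathcomp Require Import all_classical all_reals all_analysis.
From mathcomp Require Import measurable_realfun.

Set Implicit Arguments.
Unset Strict Implicit.
Unset Printing Implicit Defensive.

Import Order.TTheory GRing.Theory Num.Theory.
Import numFieldNormedType.Exports.

Local Open Scope classical_set_scope.
Local Open Scope ring_scope.

(** Vectors of [R^p] are rows ['rV[R]_p]; in particular the outer product of two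
    column vectors a b^T is written [a^T *m b].  The library norm on ['rV[R]_p]
    is the sup norm: it induces the usual topology (hence the usual Borel sets
    and continuous functions) but is not the Euclidean norm. *)

Section borel_matrix.
Context {R : realType} (m n : nat).

HB.instance Definition _ :=
  @isMeasurable.Build (sigma_display (@open 'M[R]_(m, n))) 'M[R]_(m, n)
    <<s @open 'M[R]_(m, n) >>
    (@sigma_algebra0 _ setT _) (@sigma_algebraC _ _)
    (@sigma_algebra_bigcup _ setT _).

Lemma measurable_mx_coord (i : 'I_m) (j : 'I_n) :
  measurable_fun [set: 'M[R]_(m, n)] (fun M : 'M[R]_(m, n) => M i j).
Proof.
apply: (measurability _ (RGenOInfty.measurableE R)) => _ [_ [a ->] <-].
rewrite setTI; apply: sub_sigma_algebra.
apply: open_comp; last exact: interval_open.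
by move=> x _; exact: coord_continuous.
Qed.

Lemma measurable_fun_mxP d (T : measurableType d) (f : T -> 'M[R]_(m, n)) :
  measurable_fun [set: T] f <->
  forall i j, measurable_fun [set: T] (fun t => f t i j).
Proof.
split=> [mf i j|mf].
  exact: (measurableT_comp (measurable_mx_coord i j) mf).
apply: (measurability (@open 'M[R]_(m, n))) => // _ [U oU <-]; rewrite setTI.
pose qball (q : 'M[rat]_(m, n) * nat) : set 'M[R]_(m, n) :=
  ball (map_mx (@ratr R) q.1) q.2.+1%:R^-1.
have -> : U = \bigcup_q (if `[< qball q `<=` U >] then qball q else set0).
  apply/seteqP; split => [x Ux|x [q _]]; last first.
    by move=> qx; case: asboolP qx => //= qU; exact: qU.
  have : nbhs x U by apply: open_nbhs_nbhs; split.
  move=> /nbhs_ballP[e /= e0 xeU].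
  have e20 : 0 < e / 2 by rewrite divr_gt0.
  have [k _ /(_ k (leqnn k)) ke] := near_infty_natSinv_lt (PosNum e20).
  have k0 : 0 < k.+1%:R^-1 :> R by rewrite invr_gt0.
  have qP i j : exists q : rat, ball (x i j) k.+1%:R^-1 (ratr q : R).
    have /rat_in_itvoo[q xq] : x i j - k.+1%:R^-1 < x i j + k.+1%:R^-1.
      by rewrite ltrBlDr -addrA ltrDl addr_gt0.
    by exists q; rewrite ball_itv.
  pose Q := \matrix_(i, j) projT1 (cid (qP i j)).
  have xQ : qball (Q, k) x.
    split=> // i j; rewrite !mxE; apply: ball_sym.
    by case: cid.
  exists (Q, k) => //; rewrite asboolT// => z Qz.
  have sub := @le_ball _ _ (map_mx (@ratr R) Q) _ _ (ltW ke).
  apply: xeU; rewrite (splitr e).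
  exact: ball_triangle (ball_sym (sub _ xQ)) (sub _ Qz).
rewrite preimage_bigcup; apply: countable_bigcupT_measurable => // q.
case: asboolP => _; last by rewrite preimage_set0.
have -> : f @^-1` qball q = \bigcap_i \bigcap_j
    ((fun t => f t i j) @^-1` ball (ratr (q.1 i j) : R) q.2.+1%:R^-1).
  apply/seteqP; split => t /= => [[_ qt] i _ j _|qt]; first by have := qt i j; rewrite mxE.
  split=> [|i j]; first by rewrite invr_gt0.
  by rewrite mxE; exact: qt.
apply: fin_bigcap_measurable => // i _; apply: fin_bigcap_measurable => // j _.
rewrite -[X in measurable X]setTI; apply: mf => //.
by rewrite ball_itv; exact: measurable_itv.
Qed.

End borel_matrix.

Section lebesgue_rV.
Context {R : realType}.
Local Open Scope ereal_scope.

Definition rV_cons n (xv : measurableTypeR R * 'rV[R]_n) : 'rV[R]_n.+1 :=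
  row_mx (const_mx xv.1 : 'rV[R]_1) xv.2.

Lemma rV_cons0 n xv : @rV_cons n xv ord0 ord0 = xv.1.
Proof.
by rewrite mxE; case: splitP => // j _; rewrite mxE.
Qed.

Lemma rV_consS n xv i : @rV_cons n xv ord0 (lift ord0 i) = xv.2 ord0 i.
Proof.
rewrite mxE; case: splitP => [[[|//] ?]|k]//=.
by rewrite /bump add1n => -[/val_inj ->].
Qed.

Lemma measurable_rV_cons n : measurable_fun [set: _] (@rV_cons n).
Proof.
apply/measurable_fun_mxP => i j; rewrite (ord1 i).
case: (unliftP ord0 j) => [k|] ->.
  under eq_fun do rewrite rV_consS.
  exact: (measurableT_comp (measurable_mx_coord ord0 k) measurable_snd).
by under eq_fun do rewrite rV_cons0; exact: measurable_fst.
Qed.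

Section step.
Context n (mu : {sigma_finite_measure set 'rV[R]_n -> \bar R}).

Definition lebesgue_rVS : set 'rV[R]_n.+1 -> \bar R :=
  pushforward (lebesgue_measure \x mu) (@rV_cons n).

Let lebesgue_rVS0 : lebesgue_rVS set0 = 0.
Proof. by rewrite /lebesgue_rVS /pushforward preimage_set0 measure0. Qed.

Let lebesgue_rVS_ge0 A : 0 <= lebesgue_rVS A.
Proof. by rewrite /lebesgue_rVS /pushforward; exact: measure_ge0. Qed.

Let lebesgue_rVS_sigma_additive : semi_sigma_additive lebesgue_rVS.
Proof.
have mpre A : measurable A -> measurable (@rV_cons n @^-1` A).
  by move=> mA; rewrite -[X in measurable X]setTI; exact: measurable_rV_cons.
move=> F mF tF mUF; rewrite /lebesgue_rVS /pushforward preimage_bigcup.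
apply: measure_semi_sigma_additive.
- by move=> k; exact: mpre.
- apply/trivIsetP => /= i j _ _ ij; rewrite -preimage_setI.
  by move/trivIsetP : tF => /(_ _ _ _ _ ij) ->//; rewrite preimage_set0.
- by rewrite -preimage_bigcup; exact: mpre.
Qed.

HB.instance Definition _ := isMeasure.Build _ _ _ lebesgue_rVS
  lebesgue_rVS0 lebesgue_rVS_ge0 lebesgue_rVS_sigma_additive.

Lemma lebesgue_rVS_setX (A : set R) (B : set 'rV[R]_n) :
  measurable A -> measurable B ->
  lebesgue_rVS [set x | A (x ord0 ord0) /\
    B (\row_i x ord0 (lift ord0 i))] = lebesgue_measure A * mu B.
Proof.
move=> mA mB; rewrite -product_measure1E// /lebesgue_rVS /pushforward.
congr (_ _); rewrite /preimage; apply/funext => -[x v] /=.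
rewrite rV_cons0 (_ : \row_i _ = v)//.
by apply/rowP => i; rewrite mxE rV_consS.
Qed.

Let lebesgue_rVS_sigma_finite : sigma_finite setT lebesgue_rVS.
Proof.
have /sigma_finiteP[F [TF ndF Foo]] := sigma_finiteT (@lebesgue_measure R).
have /sigma_finiteP[G [TG ndG Goo]] := sigma_finiteT mu.
pose tl (x : 'rV[R]_n.+1) : 'rV[R]_n := \row_i x ord0 (lift ord0 i).
exists (fun k => [set x : 'rV[R]_n.+1 | F k (x ord0 ord0) /\ G k (tl x)]).
  apply/seteqP; split => // x _.
  have [i _ Fi] : (\bigcup_i F i) (x ord0 ord0) by rewrite -TF.
  have [j _ Gj] : (\bigcup_i G i) (tl x) by rewrite -TG.
  exists (maxn i j) => //; split.
  - by move: Fi; exact/subsetPset/ndF/leq_maxl.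
  - by move: Gj; exact/subsetPset/ndG/leq_maxr.
move=> k; have [mF ?] := Foo k; have [mG ?] := Goo k; split.
  have mtl : measurable_fun [set: _] tl.
    apply/measurable_fun_mxP => i j; under eq_fun do rewrite mxE.
    exact: measurable_mx_coord.
  rewrite [X in measurable X](_ : _ =
    ((fun x : 'rV[R]_n.+1 => x ord0 ord0) @^-1` F k) `&` (tl @^-1` G k))//.
  apply: measurableI; rewrite -[X in measurable X]setTI.
    exact: measurable_mx_coord.
  exact: mtl.
by rewrite lebesgue_rVS_setX// lte_mul_pinfty// ge0_fin_numE.
Qed.

HB.instance Definition _ := Measure_isSigmaFinite.Build _ _ _ lebesgue_rVS
  lebesgue_rVS_sigma_finite.

End step.

Fixpoint lebesgue_rV n : {sigma_finite_measure set 'rV[R]_n -> \bar R} :=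
  match n with
  | 0 => \d_(0%R : 'rV[R]_0)
  | n'.+1 => lebesgue_rVS (lebesgue_rV n')
  end.

Lemma lebesgue_rV_box n (A : 'I_n -> set R) : (forall i, measurable (A i)) ->
  lebesgue_rV n [set x | forall i, A i (x ord0 i)] =
  \prod_(i < n) lebesgue_measure (A i).
Proof.
elim: n A => [|n IH] A mA /=.
  by rewrite big_ord0 diracE mem_set//= => -[].
rewrite big_ord_recl -IH// -lebesgue_rVS_setX//; last first.
  rewrite [X in measurable X](_ : _ = \bigcap_i
      ((fun x : 'rV[R]_n => x ord0 i) @^-1` A (lift ord0 i))); last first.
    by apply/seteqP; split => x /= Ax i => [_|]; exact: Ax.
  apply: fin_bigcap_measurable => // i _; rewrite -[X in measurable X]setTI.
  exact: measurable_mx_coord.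
congr (_ _); apply/seteqP; split => x /=.
  by move=> Ax; split => // i; rewrite mxE.
move=> [A0 AS] i; case: (unliftP ord0 i) => [k|] ->//.
by have := AS k; rewrite mxE.
Qed.

End lebesgue_rV.

Section random_vectors.
Context d (T : measurableType d) (R : realType) (P : probability T R).
Local Open Scope ereal_scope.

Definition mutually_independent d' (T' : measurableType d') (I : choiceType)
    (X : I -> {RV P >-> T'}) : Prop :=
  forall (J : {fset I}) (A : I -> set T'),
    (forall i, i \in J -> measurable (A i)) ->
    P (\bigcap_(i in [set` J]) (X i @^-1` A i)) =
    \prod_(i <- J) P (X i @^-1` A i).

Definition has_density n (X : T -> 'rV[R]_n) (f : 'rV[R]_n -> R) : Prop :=
  [/\ forall x, (0 <= f x)%R, measurable_fun [set: 'rV[R]_n] f &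
    forall A : set 'rV[R]_n, measurable A ->
      P (X @^-1` A) = \int[lebesgue_rV n]_(x in A) (f x)%:E].

Definition expectation_mx m n (M : T -> 'M[R]_(m, n)) : 'M[R]_(m, n) :=
  \matrix_(i, j) fine 'E_P[fun t => M t i j].

Definition cvg_in_law n (X : nat -> T -> 'rV[R]_n)
    (nu : probability 'rV[R]_n R) : Prop :=
  forall f : 'rV[R]_n -> R, continuous f -> bounded_fun f ->
    'E_P[f \o X k] @[k --> \oo] --> \int[nu]_x (f x)%:E.

End random_vectors.

Section mvnormal.
Context (R : realType).

(** [normal_prob m 0] is not a point mass in the library (it is the uniform
    distribution on [[0, 1]]), hence the case distinction. *)
Definition normal_law (m v : R) : set (measurableTypeR R) -> \bar R :=
  if v == 0 then \d_m else normal_prob m (Num.sqrt v).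

(** [nu] is normal with mean [m] and covariance [S], possibly degenerate: for
    every direction [u], the law of [x |-> <x, u>] under [nu] is the univariate
    normal law with mean [<m, u>] and variance [u S u^T]. *)
Definition is_mvnormal n (nu : probability 'rV[R]_n R)
    (m : 'rV[R]_n) (S : 'M[R]_n) : Prop :=
  [/\ S^T = S, forall u : 'rV[R]_n, 0 <= (u *m S *m u^T) 0 0 &
    forall (u : 'rV[R]_n) (A : set (measurableTypeR R)), measurable A ->
      nu ((fun x : 'rV[R]_n => (x *m u^T) 0 0) @^-1` A) =
      normal_law ((m *m u^T) 0 0) ((u *m S *m u^T) 0 0) A].

End mvnormal.

Section spatial.
Context d (T : measurableType d) (R : realType) (P : probability T R) (p : nat).

Definition enorm (x : 'rV[R]_p) : R := Num.sqrt (\sum_(i < p) x 0 i ^+ 2).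

(** [spatial_sign 0 = 0], since [0^-1 = 0]. *)
Definition spatial_sign (x : 'rV[R]_p) : 'rV[R]_p := (enorm x)^-1 *: x.

Definition is_spatial_median (Z : T -> 'rV[R]_p) (mu : 'rV[R]_p) : Prop :=
  forall nu : 'rV[R]_p,
    ('E_P[fun t => (enorm (Z t - mu) - enorm (Z t))%R] <=
     'E_P[fun t => (enorm (Z t - nu) - enorm (Z t))%R])%E.

Definition midpoint (X Y : T -> 'rV[R]_p) : T -> 'rV[R]_p :=
  fun t => 2^-1 *: (X t + Y t).

Definition signed_rank_stat (z : nat -> nat -> T -> 'rV[R]_p) (n : nat) :
    T -> 'rV[R]_p :=
  fun t => 'C(n, 2)%:R^-1 *:
    \sum_(i < n) \sum_(j < n | (i < j)%N) spatial_sign (z i j t).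

End spatial.

(* Main.v *)
Require Import Defs.
From HB Require Import structures.
From mathcomp Require Import all_boot all_order all_algebra finmap.
From mathcomp Require Import all_classical all_reals all_analysis.
From mathcomp Require Import measurable_realfun.
From mathcomp Require Import ring lra zify.

(** Fix a direction [u] and put [k (x, x') = <spatial_sign ((x + x') / 2), u>], a
    bounded symmetric kernel, so that [<q_n, u>] is the U-statistic of [k].

    The median minimizes [nu |-> E (|z - nu| - |z|)] at [0], and [z] has no atom
    at [0] since it has a density; differentiating under the expectation gives
    [E k (y_0, y_1) = 0].  Writing [k1 x = E k (x, y_1)], the kernel
    [k (x, x') - k1 x - k1 x'] is degenerate, so its U-statistic has variance
    [O (n ^- 2)], and [sqrt n <q_n, u>] is within [O (1 / sqrt n)] in [L^2] of
    the normalized i.i.d. sum of the bounded variables [2 k1 (y_i)].  The cosine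
    and sine transforms of the latter converge to those of a centered normal law
    of variance [4 E (k1 y_1 ^ 2) = 4 u B u^T].

    The vectors [sqrt n q_n] are bounded in [L^2], hence tight, and a continuous
    function is uniformly close to a trigonometric polynomial on a cube, so the
    convergence of [E cos (<sqrt n q_n, u> + th)] for all [u] and [th] yields
    convergence in law. *)

Set Implicit Arguments.
Unset Strict Implicit.
Unset Printing Implicit Defensive.

Import Order.TTheory GRing.Theory Num.Theory.
Import numFieldNormedType.Exports.

Local Open Scope classical_set_scope.
Local Open Scope ring_scope.

(** * Bounded measurable functions *)

(** The random integrands that occur are bounded, so the probabilistic part works with real-valued
    integrals of [bmfun] functions, for which integrability, products and finite sums cost nothing.
    Boundedness also replaces any Lindeberg-type condition by Taylor estimates with explicit
    constants.

    Equalities between expectations (identical laws, independence, conditioning, convolution) share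
    one scheme: the difference of the two sides is a functional that is linear and continuous under
    bounded pointwise convergence, hence zero once it vanishes on indicators, or on rectangles when
    two variables occur. Joint laws of the observations are never formed.

    Characteristic functions are kept as pairs of a cosine and a sine integral.

    The limit law has to be produced, for a covariance that may be singular, and its cosine
    transform computed. Both tasks rest on the convolution of one-dimensional centered normal laws,
    degenerate ones included. *)

Section bounded_measurable.
Context d (T : measurableType d) (R : realType).
Implicit Types X Y : T -> R.

Definition bmfun X := measurable_fun [set: T] X /\ exists K : R, forall t, `|X t| <= K.

Lemma bmfun_cst (c : R) : bmfun (fun=> c).
Proof. by split; [exact: measurable_cst | exists `|c|]. Qed.

Lemma bmfunD X Y : bmfun X -> bmfun Y -> bmfun (fun t => X t + Y t).
Proof.
move=> [mX [K XK]] [mY [L YL]]; split; first exact: measurable_funD.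
by exists (K + L) => t; rewrite (le_trans (ler_normD _ _))// lerD.
Qed.

Lemma bmfunM X Y : bmfun X -> bmfun Y -> bmfun (fun t => X t * Y t).
Proof.
move=> [mX [K XK]] [mY [L YL]]; split; first exact: measurable_funM.
by exists (K * L) => t; rewrite normrM ler_pM.
Qed.

Lemma bmfunZ (c : R) X : bmfun X -> bmfun (fun t => c * X t).
Proof. by move=> bX; apply: bmfunM => //; exact: bmfun_cst. Qed.

Lemma bmfunN X : bmfun X -> bmfun (fun t => - X t).
Proof.
by move=> [mX [K XK]]; split; [exact: measurableT_comp|exists K => t; rewrite normrN].
Qed.

Lemma bmfunB X Y : bmfun X -> bmfun Y -> bmfun (fun t => X t - Y t).
Proof. by move=> bX bY; apply: bmfunD => //; exact: bmfunN. Qed.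

Lemma bmfunX X n : bmfun X -> bmfun (fun t => X t ^+ n).
Proof.
move=> bX; elim: n => [|n IH]; first exact: bmfun_cst.
by under eq_fun do rewrite exprS; exact: bmfunM.
Qed.

Lemma bmfun_sum I (s : seq I) (Q : pred I) (X : I -> T -> R) :
  (forall i, Q i -> bmfun (X i)) -> bmfun (fun t => \sum_(i <- s | Q i) X i t).
Proof.
move=> bX; elim: s => [|i s IH].
  by under eq_fun do rewrite big_nil; exact: bmfun_cst.
under eq_fun do rewrite big_cons.
by case Qi : (Q i) => //; apply: bmfunD => //; exact: bX.
Qed.

Lemma bmfun_prod I (s : seq I) (Q : pred I) (X : I -> T -> R) :
  (forall i, Q i -> bmfun (X i)) -> bmfun (fun t => \prod_(i <- s | Q i) X i t).
Proof.
move=> bX; elim: s => [|i s IH].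
  by under eq_fun do rewrite big_nil; exact: bmfun_cst.
under eq_fun do rewrite big_cons.
by case Qi : (Q i) => //; apply: bmfunM => //; exact: bX.
Qed.

Lemma bmfun_indic (A : set T) : measurable A -> bmfun (\1_A : T -> R).
Proof.
move=> mA; split; first exact: measurable_indic.
by exists 1 => t; rewrite indicE; case: (_ \in _); rewrite ?normr1 ?normr0.
Qed.

Lemma bmfun_cos X : measurable_fun [set: T] X -> bmfun (fun t => cos (X t)).
Proof.
move=> mX; split; last by exists 1 => t; exact: cos_max.
by apply: (measurableT_comp _ mX); apply: continuous_measurable_fun; exact: continuous_cos.
Qed.

Lemma bmfun_sin X : measurable_fun [set: T] X -> bmfun (fun t => sin (X t)).
Proof.
move=> mX; split; last by exists 1 => t; exact: sin_max.
by apply: (measurableT_comp _ mX); apply: continuous_measurable_fun; exact: continuous_sin.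
Qed.

Lemma bmfun_comp d' (T' : measurableType d') (X : T' -> R) (f : T -> T') :
  measurable_fun [set: T'] X -> (exists K : R, forall t, `|X t| <= K) ->
  measurable_fun [set: T] f -> bmfun (fun t => X (f t)).
Proof.
move=> mX [K XK] mf; split; first exact: (measurableT_comp mX mf).
by exists K => t; exact: XK.
Qed.

End bounded_measurable.

Section bounded_integral.
Context d (T : measurableType d) (R : realType) (P : probability T R).
Implicit Types X Y : T -> R.

Lemma bmfun_integrable X : bmfun X -> P.-integrable [set: T] (EFin \o X).
Proof.
move=> [mX [K XK]]; apply: measurable_bounded_integrable => //.
  by rewrite (le_lt_trans (probability_le1 _ _)) ?ltry.
exists K; split; first exact: num_real.
by move=> x Kx t _ /=; rewrite (le_trans (XK t))// ltW.
Qed.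

Lemma EFin_Rintegral X : bmfun X ->
  (\int[P]_t X t)%:E = (\int[P]_t (X t)%:E)%E.
Proof.
move=> bX; rewrite /Rintegral fineK//; apply: integrable_fin_num => //.
exact: bmfun_integrable.
Qed.

Lemma RintegralT_cst (c : R) : \int[P]_t c = c.
Proof. rewrite Rintegral_cst// -[RHS]mulr1; congr (_ * _).
exact: (congr1 fine (probability_setT P)). Qed.

Lemma bRintegralD X Y : bmfun X -> bmfun Y ->
  \int[P]_t (X t + Y t) = \int[P]_t X t + \int[P]_t Y t.
Proof. by move=> bX bY; rewrite RintegralD//; exact: bmfun_integrable. Qed.

Lemma bRintegralB X Y : bmfun X -> bmfun Y ->
  \int[P]_t (X t - Y t) = \int[P]_t X t - \int[P]_t Y t.
Proof. by move=> bX bY; rewrite RintegralB//; exact: bmfun_integrable. Qed.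

Lemma bRintegralZl (c : R) X : bmfun X -> \int[P]_t (c * X t) = c * \int[P]_t X t.
Proof. by move=> bX; rewrite RintegralZl//; exact: bmfun_integrable. Qed.

Lemma bRintegralZr (c : R) X : bmfun X -> \int[P]_t (X t * c) = \int[P]_t X t * c.
Proof. by move=> bX; rewrite RintegralZr//; exact: bmfun_integrable. Qed.

Lemma bRintegral_sum I (s : seq I) (Q : pred I) (X : I -> T -> R) :
  (forall i, Q i -> bmfun (X i)) ->
  \int[P]_t (\sum_(i <- s | Q i) X i t) = \sum_(i <- s | Q i) \int[P]_t X i t.
Proof.
move=> bX; elim: s => [|i s IH].
  by under eq_Rintegral do rewrite big_nil; rewrite big_nil RintegralT_cst.
under eq_Rintegral do rewrite big_cons; rewrite big_cons.
case: ifPn => // Qi; rewrite bRintegralD ?IH//; first exact: bX.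
exact: bmfun_sum.
Qed.

Lemma le_bRintegral X Y : bmfun X -> bmfun Y -> (forall t, X t <= Y t) ->
  \int[P]_t X t <= \int[P]_t Y t.
Proof. by move=> bX bY XY; apply: le_Rintegral => //; exact: bmfun_integrable. Qed.

Lemma bRintegral_norm_le X K : measurable_fun [set: T] X ->
  (forall t, `|X t| <= K) -> `|\int[P]_t X t| <= K.
Proof.
move=> mX XK; have bX : bmfun X by split => //; exists K.
rewrite -[leRHS](RintegralT_cst K) ler_norml; apply/andP; split.
  rewrite RintegralT_cst -[leLHS]RintegralT_cst.
  apply: le_bRintegral => //; first exact: bmfun_cst.
  by move=> t; have := XK t; rewrite ler_norml => /andP[].
apply: le_bRintegral => //; first exact: bmfun_cst.
by move=> t; have := XK t; rewrite ler_norml => /andP[].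
Qed.

Lemma bRintegral_indic (A : set T) : measurable A -> \int[P]_t \1_A t = fine (P A).
Proof. by move=> mA; rewrite /Rintegral integral_indic// setIT. Qed.

Lemma sqr_bRintegral_le X : bmfun X -> (\int[P]_t X t) ^+ 2 <= \int[P]_t (X t ^+ 2).
Proof.
move=> bX; set m := \int[P]_t X t.
have : 0 <= \int[P]_t ((X t - m) ^+ 2) by apply: Rintegral_ge0 => t _; exact: sqr_ge0.
have bX2 : bmfun (fun t => X t ^+ 2) by exact: bmfunX.
have -> : \int[P]_t ((X t - m) ^+ 2) =
    \int[P]_t ((X t ^+ 2 - (2 * m) * X t) + m ^+ 2).
  by apply: eq_Rintegral => t _; ring.
rewrite bRintegralD; [|by apply: bmfunB => //; exact: bmfunZ|exact: bmfun_cst].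
rewrite bRintegralB//; last exact: bmfunZ.
rewrite bRintegralZl// RintegralT_cst -/m; lra.
Qed.

End bounded_integral.

(** * Uniform approximation by simple functions *)

Section monotone_class.
Context d (T : measurableType d) (R : realType).

(** The range of [f] is cut into half-open slices of width [e], and each value is replaced by the
    lower end of its slice; [n] is large enough for the slices to cover the range. *)
Lemma bmfun_simple_approx (f : T -> R) (e : R) : bmfun f -> 0 < e ->
  exists (n : nat) (c : 'I_n -> R) (A : 'I_n -> set T),
    (forall i, measurable (A i)) /\
    forall x, `|f x - \sum_(i < n) c i * \1_(A i) x| <= e.
Proof.
move=> [mf [K fK]] e0.
have K1 : 0 <= K + 1 by rewrite addr_ge0// (le_trans (normr_ge0 _) (fK point)).
have [n nK] : exists n : nat, (K + 1) *+ 2 < e *+ n.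
  have := archi_boundP (divr_ge0 (mulrn_wge0 2 K1) (ltW e0)).
  by rewrite ltr_pdivrMr// => h; exists (Num.bound ((K + 1) *+ 2 / e)); rewrite -[e *+ _]mulr_natl.
pose c (i : 'I_n) := - (K + 1) + e *+ i.
exists n, c, (fun i => f @^-1` `[c i, c i + e[%classic).
split=> [i|x].
  by rewrite -[X in measurable X]setTI; apply: mf.
have := fK x; rewrite ler_norml => /andP[fK1 fK2].
have [k [kl ku]] : exists k : 'I_n, c k <= f x < c k + e /\ True.
  have z0 : 0 <= (f x + (K + 1)) / e by rewrite divr_ge0 ?ltW//; lra.
  have /andP[t1 t2] := trunc_itv z0; set k := Num.trunc _ in t1 t2.
  move: t1 t2; rewrite ler_pdivlMr// ltr_pdivrMr// => t1 t2.
  have kn : (k < n)%N.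
    rewrite -(ltr_nat R) -(ltr_pM2r e0) (le_lt_trans t1)//.
    by move: nK; rewrite -(mulr_natl e n); lra.
  exists (Ordinal kn); split => //; rewrite /c /=.
  move: t2; rewrite -natr1 mulrDl mul1r mulr_natl => t2.
  by move: t1; rewrite mulr_natl => t1; apply/andP; split; lra.
rewrite (bigD1 k)//= big1 ?addr0; last first.
  move=> i ik; rewrite indicE memNset ?mulr0//= in_itv/= => /andP[i1 i2].
  move/andP: kl => [k1 k2]; rewrite /c in i1 i2 k1 k2.
  have ck (a b : nat) : (a < b)%N -> e *+ a + e <= e *+ b.
    by move=> ab; rewrite -mulrSr ler_wpMn2l// ltW.
  have [lik|lki|/val_inj/eqP] := ltngtP i k; last by rewrite (negbTE ik).
    by have := ck _ _ lik; lra.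
  by have := ck _ _ lki; lra.
rewrite indicE mem_set/=; last by rewrite /= in_itv.
by rewrite mulr1 ler_norml; move/andP: kl => [k1 k2]; apply/andP; split; lra.
Qed.

End monotone_class.

(** Dominated convergence with a constant dominating function, which is integrable since [P] has
    mass one. *)
Lemma bRintegral_cvg d (T : measurableType d) (R : realType) (P : probability T R)
    (X : nat -> T -> R) (X0 : T -> R) (K : R) :
  (forall n, measurable_fun [set: T] (X n)) -> (forall n t, `|X n t| <= K) ->
  (forall t, X n t @[n --> \oo] --> X0 t) ->
  bmfun X0 /\ \int[P]_t X n t @[n --> \oo] --> \int[P]_t X0 t.
Proof.
move=> mX XK XX0.
have mX0 : measurable_fun [set: T] X0.
  by apply: (measurable_fun_cvg mX) => t _; exact: XX0.
have X0K t : `|X0 t| <= K.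
  have h : `|X n t| @[n --> \oo] --> `|X0 t| by apply: cvg_norm; exact: XX0.
  rewrite -(cvg_lim _ h)//; apply: limr_le; first by apply/cvg_ex; eexists; exact: h.
  by apply: nearW => n; exact: XK.
split; first by split => //; exists K.
have bX0 : bmfun X0 by split => //; exists K.
have [] := @dominated_convergence _ T R P [set: T] measurableT
  (fun n t => (X n t)%:E) (fun t => (X0 t)%:E) (cst K%:E).
- by move=> n; exact/measurable_EFinP.
- exact/measurable_EFinP.
- by apply: aeW => t _; apply: cvg_EFin; [exact: nearW|exact: XX0].
- by apply: (@bmfun_integrable _ _ _ P (fun=> K)); exact: bmfun_cst.
- by apply: aeW => t n _; rewrite /= lee_fin.
move=> _ _; rewrite /= => h.
have {}h : (\int[P]_t X n t)%:E @[n --> \oo] --> (\int[P]_t X0 t)%:E.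
  rewrite EFin_Rintegral//; apply: cvg_trans h; apply: near_eq_cvg; apply: nearW => n.
  by rewrite EFin_Rintegral//; split => //; exists K.
exact: (fine_cvg h).
Qed.

(** * Functionals continuous under bounded pointwise convergence *)

Section bounded_functionals.
Context d (T : measurableType d) (R : realType).
Implicit Types L : (T -> R) -> R.

(** These are the functionals [f |-> \int f dm], [m] a finite signed measure. *)
Definition bclinear L :=
  [/\ forall f g, bmfun f -> bmfun g -> L (fun x => f x + g x) = L f + L g,
      forall (c : R) f, bmfun f -> L (fun x => c * f x) = c * L f &
      forall (f : nat -> T -> R) (g : T -> R) (K : R),
        (forall n, measurable_fun [set: T] (f n)) -> (forall n x, `|f n x| <= K) ->
        (forall x, f n x @[n --> \oo] --> g x) -> L (f n) @[n --> \oo] --> L g].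

Lemma bclinearB L L' : bclinear L -> bclinear L' -> bclinear (fun f => L f - L' f).
Proof.
move=> [LD LZ Lc] [LD' LZ' Lc']; split.
- by move=> f g bf bg; rewrite LD// LD'//; ring.
- by move=> c f bf; rewrite LZ// LZ'//; ring.
- by move=> f g K mf fK fg; apply: cvgB; [exact: (Lc f g K)|exact: (Lc' f g K)].
Qed.

Lemma bclinearZ L (c : R) : bclinear L -> bclinear (fun f => c * L f).
Proof.
move=> [LD LZ Lc]; split.
- by move=> f g bf bg; rewrite LD//; ring.
- by move=> a f bf; rewrite LZ//; ring.
- by move=> f g K mf fK fg; apply: cvgMr; exact: (Lc f g K).
Qed.

(** By linearity [L] vanishes on simple functions. These approximate [f] uniformly, within 1 in
    particular, so they form a bounded sequence along which [L] is continuous. *)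
Lemma bclinear_eq0 L : bclinear L ->
  (forall A, measurable A -> L \1_A = 0) -> forall f, bmfun f -> L f = 0.
Proof.
move=> [LD LZ Lc] L0 f bf.
have approx (n : nat) : exists g : T -> R,
    [/\ bmfun g, L g = 0 & forall x, `|f x - g x| <= n.+1%:R^-1].
  have [m [c [A [mA fA]]]] := bmfun_simple_approx bf (ltac:(by rewrite invr_gt0) :
    0 < n.+1%:R^-1).
  exists (fun x => \sum_(i < m) c i * \1_(A i) x); split => //.
    by apply: bmfun_sum => i _; apply: bmfunZ; exact: bmfun_indic.
  have L00 : L (fun=> 0) = 0.
    by have := LZ 0 (fun=> 0) (bmfun_cst _ 0); rewrite !mul0r.
  have : forall (s : seq 'I_m), L (fun x => \sum_(i <- s) c i * \1_(A i) x) = 0.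
    elim => [|i s IH]; first by rewrite -[RHS]L00; congr L; apply/funext => x; rewrite big_nil.
    under eq_fun do rewrite big_cons.
    rewrite (LD (fun x => c i * \1_(A i) x)); last 2 first.
    - by apply: bmfunZ; exact: bmfun_indic.
    - by apply: bmfun_sum => j _; apply: bmfunZ; exact: bmfun_indic.
    by rewrite IH addr0 LZ ?L0 ?mulr0//; exact: bmfun_indic.
  exact.
pose g n := projT1 (cid (approx n)).
have gP n : [/\ bmfun (g n), L (g n) = 0 & forall x, `|f x - g n x| <= n.+1%:R^-1].
  by rewrite /g; case: cid.
have [mf [K fK]] := bf.
have h : L (g n) @[n --> \oo] --> L f.
  apply: (Lc g f (K + 1)).
  - by move=> n; have [[]] := gP n.
  - move=> n x; have [_ _ /(_ x) h] := gP n.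
    rewrite -[g n x](subKr (f x)) (le_trans (ler_normB _ _))// lerD//.
    by rewrite (le_trans h)// invf_le1// ler1n.
  - move=> x; apply/cvgrPdist_le => e e0.
    have [N _ NP] := near_infty_natSinv_lt (PosNum e0).
    exists N => // n /= Nn; have [_ _ /(_ x) h] := gP n.
    by rewrite (le_trans h)// ltW//; exact: NP.
have h0 : L (g n) @[n --> \oo] --> (0 : R).
  by apply: cvg_near_cst; apply: nearW => n; have [] := gP n.
by rewrite -(cvg_lim _ h)// (cvg_lim _ h0).
Qed.

Lemma cvg_indic_bigcup (F : nat -> set T) : nondecreasing_seq F ->
  forall x, (\1_(F n) x : R) @[n --> \oo] --> (\1_(\bigcup_n F n) x : R).
Proof.
move=> ndF x; have [[N _ FN]|nF] := pselect ((\bigcup_n F n) x).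
  apply: cvg_near_cst; exists N => // n /= Nn; rewrite !indicE !mem_set//.
    by exists N.
  by move/ndF : Nn => /subsetPset; exact.
apply: cvg_near_cst; apply: nearW => n; rewrite !indicE !memNset//.
by apply: contra_not nF => Fx; exists n.
Qed.

End bounded_functionals.

Section bounded_functionals_pair.
Context d1 d2 (T1 : measurableType d1) (T2 : measurableType d2) (R : realType).

Lemma bclinear_pair_eq0 (L : (T1 * T2 -> R) -> R) : bclinear L ->
  (forall A B, measurable A -> measurable B ->
    L (fun z => \1_A z.1 * \1_B z.2) = 0) ->
  forall f, bmfun f -> L f = 0.
Proof.
move=> bL Lrect; apply: bclinear_eq0 => //; have [LD LZ Lc] := bL.
have LI A B : measurable A -> measurable B -> L \1_(A `*` B) = 0.
  move=> mA mB; rewrite -(Lrect A B)//; congr L; apply/funext => -[x y] /=.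
  by rewrite !indicE in_setX/= -natrM mulnb.
move=> A mA.
(* Dynkin's argument: rectangles are stable under intersection and generate the product
   sigma-algebra, while [H] is stable under proper differences by linearity and under increasing
   unions by continuity of [L]. *)
pose H := [set A : set (T1 * T2) | measurable A /\ L \1_A = 0].
suff : <<s [set A `*` B | A in measurable & B in measurable] >> `<=` H.
  by move=> /(_ A); rewrite -measurable_prod_measurableType => /(_ mA)[].
apply: lambda_system_subset => //.
- move=> _ _ [A1 mA1 [B1 mB1 <-]] [A2 mA2 [B2 mB2 <-]].
  rewrite -setXI; exists (A1 `&` A2); first exact: measurableI.
  by exists (B1 `&` B2) => //; exact: measurableI.
- split => //.
  + by split => //; rewrite -setXTT LI.
  + move=> B C CB [mB LB] [mC LC]; split; first exact: measurableD.
    have -> : (\1_(B `\` C) : T1 * T2 -> R) = (fun x => \1_B x + (-1) * \1_C x).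
      apply/funext => x; rewrite !indicE in_setD.
      have [/set_mem Bx|Bx] := boolP (x \in B);
      have [/set_mem Cx|Cx] := boolP (x \in C) => /=; try lra.
      by move/negP: Bx => []; exact/mem_set/CB.
    rewrite LD ?LZ ?LB ?LC ?mulr0 ?addr0//; last apply: bmfunZ; exact: bmfun_indic.
  + move=> F ndF HF; split; first by apply: bigcupT_measurable => n; have [] := HF n.
    have h : L (\1_(F n)) @[n --> \oo] --> L \1_(\bigcup_n F n).
      apply: (Lc (fun n => \1_(F n)) _ 1).
      * by move=> n; apply: measurable_indic; have [] := HF n.
      * by move=> n x; rewrite indicE; case: (_ \in _); rewrite ?normr1 ?normr0.
      * exact: cvg_indic_bigcup.
    rewrite -(cvg_lim _ h)//; apply: cvg_lim => //.
    by apply: cvg_near_cst; apply: nearW => n; have [] := HF n.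
- by move=> _ [B mB [C mC <-]]; split; [exact: measurableX|exact: LI].
Qed.

End bounded_functionals_pair.

(** * Integrating out an independent variable *)

Section integrate_out.
Context d (T : measurableType d) (R : realType) (P : probability T R).

Lemma bclinear_integral d' (T' : measurableType d') (Z : T -> T') (V : T -> R) :
  measurable_fun [set: T] Z -> bmfun V ->
  bclinear (fun f : T' -> R => \int[P]_t (f (Z t) * V t)).
Proof.
move=> mZ bV.
have bZ f : bmfun f -> bmfun (fun t => f (Z t) * V t).
  by move=> [mf fK]; apply: bmfunM => //; exact: bmfun_comp.
split.
- move=> f g bf bg; rewrite -bRintegralD//; [|exact: bZ..].
  by apply: eq_Rintegral => t _; ring.
- move=> c f bf; rewrite -bRintegralZl//; last exact: bZ.
  by apply: eq_Rintegral => t _; ring.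
- move=> f g K mf fK fg.
  have [mV [M VM]] := bV.
  apply: (bRintegral_cvg P (X := fun n t => f n (Z t) * V t) (K := K * M) _ _ _).2.
  + by move=> n; apply: (bZ (f n) _).1; split => //; exists K.
  + by move=> n t; rewrite normrM ler_pM.
  + by move=> t; apply: cvgMl; exact: fg.
Qed.

Context d1 d2 (T1 : measurableType d1) (T2 : measurableType d2).
Variable F : probability T2 R.

Lemma bmfun_Rintegral (f : T1 * T2 -> R) : bmfun f ->
  bmfun (fun x => \int[F]_y f (x, y)).
Proof.
move=> bf; have [mf [K fK]] := bf; split; last first.
  exists K => x; apply: bRintegral_norm_le => //.
  exact: measurableT_comp.
have K0 : 0 <= K by exact: le_trans (normr_ge0 _) (fK point).
(* Tonelli's measurability statement concerns nonnegative functions: shift by [K], then subtract [K]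
   again, [F] having mass one. *)
pose h : T1 * T2 -> \bar R := fun z => (f z + K)%:E.
have mh : measurable_fun [set: T1] (fubini_F F h).
  apply: measurable_fun_fubini_tonelli_F.
  - by apply/measurable_EFinP; exact: measurable_funD.
  - by move=> z; rewrite lee_fin -lerBlDr sub0r; have := fK z; rewrite ler_norml => /andP[].
apply/measurable_EFinP.
rewrite (_ : _ \o _ = (fubini_F F h \- cst K%:E)%E); first exact: emeasurable_funB.
apply/funext => x /=; rewrite /fubini_F/h/=.
have bfx : bmfun (fun y => f (x, y)).
  by split; [exact: measurableT_comp|exists K].
rewrite -EFin_Rintegral; last by apply: bmfunD => //; exact: bmfun_cst.
rewrite bRintegralD//; last exact: bmfun_cst.
by rewrite RintegralT_cst -EFinB addrK.
Qed.

Lemma bclinear_iterated (Z : T -> T1) (W : T -> R) :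
  measurable_fun [set: T] Z -> bmfun W ->
  bclinear (fun f : T1 * T2 -> R => \int[P]_t ((\int[F]_y f (Z t, y)) * W t)).
Proof.
move=> mZ bW; have [LD LZ Lc] := bclinear_integral mZ bW.
have bx (f : T1 * T2 -> R) x : bmfun f -> bmfun (fun y => f (x, y)).
  by move=> [mf [K fK]]; split; [exact: measurableT_comp|exists K].
split.
- move=> f g bf bg; rewrite -(LD (fun x => \int[F]_y f (x, y)) (fun x => \int[F]_y g (x, y))); last 2 first.
  + exact: bmfun_Rintegral.
  + exact: bmfun_Rintegral.
  by apply: eq_Rintegral => t _; rewrite bRintegralD//; exact: bx.
- move=> c f bf; rewrite -(LZ c (fun x => \int[F]_y f (x, y))); last exact: bmfun_Rintegral.
  by apply: eq_Rintegral => t _; rewrite bRintegralZl//; exact: bx.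
- move=> f g K mf fK fg.
  apply: (Lc (fun n x => \int[F]_y f n (x, y)) (fun x => \int[F]_y g (x, y)) K).
  + by move=> n; apply: (bmfun_Rintegral _).1; split => //; exists K.
  + by move=> n x; apply: bRintegral_norm_le => //; exact: measurableT_comp.
  + move=> x; apply: (bRintegral_cvg F (K := K) _ _ _).2 => //.
    by move=> n; exact: measurableT_comp.
Qed.

(** The hypothesis holds as soon as [Y] has law [F] and is independent of
    [(Z, W)]; both sides are bounded-linear functionals of [f], so rectangles
    are enough. *)
Lemma Rintegral_integrate_out (Z : T -> T1) (Y : T -> T2) (W : T -> R) :
  measurable_fun [set: T] Z -> measurable_fun [set: T] Y -> bmfun W ->
  (forall A B, measurable A -> measurable B ->
    \int[P]_t (\1_A (Z t) * \1_B (Y t) * W t) =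
    (\int[P]_t (\1_A (Z t) * W t)) * \int[F]_y \1_B y) ->
  forall f : T1 * T2 -> R, bmfun f ->
    \int[P]_t (f (Z t, Y t) * W t) = \int[P]_t ((\int[F]_y f (Z t, y)) * W t).
Proof.
move=> mZ mY bW ind f bf; apply/eqP; rewrite -subr_eq0; apply/eqP.
apply: (bclinear_pair_eq0 (bclinearB (bclinear_integral (Z := fun t => (Z t, Y t)) _ bW)
  (bclinear_iterated mZ bW))) => //.
  exact: measurable_fun_pair.
move=> A B mA mB /=; rewrite ind//; apply/eqP; rewrite subr_eq0; apply/eqP.
have [mZA _] : bmfun (fun t => \1_A (Z t) : R).
  by have [mA1 KA] := bmfun_indic R mA; exact: bmfun_comp.
rewrite -bRintegralZr; last by apply: bmfunM => //; have [mA1 KA] := bmfun_indic R mA; exact: bmfun_comp.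
apply: eq_Rintegral => t _; rewrite bRintegralZl; last exact: bmfun_indic.
by ring.
Qed.

End integrate_out.

(** * Independent families and the central limit theorem *)

Section independence.
Context d d' (T : measurableType d) (T' : measurableType d') (R : realType).
Variables (P : probability T R) (y : nat -> {RV P >-> T'}).
Hypothesis y_indep : mutually_independent y.

Lemma bmfun_RV (f : T' -> R) i : bmfun f -> bmfun (fun t => f (y i t)).
Proof. by move=> [mf fK]; exact: bmfun_comp. Qed.

(** The product of the indicators is the indicator of the intersection, so this is
    [mutually_independent] for the finite set of indices below [n]; most of the script translates
    between that set and the ordinals. *)
Lemma Rintegral_prod_indic n (A : nat -> set T') : (forall i, measurable (A i)) ->
  \int[P]_t (\prod_(i < n) \1_(A i) (y i t)) =
  \prod_(i < n) \int[P]_t \1_(A i) (y i t).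
Proof.
move=> mA.
have Ji i : (i \in seq_fset tt (index_iota 0 n)) = (i < n)%N.
  by rewrite seq_fsetE mem_index_iota.
have := y_indep (J := seq_fset tt (iota 0 n)) (A := A) (fun i _ => mA i).
rewrite (perm_big _ (seq_fset_perm tt _)) undup_id ?iota_uniq//.
have -> : iota 0 n = index_iota 0 n by rewrite /index_iota subn0.
rewrite big_mkord => h.
have bA i : bmfun (fun t => \1_(A i) (y i t) : R) by apply: bmfun_RV; exact: bmfun_indic.
have PA i : P (y i @^-1` A i) = (\int[P]_t \1_(A i) (y i t))%:E.
  have mpre : measurable (y i @^-1` A i).
    by rewrite -[X in measurable X]setTI; exact: measurable_funPT.
  rewrite EFin_Rintegral// -[in LHS](setIT (y i @^-1` A i)).
  by have := integral_indic P measurableT mpre; move=> <-.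
have capE : \bigcap_(i in [set` seq_fset tt (index_iota 0 n)]) (y i @^-1` A i) =
    \bigcap_(i < n) (y i @^-1` A i).
  apply: eq_bigcapl; split => i ilt; first exact: (eq_ind _ is_true ilt _ (Ji i)).
  exact: (eq_ind _ is_true ilt _ (esym (Ji i))).
rewrite capE in h.
have mcap : measurable (\bigcap_(i < n) (y i @^-1` A i)).
  apply: fin_bigcap_measurable => [|i _]; first exact: finite_II.
  by rewrite -[X in measurable X]setTI; exact: measurable_funPT.
transitivity (fine (P (\bigcap_(i < n) (y i @^-1` A i)))).
  rewrite -bRintegral_indic//; apply: eq_Rintegral => t _.
  rewrite indicE; have [cap|ncap] := boolP (t \in _).
    rewrite big1// => i _; rewrite indicE mem_set//.
    by move/set_mem : cap => /(_ i (ltn_ord i)).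
  have [i Ai] : exists i : 'I_n, ~ A i (y i t).
    apply: contrapT => /forallNP Ai; move/negP : ncap; apply; apply/mem_set => i /= ilt.
    exact: contrapT (Ai (Ordinal ilt)).
  by rewrite (bigD1 i)//= indicE memNset// mul0r.
by rewrite h; under eq_bigr do rewrite PA; rewrite prodEFin.
Qed.

(** Indicators are upgraded to bounded functions one index at a time: in the induction, [r] lists
    the indices at which [f] may be arbitrary, and elsewhere it is an indicator. For the head [k] of
    [r] both sides are bounded functionals of [f k], so [f k] may be taken to be an indicator, which
    is the induction hypothesis. *)
Lemma Rintegral_prod_indep n (f : nat -> T' -> R) : (forall i, bmfun (f i)) ->
  \int[P]_t (\prod_(i < n) f i (y i t)) = \prod_(i < n) \int[P]_t f i (y i t).
Proof.
suff H (r : seq nat) : forall f : nat -> T' -> R, (forall i, bmfun (f i)) ->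
    (forall i, (i < n)%N -> i \in r \/ exists2 A, measurable A & f i = \1_A) ->
    \int[P]_t (\prod_(i < n) f i (y i t)) = \prod_(i < n) \int[P]_t f i (y i t).
  move=> bf; apply: (H (iota 0 n)) => // i ilt; left.
  by rewrite mem_iota/=.
elim: r => [|k r IH] {}f bf fr.
  have /choice[A AP] : forall i, exists A, measurable A /\ ((i < n)%N -> f i = \1_A).
    move=> i; have [ilt|] := boolP (i < n)%N; last by exists setT.
    by have [//|[A mA fA]] := fr i ilt; exists A.
  have := Rintegral_prod_indic n (fun i => (AP i).1).
  under eq_Rintegral do under eq_bigr => i _ do rewrite -(AP i).2//.
  by move=> ->; apply: eq_bigr => i _; apply: eq_Rintegral => t _; rewrite (AP i).2.
have [kn|kn] := ltnP k n; last first.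
  apply: IH => // i ilt; have [|] := fr i ilt; last by right.
  rewrite inE => /predU1P[ik|]; last by left.
  by move: ilt; rewrite ik ltnNge kn.
(* The other factors are frozen. The factor 1 in the second integral gives it the shape expected by
   [bclinear_integral]. *)
pose L (g : T' -> R) := \int[P]_t (g (y k t) * \prod_(i < n | i != Ordinal kn) f i (y i t)) -
  (\prod_(i < n | i != Ordinal kn) \int[P]_t f i (y i t)) *
  \int[P]_t (g (y k t) * 1).
suff : L (f k) = 0.
  move/eqP; rewrite subr_eq0 => /eqP Lk.
  rewrite [RHS](bigD1 (Ordinal kn))//= [RHS]mulrC.
  under eq_Rintegral do rewrite (bigD1 (Ordinal kn))//=.
  by rewrite Lk; congr (_ * _); apply: eq_Rintegral => t _; rewrite mulr1.
apply: bclinear_eq0 (bf k).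
  apply: bclinearB; first apply: bclinear_integral => //.
    by apply: bmfun_prod => i _; exact: bmfun_RV.
  apply: bclinearZ; apply: bclinear_integral => //; exact: bmfun_cst.
move=> A mA; apply/eqP; rewrite subr_eq0; apply/eqP.
pose g i := if i == k then \1_A : T' -> R else f i.
have := IH g.
have gk : g k = \1_A by rewrite /g eqxx.
rewrite [\prod_(_ < _) _](bigD1 (Ordinal kn))//= gk.
under eq_Rintegral do rewrite (bigD1 (Ordinal kn))//= gk.
have gE (i : 'I_n) : i != Ordinal kn -> g i = f i.
  by move=> /negbTE ik; rewrite /g; move: ik; rewrite -val_eqE/= => ->.
under eq_Rintegral do under eq_bigr => i ik do rewrite gE//.
move=> ->; first by rewrite mulrC; congr (_ * _);
  [by apply: eq_bigr => i ik; rewrite gE|by apply: eq_Rintegral => t _; rewrite mulr1].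
  by move=> i; rewrite /g; case: ifP => // _; exact: bmfun_indic.
move=> i ilt; rewrite /g; case: eqP => [_|/eqP ik]; first by right; exists A.
have [|] := fr i ilt; last by right.
by rewrite inE (negbTE ik)/=; left.
Qed.

End independence.

(** * Taylor bounds for sine, cosine and exponential *)

Section trigo_bounds.
Variable R : realType.
Implicit Types x : R.

Lemma norm_sin_le x : `|sin x| <= `|x|.
Proof.
wlog x0 : x / 0 <= x => [h|].
  by have [/h//|/ltW] := leP 0 x; rewrite -oppr_ge0 => /h; rewrite sinN !normrN.
have [|u] := @MVT_segment R sin cos 0 x x0.
  by apply: continuous_subspaceT => w; exact: continuous_sin.
by rewrite sin0 !subr0 => _ ->; rewrite normrM ler_piMl// cos_max.
Qed.

Lemma one_sub_cosE x : 1 - cos x = 2 * sin (x / 2) ^+ 2.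
Proof.
have -> : cos x = cos ((x / 2) *+ 2) by rewrite -[_ *+ 2]mulr_natr divfK.
by rewrite cos_mulr2n cos2sin2; ring.
Qed.

Lemma one_sub_cos_le x : 1 - cos x <= x ^+ 2 / 2.
Proof.
rewrite one_sub_cosE.
have : sin (x / 2) ^+ 2 <= (x / 2) ^+ 2.
  by rewrite -[leLHS]real_normK ?num_real// -[leRHS]real_normK ?num_real// ler_sqr ?nnegrE// norm_sin_le.
by rewrite expr_div_n; lra.
Qed.

(** Mean value theorem: the derivative [1 - cos c] lies between 0 and x^2 / 2. The constant is not
    sharp; only the cubic order matters. *)
Let sub_sin_bounds x : 0 <= x -> 0 <= x - sin x <= x ^+ 3 / 2.
Proof.
move=> x0.
have [|c] := @MVT_segment R (fun z => z - sin z) (fun z => 1 - cos z) 0 x x0.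
  apply: continuous_subspaceT => z; apply: continuousB; first exact: cvg_id.
  exact: continuous_sin.
rewrite in_itv/= => /andP[c0 cx]; rewrite sin0 !subr0 => ->.
have := cos_le1 c; have cc := one_sub_cos_le c => c1.
apply/andP; split; first by rewrite mulr_ge0//; lra.
have -> : x ^+ 3 / 2 = x ^+ 2 / 2 * x by field.
rewrite ler_wpM2r// (le_trans cc)// ler_wpM2r ?invr_ge0// ler_sqr ?nnegrE//.
Qed.

Lemma norm_sub_sin_le x : `|x - sin x| <= `|x| ^+ 3 / 2.
Proof.
have [x0|/ltW] := leP 0 x.
  have /andP[h1 h2] := sub_sin_bounds x0.
  by rewrite [in leLHS]ger0_norm// ger0_norm.
rewrite -oppr_ge0 => x0; have /andP[h1 h2] := sub_sin_bounds x0.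
have e : - x - sin (- x) = - (x - sin x) by rewrite sinN; ring.
by rewrite -normrN -(normrN x) -e [in leLHS]ger0_norm// ger0_norm.
Qed.

(** By the half-angle formula the remainder is 2 ((x/2)^2 - sin(x/2)^2), a difference of squares:
    one factor is cubic by [norm_sub_sin_le], the other at most |x|. *)
Lemma cos_taylor2 x : 0 <= cos x - (1 - x ^+ 2 / 2) <= x ^+ 4 / 8.
Proof.
apply/andP; split; first by have := one_sub_cos_le x; lra.
have -> : cos x - (1 - x ^+ 2 / 2) = 2 * ((x / 2 - sin (x / 2)) * (x / 2 + sin (x / 2))).
  by rewrite -[in LHS](subKr 1 (cos x)) one_sub_cosE; field.
rewrite (le_trans (ler_norm _))// normrM ger0_norm// normrM.
have n2 : `|2^-1| = 2^-1 :> R by rewrite ger0_norm ?invr_ge0.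
have h1 := norm_sub_sin_le (x / 2).
have h2 : `|x / 2 + sin (x / 2)| <= `|x|.
  rewrite (le_trans (ler_normD _ _))// (le_trans (lerD (lexx _) (norm_sin_le _)))//.
  by rewrite -mulr2n normrM -[_ *+ 2]mulr_natr n2 divfK.
apply: le_trans (_ : 2 * ((`|x / 2| ^+ 3 / 2) * `|x|) <= _).
  by rewrite ler_wpM2l// ler_pM.
rewrite normrM n2.
rewrite -[x ^+ 4]/(x ^+ (2 * 2)) exprM -(real_normK (num_real x)) -exprM.
by rewrite le_eqVlt; apply/orP; left; apply/eqP; field.
Qed.

(** With E = exp(-x), the inequality E (1 + x) <= 1 gives E - 1 + x <= x (1 - E), and 1 - E <= x. *)
Lemma expRN_taylor1 x : 0 <= x -> 0 <= expR (- x) - (1 - x) <= x ^+ 2.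
Proof.
move=> x0; apply/andP; split; first by have := expR_ge1Dx (- x); lra.
have h : expR (- x) * (1 + x) <= 1.
  by have := ler_wpM2l (expR_ge0 (- x)) (expR_ge1Dx x); rewrite [X in _ <= X]mulrC expRxMexpNx_1.
have : expR (- x) <= 1 by rewrite -[leRHS]expR0 ler_expR oppr_le0.
have : x * (expR (- x) - (1 - x)) >= 0.
  by rewrite mulr_ge0//; have := expR_ge1Dx (- x); lra.
by have -> : x ^+ 2 = x * x by []; nra.
Qed.

Lemma cvg_sqrtV : (Num.sqrt (n%:R : R))^-1 @[n --> \oo] --> (0 : R).
Proof.
apply/cvgrPdist_lt => e e0; near=> n.
have n0 : 0 < (n%:R : R) by rewrite ltr0n; near: n; exact: nbhs_infty_gt.
rewrite sub0r normrN ger0_norm ?invr_ge0 ?sqrtr_ge0//.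
rewrite invf_plt ?posrE ?sqrtr_gt0// -(ger0_norm (ltW (_ : 0 < e^-1))) ?invr_gt0//.
rewrite -sqrtr_sqr ltr_sqrt//; near: n.
exists (Num.bound (e^-1 ^+ 2)) => // n /= nB.
by rewrite (lt_le_trans (archi_boundP _)) ?sqr_ge0// ler_nat.
Unshelve. all: by end_near. Qed.

End trigo_bounds.

(** * Powers of complex numbers in real coordinates *)

Section complex_power.
Variable R : realType.
Implicit Types c s e : R.

(** Real and imaginary parts of [(c + i s) ^ n]. *)
Fixpoint cpow c s n : R * R :=
  if n is n'.+1 then
    let z := cpow c s n' in (z.1 * c - z.2 * s, z.2 * c + z.1 * s)
  else (1, 0).

(** Real form of |z^n - e^n| <= n |z - e| in the unit disc. All powers of z stay in the disc because
    the modulus is multiplicative, so each further factor adds an error of at most |c - e| + |s| to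
    the real part and |s| to the imaginary part. *)
Lemma cpow_approx c s e n : c ^+ 2 + s ^+ 2 <= 1 -> `|e| <= 1 ->
  `|(cpow c s n).1 - e ^+ n| <= n%:R * (`|c - e| + `|s|) /\
  `|(cpow c s n).2| <= n%:R * `|s|.
Proof.
move=> cs e1.
have sqr_le1 a b : a ^+ 2 + b ^+ 2 <= 1 -> `|a| <= 1 /\ `|b| <= 1 :> R.
  move=> ab; split; rewrite -(@expr_le1 _ 2)// real_normK ?num_real//.
    by have := sqr_ge0 b; lra.
  by have := sqr_ge0 a; lra.
have [c1 s1] := sqr_le1 _ _ cs.
have norm1 m : (cpow c s m).1 ^+ 2 + (cpow c s m).2 ^+ 2 <= 1.
  elim: m => [|m IH] /=; first by rewrite expr1n expr0n addr0.
  set a := (cpow c s m).1 in IH *; set b := (cpow c s m).2 in IH *.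
  have -> : (a * c - b * s) ^+ 2 + (b * c + a * s) ^+ 2 =
    (a ^+ 2 + b ^+ 2) * (c ^+ 2 + s ^+ 2) by ring.
  by rewrite mulr_ile1// addr_ge0// sqr_ge0.
elim: n => [|n [IH1 IH2]] /=.
  by rewrite expr0 subrr normr0 !mul0r.
have [a1 b1] := sqr_le1 _ _ (norm1 n).
set a := (cpow c s n).1 in IH1 a1 *; set b := (cpow c s n).2 in IH2 b1 *.
have en : `|e ^+ n| <= 1 by rewrite normrX exprn_ile1.
split.
  have -> : a * c - b * s - e ^+ n.+1 = (a - e ^+ n) * c + e ^+ n * (c - e) - b * s.
    by rewrite exprSr; ring.
  rewrite -natr1 [X in _ <= X]mulrDl mul1r (le_trans (ler_normB _ _))//.
  rewrite (le_trans (lerD (ler_normD _ _) (lexx _)))//.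
  rewrite -addrA lerD//; first by rewrite normrM (le_trans _ IH1)// ler_piMr.
  by rewrite !normrM lerD// ler_piMl.
rewrite -natr1 [X in _ <= X]mulrDl mul1r (le_trans (ler_normD _ _))// !normrM lerD//.
  by rewrite (le_trans _ IH2)// ler_piMr.
by rewrite ler_piMl.
Qed.

End complex_power.

(** * Characteristic functions of i.i.d. sums and the central limit theorem *)

Section identical_law.
Context d d' (T : measurableType d) (T' : measurableType d') (R : realType).
Variables (P : probability T R) (y : nat -> {RV P >-> T'}) (F : probability T' R).
Hypothesis y_dist : forall i (A : set T'), measurable A -> distribution P (y i) A = F A.

Lemma Rintegral_law i (f : T' -> R) : bmfun f ->
  \int[P]_t f (y i t) = \int[F]_x f x.
Proof.
move=> bf; apply/eqP; rewrite -subr_eq0.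
pose L (g : T' -> R) := \int[P]_t (g (y i t) * 1) - \int[F]_x (g x * 1).
have <- : L f = \int[P]_t f (y i t) - \int[F]_x f x.
  by congr (_ - _); apply: eq_Rintegral => t _; rewrite mulr1.
apply/eqP; apply: bclinear_eq0 bf.
  by apply: bclinearB; apply: bclinear_integral => //; exact: bmfun_cst.
move=> A mA; apply/eqP; rewrite subr_eq0; apply/eqP.
have mpre : measurable (y i @^-1` A).
  by rewrite -[X in measurable X]setTI; exact: measurable_funPT.
transitivity (fine (P (y i @^-1` A))).
  by rewrite -bRintegral_indic//; apply: eq_Rintegral => t _; rewrite mulr1.
have := y_dist i mA; rewrite /distribution/= /pushforward => ->.
by rewrite -bRintegral_indic//; apply: eq_Rintegral => t _; rewrite mulr1.
Qed.

Hypothesis y_indep : mutually_independent y.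

Let bmfun_cossum (g : T' -> R) n : bmfun g ->
  bmfun (fun t => cos (\sum_(i < n) g (y i t))) /\
  bmfun (fun t => sin (\sum_(i < n) g (y i t))).
Proof.
move=> bg; have ms : measurable_fun [set: T] (fun t => \sum_(i < n) g (y i t)).
  have [] // := @bmfun_sum _ T R _ (index_enum 'I_n) xpredT (fun i t => g (y i t)).
  by move=> i _; exact: (bmfun_RV y i).
by split; [exact: bmfun_cos|exact: bmfun_sin].
Qed.

(** The characteristic function of an i.i.d. sum is a power, in real form. *)
Lemma Rintegral_cpow (g : T' -> R) n : bmfun g ->
  (\int[P]_t cos (\sum_(i < n) g (y i t)), \int[P]_t sin (\sum_(i < n) g (y i t))) =
  cpow (\int[F]_x cos (g x)) (\int[F]_x sin (g x)) n.
Proof.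
move=> bg; have [mg _] := bg.
have bc : bmfun (fun x => cos (g x)) by exact: bmfun_cos.
have bs : bmfun (fun x => sin (g x)) by exact: bmfun_sin.
set c := \int[F]_x cos (g x); set s := \int[F]_x sin (g x).
(* The first [k] terms are gathered in a cosine or sine and the other indices carry arbitrary
   factors. With the factor at [k] taken to be the cosine or sine of [g], the addition formulas
   absorb it into the sum. *)
suff H k : (k <= n)%N -> forall f : nat -> T' -> R, (forall i, bmfun (f i)) ->
    \int[P]_t (cos (\sum_(i < k) g (y i t)) * \prod_(k <= i < n) f i (y i t)) =
      (cpow c s k).1 * \prod_(k <= i < n) \int[F]_x f i x /\
    \int[P]_t (sin (\sum_(i < k) g (y i t)) * \prod_(k <= i < n) f i (y i t)) =
      (cpow c s k).2 * \prod_(k <= i < n) \int[F]_x f i x.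
  have E0 (G : nat -> R) : \prod_(n <= i < n) G i = 1 by rewrite big_geq.
  have [] := H n (leqnn n) (fun _ _ => 1) (fun=> bmfun_cst _ 1).
  rewrite !E0 !mulr1 => h1 h2; rewrite [RHS]surjective_pairing -h1 -h2.
  by congr (_, _); apply: eq_Rintegral => t _; rewrite mulr1.
elim: k => [_|k IH kn] f bf.
  split; last first.
    by rewrite mul0r -[RHS](RintegralT_cst P); apply: eq_Rintegral => t _; rewrite big_ord0 sin0 mul0r.
  rewrite mul1r big_mkord.
  under [RHS]eq_bigr => i _ do rewrite -(Rintegral_law i (bf i)).
  rewrite -(Rintegral_prod_indep y_indep n bf); apply: eq_Rintegral => t _.
  by rewrite big_ord0 cos0 mul1r big_mkord.
pose fc (h : T' -> R) i := if i == k then h else f i.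
have bfc h i : bmfun h -> bmfun (fc h i) by rewrite /fc; case: ifP.
have prodE h (G : nat -> (T' -> R) -> R) :
    \prod_(k <= i < n) G i (fc h i) = G k h * \prod_(k.+1 <= i < n) G i (f i).
  rewrite big_ltn// {1}/fc eqxx; congr (_ * _); apply: eq_big_nat => i /andP[ki _].
  by rewrite /fc gtn_eqF.
have [cc sc] := IH (ltnW kn) (fc (fun x => cos (g x))) (fun i => bfc _ i bc).
have [cs ss] := IH (ltnW kn) (fc (fun x => sin (g x))) (fun i => bfc _ i bs).
have bprod (h : nat -> T' -> R) : (forall i, bmfun (h i)) ->
    bmfun (fun t => \prod_(k <= i < n) h i (y i t)).
  by move=> bh; apply: bmfun_prod => i _; exact: (bmfun_RV y i).
have [bC bS] := bmfun_cossum k bg.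
rewrite (prodE _ (fun i h => \int[F]_x h x)) in cc sc.
rewrite (prodE _ (fun i h => \int[F]_x h x)) in cs ss.
split => /=.
  rewrite mulrBl -!mulrA -cc -ss -bRintegralB; last 2 first.
  - by apply: bmfunM => //; apply: bprod => i; exact: bfc.
  - by apply: bmfunM => //; apply: bprod => i; exact: bfc.
  apply: eq_Rintegral => t _.
  rewrite (prodE _ (fun i h => h (y i t))) (prodE _ (fun i h => h (y i t))).
  by rewrite big_ord_recr/= cosD; ring.
rewrite mulrDl -!mulrA -sc -cs -bRintegralD; last 2 first.
- by apply: bmfunM => //; apply: bprod => i; exact: bfc.
- by apply: bmfunM => //; apply: bprod => i; exact: bfc.
apply: eq_Rintegral => t _.
rewrite (prodE _ (fun i h => h (y i t))) (prodE _ (fun i h => h (y i t))).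
by rewrite big_ord_recr/= sinD; ring.
Qed.

(** The transform of one term is [(c n, s n)], with [c n] = 1 - h^2 v / 2 + O(h^4) and [s n] =
    O(h^3) for h = 1 / sqrt n. By [cpow_approx] the n-th power then errs by n (O(h^4) + O(h^3)) =
    O(h). *)
Lemma clt_cos_sin (g : T' -> R) (v : R) : bmfun g -> \int[F]_x g x = 0 ->
  v = \int[F]_x (g x ^+ 2) ->
  let S n t := (Num.sqrt n%:R)^-1 * \sum_(i < n) g (y i t) in
  \int[P]_t cos (S n t) @[n --> \oo] --> expR (- (v / 2)) /\
  \int[P]_t sin (S n t) @[n --> \oo] --> (0 : R).
Proof.
move=> bg g0 vE S; have [mg [K gK]] := bg.
have K0 : 0 <= K by exact: le_trans (normr_ge0 _) (gK point).
have v0 : 0 <= v by rewrite vE; apply: Rintegral_ge0 => x _; exact: sqr_ge0.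
pose h n : R := (Num.sqrt n%:R)^-1.
have h0 n : 0 <= h n by rewrite invr_ge0 sqrtr_ge0.
have hn n : (0 < n)%N -> n%:R * h n ^+ 2 = 1.
  by move=> n0; rewrite /h exprVn sqr_sqrtr// mulfV// pnatr_eq0 -lt0n.
pose c n := \int[F]_x cos (h n * g x).
pose s n := \int[F]_x sin (h n * g x).
have mhg n : measurable_fun [set: T'] (fun x => h n * g x) by exact: measurable_funM.
have cpowE n : (\int[P]_t cos (S n t), \int[P]_t sin (S n t)) = cpow (c n) (s n) n.
  rewrite -Rintegral_cpow; last exact: bmfunZ.
  by congr (_, _); apply: eq_Rintegral => t _; rewrite /S mulr_sumr.
(* Jensen's inequality for the square, then cos^2 + sin^2 = 1. *)
have cs1 n : c n ^+ 2 + s n ^+ 2 <= 1.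
  rewrite (le_trans (lerD (sqr_bRintegral_le _ (bmfun_cos (mhg n)))
    (sqr_bRintegral_le _ (bmfun_sin (mhg n)))))// -bRintegralD; last 2 first.
  - by apply: bmfunX; exact: bmfun_cos.
  - by apply: bmfunX; exact: bmfun_sin.
  by under eq_Rintegral do rewrite cos2Dsin2; rewrite RintegralT_cst.
have cB n : `|c n - (1 - h n ^+ 2 * v / 2)| <= h n ^+ 4 * (K ^+ 4 / 8).
  have -> : c n - (1 - h n ^+ 2 * v / 2) =
      \int[F]_x (cos (h n * g x) - (1 - (h n * g x) ^+ 2 / 2)).
    rewrite bRintegralB; last 2 first.
    - exact: bmfun_cos.
    - apply: bmfunB; first exact: bmfun_cst.
      by under eq_fun do rewrite mulrC; apply: bmfunZ; apply: bmfunX; exact: bmfunZ.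
    congr (_ - _).
    under eq_Rintegral do rewrite exprMn mulrAC.
    rewrite bRintegralB; [|exact: bmfun_cst|by apply: bmfunZ; exact: bmfunX].
    rewrite RintegralT_cst bRintegralZl -?vE; last exact: bmfunX.
    by rewrite mulrAC.
  apply: bRintegral_norm_le.
    apply: measurable_funB; first by have [] := bmfun_cos (mhg n).
    apply: measurable_funB => //; apply: measurable_funM => //; exact: measurable_funX.
  move=> x; have /andP[p1 p2] := cos_taylor2 (h n * g x).
  rewrite ger0_norm// (le_trans p2)// exprMn -mulrA ler_wpM2l ?exprn_ge0//.
  rewrite ler_wpM2r ?invr_ge0//.
  rewrite -[g x ^+ 4]/(g x ^+ (2 * 2)) exprM -(real_normK (num_real (g x))) -exprM.
  by rewrite lerXn2r ?nnegrE.
(* The mean of [g] is zero, so the linear term of the sine integrates to zero. *)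
have sB n : `|s n| <= h n ^+ 3 * (K ^+ 3 / 2).
  have -> : s n = - \int[F]_x (h n * g x - sin (h n * g x)).
    rewrite bRintegralB; [|exact: bmfunZ|exact: bmfun_sin].
    by rewrite bRintegralZl// g0 mulr0 sub0r opprK.
  rewrite normrN; apply: bRintegral_norm_le.
    by apply: measurable_funB => //; have [] := bmfun_sin (mhg n).
  move=> x; rewrite (le_trans (norm_sub_sin_le _))// normrM (ger0_norm (h0 n)) exprMn.
  rewrite -mulrA ler_wpM2l ?exprn_ge0// ler_wpM2r ?invr_ge0//.
  by rewrite lerXn2r ?nnegrE.
(* The comparison value is this exponential rather than 1 - h^2 v / 2: its n-th power is exactly the
   limit, and it is at most 1 for every [n]. *)
pose e n := expR (- (h n ^+ 2 * v / 2)).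
have eB n : `|e n - (1 - h n ^+ 2 * v / 2)| <= h n ^+ 4 * (v ^+ 2 / 4).
  have /expRN_taylor1/andP[p1 p2] : 0 <= h n ^+ 2 * v / 2.
    by rewrite divr_ge0// mulr_ge0// sqr_ge0.
  by rewrite ger0_norm// (le_trans p2)//; rewrite le_eqVlt; apply/orP; left; apply/eqP; field.
have e1 n : `|e n| <= 1.
  rewrite ger0_norm ?expR_ge0// -[leRHS]expR0 ler_expR oppr_le0.
  by rewrite divr_ge0// mulr_ge0// sqr_ge0.
have en n : (0 < n)%N -> e n ^+ n = expR (- (v / 2)).
  move=> n0; rewrite -expRM_natl; congr expR.
  have -> : n%:R * - (h n ^+ 2 * v / 2) = - (n%:R * h n ^+ 2 * (v / 2)) by ring.
  by rewrite hn// mul1r.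
have hlim : h n @[n --> \oo] --> (0 : R) by exact: cvg_sqrtV.
pose A := K ^+ 4 / 8 + v ^+ 2 / 4; pose B := K ^+ 3 / 2.
have lim2 : h n ^+ 2 * A + h n * B @[n --> \oo] --> (0 : R).
  have -> : (0 : R) = 0 ^+ 2 * A + 0 * B by rewrite expr0n/= !mul0r addr0.
  apply: cvgD; apply: cvgMl => //.
  exact: (cvg_comp _ _ hlim (@exprn_continuous _ 2 0)).
have s_le n : (0 < n)%N -> n%:R * `|s n| <= h n * B.
  move=> n0; rewrite (le_trans (ler_wpM2l _ (sB n)))//.
  have -> : n%:R * (h n ^+ 3 * (K ^+ 3 / 2)) = (n%:R * h n ^+ 2) * (h n * B) by rewrite /B; ring.
  by rewrite hn// mul1r.
have c_le n : (0 < n)%N -> n%:R * `|c n - e n| <= h n ^+ 2 * A.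
  move=> n0.
  have : `|c n - e n| <= h n ^+ 4 * A.
    have -> : c n - e n = (c n - (1 - h n ^+ 2 * v / 2)) - (e n - (1 - h n ^+ 2 * v / 2)) by ring.
    by rewrite (le_trans (ler_normB _ _))// mulrDr lerD.
  move=> /(ler_wpM2l (ler0n R n))/le_trans; apply.
  have -> : n%:R * (h n ^+ 4 * A) = (n%:R * h n ^+ 2) * (h n ^+ 2 * A) by ring.
  by rewrite hn// mul1r.
have A0 : 0 <= A by rewrite addr_ge0// divr_ge0// exprn_ge0.
have B0 : 0 <= B by rewrite divr_ge0// exprn_ge0.
split; apply/cvgrPdist_le => eps eps0; near=> n.
all: have n0 : (0 < n)%N by near: n; exact: nbhs_infty_gt.
all: have hB : h n ^+ 2 * A + h n * B <= eps
  by rewrite -[leLHS]ger0_norm ?addr_ge0 ?mulr_ge0 ?sqr_ge0// -[X in `|X|]subr0 distrC; near: n;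
     move/cvgrPdist_le : lim2; exact.
all: have [r1 r2] := cpow_approx n (cs1 n) (e1 n).
all: move: r1 r2; rewrite -cpowE /= en// => r1 r2.
- rewrite distrC (le_trans r1)// (le_trans _ hB)// mulrDr lerD//; [exact: c_le|exact: s_le].
- rewrite sub0r normrN (le_trans r2)// (le_trans _ hB)// (le_trans (s_le _ n0))//.
  by rewrite lerDr mulr_ge0 ?sqr_ge0.
Unshelve. all: by end_near. Qed.

End identical_law.

Import HBNNSimple.

(** * Normal laws *)

(** Both sides are monotone limits over the same simple functions, on which the equality is the
    hypothesis on sets. *)
Lemma ge0_integral_density d (T : measurableType d) (R : realType)
    (mu nu : {measure set T -> \bar R}) (p : T -> R) :
  measurable_fun [set: T] p -> (forall x, 0 <= p x) ->
  (forall A, measurable A -> nu A = (\int[mu]_(x in A) (p x)%:E)%E) ->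
  forall f : T -> \bar R, measurable_fun [set: T] f -> (forall x, 0 <= f x)%E ->
  (\int[nu]_x f x = \int[mu]_x (f x * (p x)%:E))%E.
Proof.
move=> mp p0 nuE f mf f0.
have mEp : measurable_fun [set: T] (EFin \o p) by exact/measurable_EFinP.
pose f_ := nnsfun_approx measurableT mf.
transitivity (lim (\int[nu]_x (f_ n x)%:E @[n --> \oo])%E).
  rewrite -monotone_convergence//=.
  - by apply: eq_integral => x _; apply/esym/cvg_lim => //=; exact: cvg_nnsfun_approx.
  - by move=> n; exact/measurable_EFinP/measurable_funTS.
  - by move=> n ? _; rewrite lee_fin.
  - by move=> ? _ ? ? mn; rewrite lee_fin; exact/lefP/nd_nnsfun_approx.
transitivity (lim (\int[mu]_x ((f_ n x)%:E * (p x)%:E) @[n --> \oo])%E); last first.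
  rewrite -monotone_convergence//=.
  - apply: eq_integral => x _; apply/cvg_lim => //=.
    by apply: cvgeZr => //; exact: cvg_nnsfun_approx.
  - by move=> n; apply: emeasurable_funM => //; exact/measurable_EFinP/measurable_funTS.
  - by move=> n x _; rewrite mule_ge0// lee_fin.
  - move=> x _ a b ab; rewrite -!EFinM lee_fin ler_wpM2r//.
    exact/lefP/nd_nnsfun_approx.
apply: congr_lim; apply/funext => n /=.
rewrite integralT_nnsfun sintegralE.
under [RHS]eq_integral => x _.
  rewrite fimfunE -fsumEFin// ge0_mule_fsuml; last first.
    by move=> k; exact: nnfun_muleindic_ge0.
  over.
have mpre k : measurable (f_ n @^-1` [set k]) by exact: measurable_sfunP.
rewrite ge0_integral_fsum//; last 2 first.
- move=> k; apply: emeasurable_funM => //.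
  by apply/measurable_EFinP/measurable_funM => //; exact: measurable_indic.
- by move=> k x _; rewrite mule_ge0// ?lee_fin//; exact: nnfun_muleindic_ge0.
apply: eq_fsbigr => k /[!inE] -[t _ <-].
under [RHS]eq_integral do rewrite EFinM -muleA.
rewrite ge0_integralZl//; last 3 first.
- by apply: emeasurable_funM => //; apply/measurable_EFinP; exact: measurable_indic.
- by move=> x _; rewrite mule_ge0// lee_fin.
- by rewrite lee_fin.
congr (_ * _)%E; rewrite nuE// [LHS]integral_mkcond; apply: eq_integral => x _.
by rewrite patchE indicE; case: ifPn => // _; rewrite ?mul1e ?mul0e.
Qed.

(** * Lebesgue measure under affine maps *)

Section lebesgue_affine.
Variable R : realType.
Notation mu := (@lebesgue_measure R).

Lemma measurable_affine (a b : R) :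
  measurable_fun [set: R] (fun x => a * x + b : measurableTypeR R).
Proof. by apply: measurable_funD => //; exact: measurable_funM. Qed.

(** By uniqueness of Lebesgue measure it is enough to compare it with |a| times the pushforward on
    intervals ]x, y]; for negative [a] the preimage is closed on the left and open on the right. *)
Lemma lebesgue_measure_affine (a b : R) (A : set R) : a != 0 -> measurable A ->
  mu ((fun x => a * x + b) @^-1` A) = (`|a|^-1%:E * mu A)%E.
Proof.
move=> a0 mA; have an : 0 < `|a| by rewrite normr_gt0.
pose f x : measurableTypeR R := a * x + b.
have mf : measurable_fun [set: measurableTypeR R] f by exact: measurable_affine.
pose nu : {measure set (measurableTypeR R) -> \bar R} :=
  mscale (NngNum (ltW an))
    (measure_function_pushforward__canonical__measure_function_Measure mu mf).
suff -> : mu A = nu A.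
  by rewrite /nu/= /mscale/= muleA -EFinM mulVf ?mul1e// gt_eqF.
apply: lebesgue_measure_unique => // _ [[x y] _ <-].
rewrite /nu/= /mscale/= /pushforward.
move: a0; rewrite neq_lt => /orP[a0|a0].
  have -> : f @^-1` `]x, y] = `[(y - b) / a, (x - b) / a[%classic.
    apply/seteqP; split => z /=; rewrite !in_itv/= /f => /andP[h1 h2]; apply/andP; split.
    - by rewrite ler_ndivrMr// mulrC lerBrDr.
    - by rewrite ltr_ndivlMr// mulrC ltrBlDr.
    - by move: h2; rewrite ltr_ndivlMr// ltrBlDr mulrC.
    - by move: h1; rewrite ler_ndivrMr// lerBrDr mulrC.
  rewrite !lebesgue_measure_itv/= !lte_fin ltr_nM2r ?invr_lt0// ltrD2r.
  case: ifPn => xy; last by rewrite mule0.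
  rewrite -!EFinB -EFinM ltr0_norm//; congr (_%:E); field; exact: ltr0_neq0.
have -> : f @^-1` `]x, y] = `](x - b) / a, (y - b) / a]%classic.
  apply/seteqP; split => z /=; rewrite !in_itv/= /f => /andP[h1 h2]; apply/andP; split.
  - by rewrite ltr_pdivrMr// mulrC ltrBlDr.
  - by rewrite ler_pdivlMr// mulrC lerBrDr.
  - by move: h1; rewrite ltr_pdivrMr// ltrBlDr mulrC.
  - by move: h2; rewrite ler_pdivlMr// lerBrDr mulrC.
rewrite !lebesgue_measure_itv/= !lte_fin ltr_pM2r ?invr_gt0// ltrD2r.
case: ifPn => xy; last by rewrite mule0.
by rewrite -!EFinB -EFinM gtr0_norm//; congr (_%:E); field; exact: lt0r_neq0.
Qed.

Lemma ge0_integral_affine (a b : R) (A : set R) (f : R -> \bar R) : a != 0 ->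
  measurable A -> measurable_fun [set: R] f -> (forall x, 0 <= f x)%E ->
  (\int[mu]_(x in (fun x => a * x + b)%R @^-1` A) f (a * x + b)%R =
   `|a|^-1%:E * \int[mu]_(x in A) f x)%E.
Proof.
move=> a0 mA mf f0; have an : 0 <= `|a|^-1 by rewrite invr_ge0.
pose g x : measurableTypeR R := a * x + b.
have mg : measurable_fun [set: measurableTypeR R] g by exact: measurable_affine.
rewrite -[RHS](@ge0_integral_mscale _ _ R mu A mA (NngNum an))//; last exact: measurable_funTS.
transitivity (\int[pushforward mu g]_(y in A) f y)%E.
  by rewrite ge0_integral_pushforward//; exact: measurable_funTS.
apply: eq_measure_integral => B mB _.
by rewrite /= /mscale/= /pushforward -(lebesgue_measure_affine b).
Qed.

End lebesgue_affine.

(** * Scaling and convolution of normal densities *)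

Section normal.
Variable R : realType.
Notation mu := (@lebesgue_measure R).
Implicit Types s m v w : R.

Lemma normal_peakE s : normal_peak s = `|s|^-1 * (Num.sqrt (pi *+ 2))^-1.
Proof. by rewrite /normal_peak -mulrnAr sqrtrM ?sqr_ge0// sqrtr_sqr invfM. Qed.

Lemma normal_pdf_scale s (c : R) : s != 0 -> c != 0 ->
  forall x, normal_pdf 0 s x = `|c| * normal_pdf 0 (c * s) (c * x).
Proof.
move=> s0 c0 x; rewrite !normal_pdfE ?mulf_neq0// mulrA; congr (_ * _).
  by rewrite !normal_peakE normrM invfM !mulrA mulfV ?mul1r// normr_eq0.
by rewrite /normal_fun; congr expR; rewrite !subr0; field; rewrite s0 c0.
Qed.

Lemma normal_prob_scale s (c : R) (A : set R) : s != 0 -> c != 0 -> measurable A ->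
  normal_prob 0 s ((fun x => c * x) @^-1` A) = normal_prob 0 (c * s) A.
Proof.
move=> s0 c0 mA; rewrite /normal_prob.
have mpdf : measurable_fun [set: R] (fun x => (normal_pdf 0 (c * s) x)%:E).
  by apply/measurable_EFinP; exact: measurable_normal_pdf.
have pdf0 x : (0 <= (normal_pdf 0 (c * s) x)%:E)%E by rewrite lee_fin normal_pdf_ge0.
have := ge0_integral_affine 0 c0 mA mpdf pdf0.
rewrite (_ : (fun x => c * x + 0) = (fun x => c * x)); last by apply/funext => x; rewrite addr0.
under eq_integral do rewrite addr0.
move=> h; under eq_integral do rewrite (normal_pdf_scale s0 c0) EFinM.
rewrite ge0_integralZl//; last 2 first.
- rewrite -[X in measurable X]setTI; apply: measurable_funM => //.
- by apply: measurable_funTS; apply: measurableT_comp mpdf _; exact: measurable_funM.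
by rewrite h muleA -EFinM mulfV ?mul1e// normr_eq0.
Qed.

Lemma normal_prob_norm s : normal_prob 0 `|s| = normal_prob 0 s.
Proof.
have [s0|/ltW s0] := leP 0 s; [by rewrite (ger0_norm s0)|rewrite (ler0_norm s0)].
apply/funext => A; apply: eq_integral => x _; congr (_%:E).
by rewrite /normal_pdf oppr_eq0 /normal_peak /normal_fun sqrrN.
Qed.

Lemma normal_prob_shift m s (A : set R) : s != 0 -> measurable A ->
  normal_prob 0 s ((fun x => m + x) @^-1` A) = normal_prob m s A.
Proof.
move=> s0 mA; rewrite /normal_prob.
have mpdf : measurable_fun [set: R] (fun x => (normal_pdf m s x)%:E).
  by apply/measurable_EFinP; exact: measurable_normal_pdf.
have pdf0 x : (0 <= (normal_pdf m s x)%:E)%E by rewrite lee_fin normal_pdf_ge0.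
have := ge0_integral_affine m (oner_neq0 R) mA mpdf pdf0.
rewrite (_ : (fun x => 1 * x + m) = (fun x => m + x)); last first.
  by apply/funext => x; rewrite mul1r addrC.
rewrite normr1 invr1 mul1e => <-; apply: eq_integral => x _; congr (_%:E).
by rewrite !normal_pdfE//; congr (_ * _); rewrite /normal_fun subr0 mul1r addrK.
Qed.

(** Completing the square. For independent X and Y of deviations [s] and [t], the joint density of X
    and Z = X + Y is written as the density of Z times the conditional density of X given Z = z. *)
Lemma normal_pdf_conv (s t x z : R) : s != 0 -> t != 0 ->
  let r := Num.sqrt (s ^+ 2 + t ^+ 2) in
  normal_pdf x t z * normal_pdf 0 s x =
  normal_pdf 0 r z * normal_pdf (s ^+ 2 / r ^+ 2 * z) (s * t / r) x.
Proof.
move=> s0 t0 r.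
have r2 : r ^+ 2 = s ^+ 2 + t ^+ 2 by rewrite sqr_sqrtr// addr_ge0// sqr_ge0.
have st0 : 0 < s ^+ 2 + t ^+ 2 by rewrite addr_gt0// exprn_even_gt0.
have r0 : r != 0 by rewrite gt_eqF// sqrtr_gt0.
clearbody r.
rewrite !normal_pdfE ?mulf_neq0 ?invr_neq0// mulrACA [RHS]mulrACA; congr (_ * _).
  rewrite !normal_peakE !normrM normfV; move: (Num.sqrt _)^-1 => k.
  by field; rewrite !normr_eq0 r0 s0 t0.
rewrite /normal_fun -!expRD; congr expR.
rewrite expr_div_n !exprMn r2.
by field; rewrite s0 t0 gt_eqF.
Qed.

Let measurable_normal_pdf2 t : t != 0 ->
  measurable_fun [set: measurableTypeR R * measurableTypeR R]
    (fun xz => (normal_pdf xz.1 t xz.2)%:E).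
Proof.
move=> t0; apply/measurable_EFinP; rewrite (_ : (fun xz => _) = fun xz : R * R =>
    normal_peak t * expR (- (xz.2 - xz.1) ^+ 2 / (t ^+ 2 *+ 2))); last first.
  by apply/funext => -[x z]; rewrite normal_pdfE.
apply: measurable_funM => //; apply: measurableT_comp => //.
apply: measurable_funM => //; apply: measurableT_comp => //.
by apply: measurable_funX; apply: measurable_funB.
Qed.

(** Exchange the integrals by Tonelli; by [normal_pdf_conv] the inner one is then that of a
    conditional density, equal to 1. *)
Lemma integral_normal_prob_conv s t (A : set R) : s != 0 -> t != 0 -> measurable A ->
  (\int[normal_prob 0 s]_x normal_prob 0 t ((fun y => x + y)%R @^-1` A) =
   normal_prob 0 (Num.sqrt (s ^+ 2 + t ^+ 2)) A)%E.
Proof.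
move=> s0 t0 mA; set r := Num.sqrt _.
have r0 : r != 0.
  by rewrite gt_eqF// sqrtr_gt0 addr_gt0// exprn_even_gt0.
pose h (xz : measurableTypeR R * measurableTypeR R) : \bar R :=
  ((\1_A xz.2)%:E * (normal_pdf xz.1 t xz.2)%:E)%E.
have m1 : measurable_fun [set: measurableTypeR R * measurableTypeR R] (fun xz => (\1_A xz.2 : R)%:E).
  by apply/measurable_EFinP; apply: measurableT_comp.
have mh : measurable_fun [set: measurableTypeR R * measurableTypeR R] h.
  by apply: emeasurable_funM => //; exact: measurable_normal_pdf2.
have h0 xz : (0 <= h xz)%E by rewrite mule_ge0// lee_fin// normal_pdf_ge0.
have mF : measurable_fun [set: measurableTypeR R] (fubini_F mu h).
  exact: measurable_fun_fubini_tonelli_F.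
have FE x : normal_prob 0 t ((fun y => x + y)%R @^-1` A) = fubini_F mu h x.
  rewrite normal_prob_shift// /normal_prob integral_mkcond; apply: eq_integral => z _.
  by rewrite patchE /h/= indicE; case: ifPn; rewrite ?mul1e ?mul0e.
under eq_integral do rewrite FE.
rewrite (@ge0_integral_density _ _ R mu _ (normal_pdf 0 s))//; last 3 first.
- exact: measurable_normal_pdf.
- by move=> x; exact: normal_pdf_ge0.
- by move=> x; exact: integral_ge0.
pose k (xz : measurableTypeR R * measurableTypeR R) : \bar R :=
  (h xz * (normal_pdf 0 s xz.1)%:E)%E.
have mk : measurable_fun [set: measurableTypeR R * measurableTypeR R] k.
  apply: emeasurable_funM => //; apply/measurable_EFinP.
  by apply: measurableT_comp => //; exact: measurable_normal_pdf.
have k0 xz : (0 <= k xz)%E by rewrite mule_ge0// lee_fin// normal_pdf_ge0.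
transitivity (\int[mu]_x \int[mu]_z k (x, z))%E.
  apply: eq_integral => x _; rewrite /k/= ge0_integralZr//.
  - by apply: measurableT_comp mh _; exact: measurable_pair1.
  - by rewrite lee_fin normal_pdf_ge0.
rewrite fubini_tonelli// /normal_prob [RHS]integral_mkcond; apply: eq_integral => z _.
rewrite patchE /k /h/= indicE; case: ifPn => zA; last first.
  by under eq_integral do rewrite !mul0e; rewrite integral0.
under eq_integral do rewrite mul1e -EFinM normal_pdf_conv// EFinM.
rewrite ge0_integralZl//.
- by rewrite integral_normal_pdf mule1.
- by apply/measurable_EFinP; exact: measurable_normal_pdf.
- by move=> x _; rewrite lee_fin normal_pdf_ge0.
- by rewrite lee_fin normal_pdf_ge0.
Qed.

End normal.

Lemma dirac_preimage d1 d2 (T1 : measurableType d1) (T2 : measurableType d2)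
    (R : realType) (f : T1 -> T2) a b (A : set T2) :
  f a = b -> \d_a (f @^-1` A) = \d_b A :> \bar R.
Proof. by move=> <-. Qed.

Section centered_normal.
Variable R : realType.
Implicit Types v w : R.

(** [normal_law] is only a set function; this bundles its centered case as a probability, so that
    one can integrate against it. *)
Definition normal_law0 v : probability (measurableTypeR R) R :=
  if v == 0 then (\d_(0 : measurableTypeR R) : probability (measurableTypeR R) R)
  else (normal_prob 0 (Num.sqrt v) : probability (measurableTypeR R) R).

Lemma normal_law0E v (A : set R) : normal_law0 v A = normal_law 0 v A.
Proof. by rewrite /normal_law0 /normal_law; case: ifP. Qed.

Lemma integral_normal_law0 v (f : R -> \bar R) :
  (\int[normal_law0 v]_x f x = if v == 0%R then \int[\d_(0%R : measurableTypeR R)]_x f x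
    else \int[normal_prob 0%R (Num.sqrt v)]_x f x)%E.
Proof. by rewrite /normal_law0; case: ifP. Qed.

Lemma normal_law_scale v (c : R) (A : set R) : 0 <= v -> measurable A ->
  normal_law 0 v ((fun x => c * x) @^-1` A) = normal_law 0 (c ^+ 2 * v) A.
Proof.
move=> v0 mA; have cv0 : (c ^+ 2 * v == 0) = (c == 0) || (v == 0).
  by rewrite mulf_eq0 sqrf_eq0.
rewrite /normal_law cv0.
have [->|vn0] := eqVneq v 0.
  rewrite orbT; apply: (@dirac_preimage _ _ (measurableTypeR R) (measurableTypeR R)).
  by rewrite mulr0.
have [->|c0] /= := eqVneq c 0; last first.
  have vs : Num.sqrt v != 0 by rewrite gt_eqF// sqrtr_gt0 lt_neqAle eq_sym vn0.
  have -> : Num.sqrt (c ^+ 2 * v) = `|c * Num.sqrt v|.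
    by rewrite sqrtrM ?sqr_ge0// sqrtr_sqr normrM (ger0_norm (sqrtr_ge0 v)).
  by rewrite normal_prob_norm; exact: normal_prob_scale.
rewrite diracE; have [A0|A0] := boolP (0 \in A).
  rewrite (_ : _ @^-1` _ = setT) ?probability_setT//; apply/seteqP; split => // x _ /=.
  by rewrite mul0r; exact: set_mem.
rewrite (_ : _ @^-1` _ = set0) ?measure0//; apply/seteqP; split => // x /=.
by rewrite mul0r => /mem_set; rewrite (negbTE A0).
Qed.

Lemma measurable_normal_law_shift w (A : set R) : measurable A ->
  measurable_fun [set: R] (fun x => normal_law 0 w ((fun y => x + y)%R @^-1` A)).
Proof.
move=> mA; rewrite (_ : (fun x => _) = normal_law0 w \o xsection [set xy | A (xy.1 + xy.2)]).
  apply: (measurable_fun_xsection (T1 := measurableTypeR R)).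
  rewrite -[X in measurable X]setTI.
  exact: (measurable_funD measurable_fst measurable_snd).
apply/funext => x /=; rewrite -normal_law0E; congr (_ _).
by apply/seteqP; split => y; rewrite /xsection/= inE.
Qed.

Lemma integral_normal_law_conv v w (A : set R) : 0 <= v -> 0 <= w -> measurable A ->
  (\int[normal_law0 v]_x normal_law 0 w ((fun y => x + y)%R @^-1` A) =
   normal_law 0 (v + w) A)%E.
Proof.
move=> v0 w0 mA; rewrite integral_normal_law0.
have [->|vn0] := eqVneq v 0.
  rewrite integral_dirac//=; last exact: measurable_normal_law_shift.
  rewrite diracT mul1e add0r.
  by congr (_ _); apply/funext => x /=; rewrite add0r.
have vs : Num.sqrt v != 0 by rewrite gt_eqF// sqrtr_gt0 lt_neqAle eq_sym vn0.
rewrite /normal_law; have [->|wn0] := eqVneq w 0.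
  rewrite addr0 (negbTE vn0).
  rewrite -[in RHS](setIT A) -integral_indic//; apply: eq_integral => x _.
  exact: (@dirac_preimage _ _ (measurableTypeR R) (measurableTypeR R) R _ _ _ A (addr0 (x : R))).
have ws : Num.sqrt w != 0 by rewrite gt_eqF// sqrtr_gt0 lt_neqAle eq_sym wn0.
rewrite integral_normal_prob_conv// !sqr_sqrtr// gt_eqF//.
by rewrite addr_gt0// lt_neqAle eq_sym ?vn0 ?wn0.
Qed.

Lemma ge0_integral_normal_scale v (c : R) (g : R -> \bar R) : 0 <= v ->
  measurable_fun [set: R] g -> (forall x, 0 <= g x)%E ->
  (\int[normal_law0 v]_x g (c * x)%R = \int[normal_law0 (c ^+ 2 * v)]_x g x)%E.
Proof.
move=> v0 mg g0.
have mc : measurable_fun [set: measurableTypeR R] (fun x => c * x : measurableTypeR R).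
  exact: measurable_funM.
transitivity (\int[pushforward (normal_law0 v) (fun x => (c * x)%R : measurableTypeR R)]_x g x)%E.
  by rewrite (ge0_integral_pushforward mc).
apply: eq_measure_integral => A mA _.
by rewrite /= /pushforward (normal_law0E v) normal_law_scale// -normal_law0E.
Qed.

End centered_normal.

(** * Moments of the standard normal law *)

Section standard_normal_moments.
Variable R : realType.
Notation N1 := (@normal_prob R 0 1).
Notation mu := (@lebesgue_measure R).

Let ge0_integral_N1 (f : R -> \bar R) : measurable_fun [set: R] f ->
  (forall x, 0 <= f x)%E ->
  (\int[N1]_x f x = \int[mu]_x (f x * (normal_pdf 0 1 x)%:E))%E.
Proof.
move=> mf f0; apply: (@ge0_integral_density _ _ R mu N1) => //.
- exact: measurable_normal_pdf.
- by move=> x; exact: normal_pdf_ge0.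
Qed.

Let measurable_sqr_exp (a : R) :
  measurable_fun [set: R] (fun x => expR (a * x ^+ 2)).
Proof.
by apply: measurableT_comp => //; apply: measurable_funM => //; exact: measurable_funX.
Qed.

(** The exponential factor turns the standard density into that of deviation 1 / r, up to the ratio
    1 / r of the peaks. This generating function of x^2 yields the moments below. *)
Let integral_sqr_exp (r : R) : 0 < r ->
  (\int[N1]_x (expR ((1 - r ^+ 2) / 2 * x ^+ 2))%:E = (r^-1)%:E)%E.
Proof.
move=> r0; have rn0 : r != 0 by rewrite gt_eqF.
rewrite ge0_integral_N1; last 2 first.
- by apply/measurable_EFinP; exact: measurable_sqr_exp.
- by move=> x; rewrite lee_fin expR_ge0.
transitivity (\int[mu]_x ((r^-1)%:E * (normal_pdf 0 r^-1 x)%:E))%E.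
  apply: eq_integral => x _; rewrite -!EFinM; congr (_%:E).
  rewrite !normal_pdfE ?invr_neq0// !normal_peakE normr1 invr1 mul1r.
  rewrite gtr0_norm ?invr_gt0// invrK -!mulrA mulKf// mulrCA.
  congr (_ * _); rewrite /normal_fun -expRD; congr expR.
  by field.
rewrite ge0_integralZl//.
- by rewrite integral_normal_pdf mule1.
- by apply/measurable_EFinP; exact: measurable_normal_pdf.
- by move=> x _; rewrite lee_fin normal_pdf_ge0.
- by rewrite lee_fin invr_ge0 ltW.
Qed.

Let integrable_sqr_exp (r : R) : 0 < r ->
  N1.-integrable [set: R] (EFin \o (fun x => expR ((1 - r ^+ 2) / 2 * x ^+ 2))).
Proof.
move=> r0; apply/integrableP; split; first by apply/measurable_EFinP; exact: measurable_sqr_exp.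
under eq_integral do rewrite /= ger0_norm ?expR_ge0//.
by rewrite integral_sqr_exp// ltry.
Qed.

Lemma integrable_normal_X4 : N1.-integrable [set: R] (EFin \o (fun x => x ^+ 4)).
Proof.
(* For r = 1/2 the exponent is y = 3 x^2 / 8, and exp(y) >= y^2 / 2 = 9 x^4 / 128 >= x^4 / 16; hence
   the factor 16 below. *)
have h : N1.-integrable [set: R] (EFin \o (fun x => expR ((1 - 2^-1 ^+ 2) / 2 * x ^+ 2))).
  by apply: integrable_sqr_exp; rewrite invr_gt0.
have : N1.-integrable [set: R] (fun x => 16%:E * (EFin \o (fun x => expR ((1 - 2^-1 ^+ 2) / 2 * x ^+ 2))) x)%E.
  exact: integrableZl.
apply: le_integrable => //.
  by apply/measurable_EFinP; exact: measurable_funX.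
move=> x _ /=; have x40 : 0 <= x ^+ 4 by rewrite exprn_even_ge0.
rewrite lee_fin ger0_norm// ger0_norm ?mulr_ge0 ?expR_ge0//.
have y0 : 0 <= (1 - 2^-1 ^+ 2) / 2 * x ^+ 2 by rewrite mulr_ge0 ?sqr_ge0//; lra.
have := expR_ge1Dxn 1 y0; rewrite /= => e.
rewrite -ler_pdivrMl//; apply: le_trans e.
by rewrite (exprM x 2 2); set z := x ^+ 2; rewrite !factS fact0; nra.
Qed.

Lemma integrable_normal_X2 : N1.-integrable [set: R] (EFin \o (fun x => x ^+ 2)).
Proof.
have h : N1.-integrable [set: R] (EFin \o (fun x => 1 + x ^+ 4)).
  have := integrable_normal_X4 => h4.
  have h1 : N1.-integrable [set: R] (EFin \o (fun=> 1)) by apply: bmfun_integrable; exact: bmfun_cst.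
  exact: (integrableD measurableT h1 h4).
apply: le_integrable h => //.
  by apply/measurable_EFinP; exact: measurable_funX.
move=> x _ /=; rewrite lee_fin !ger0_norm ?sqr_ge0//.
  by rewrite (exprM x 2 2); set z := x ^+ 2; nra.
by rewrite addr_ge0// exprn_even_ge0.
Qed.

(** Integrating exp(y) >= 1 + y in [integral_sqr_exp] gives 1 + (1 - r^2) M / 2 <= 1 / r for all r >
    0. Dividing by r - 1 compares M r (1 + r) with 2, from opposite sides for r > 1 and r < 1, and r
    near 1 forces M = 1. *)
Lemma normal_X2 : \int[N1]_x (x ^+ 2) = 1.
Proof.
set M := \int[N1]_x _.
have M0 : 0 <= M by apply: Rintegral_ge0 => x _; exact: sqr_ge0.
have ex r : 0 < r -> \int[N1]_x expR ((1 - r ^+ 2) / 2 * x ^+ 2) = r^-1.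
  by move=> r0; rewrite /Rintegral integral_sqr_exp.
have key r : 0 < r -> 1 + (1 - r ^+ 2) / 2 * M <= r^-1.
  move=> r0; rewrite -(ex r)//.
  have i1 : N1.-integrable [set: R] (EFin \o (fun=> 1)) by apply: bmfun_integrable; exact: bmfun_cst.
  have i2 : N1.-integrable [set: R] (EFin \o (fun x => (1 - r ^+ 2) / 2 * x ^+ 2)).
    exact: (integrableZl measurableT _ integrable_normal_X2).
  have -> : 1 + (1 - r ^+ 2) / 2 * M = \int[N1]_x (1 + (1 - r ^+ 2) / 2 * x ^+ 2).
    by rewrite (RintegralD _ i1 i2)// RintegralT_cst RintegralZl//; exact: integrable_normal_X2.
  apply: le_Rintegral => //.
  - exact: (integrableD measurableT i1 i2).
  - exact: integrable_sqr_exp.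
  - by move=> x _; exact: expR_ge1Dx.
have key2 r : 0 < r -> 1 < r -> 2 <= M * (r * (1 + r)).
  move=> r0 r1; have := ler_wpM2r (ltW r0) (key r r0).
  rewrite mulVf ?gt_eqF// => h.
  have : (r - 1) * 2 <= (r - 1) * (M * (r * (1 + r))) by nra.
  by rewrite ler_pM2l// subr_gt0.
have key3 r : 0 < r -> r < 1 -> M * (r * (1 + r)) <= 2.
  move=> r0 r1; have := ler_wpM2r (ltW r0) (key r r0).
  rewrite mulVf ?gt_eqF// => h.
  have : (1 - r) * (M * (r * (1 + r))) <= (1 - r) * 2 by nra.
  by rewrite ler_pM2l// subr_gt0.
(* Instead of a limit, an explicit r violates the inequality: r = 1 - (1 - 1/M) / 4 if M > 1, and r
   = 1 + (1 - M) / 4 if M < 1. *)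
apply/eqP; rewrite eq_le; apply/andP; split; rewrite leNgt; apply/negP => M1.
  pose e := (1 - M^-1) / 4.
  have MV0 : 0 < M^-1 by rewrite invr_gt0 (lt_trans ltr01).
  have MV1 : M^-1 < 1 by rewrite invf_lt1// (lt_trans ltr01).
  have Me : M * e = (M - 1) / 4.
    by rewrite /e; field; rewrite gt_eqF// (lt_trans ltr01).
  have e0 : 0 < e by rewrite /e; lra.
  have e1 : e < 1 by rewrite /e; lra.
  have := key3 (1 - e); rewrite subr_gt0 gtrBl => /(_ e1 e0).
  have -> : M * ((1 - e) * (1 + (1 - e))) = 2 * M - 3 * (M * e) + M * e * e by ring.
  have : 0 <= M * e * e by rewrite mulr_ge0 ?(ltW e0)// mulr_ge0 ?(ltW e0).
  by move: Me; lra.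
have e0 : 0 < (1 - M) / 4 by lra.
have := key2 (1 + (1 - M) / 4); rewrite ltrDl => /(_ (addr_gt0 ltr01 e0) e0).
set e := (1 - M) / 4 in e0 *.
have -> : M * ((1 + e) * (1 + (1 + e))) = 2 * M + 3 * (M * e) + (M * e) * e by ring.
have Me : M * e <= e by rewrite ler_piMl// ltW.
have e1 : e <= 4^-1 by rewrite /e; lra.
have : M * e * e <= e * 4^-1.
  by apply: ler_pM => //; [apply: mulr_ge0 => //; exact: ltW|exact: ltW].
by move: Me; rewrite /e; lra.
Qed.

Lemma normal_cos_approx (t : R) :
  `|\int[N1]_x cos (t * x) - (1 - t ^+ 2 / 2)| <= t ^+ 4 * \int[N1]_x (x ^+ 4 / 8).
Proof.
have i1 : N1.-integrable [set: R] (EFin \o (fun=> 1)) by apply: bmfun_integrable; exact: bmfun_cst.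
have i2 : N1.-integrable [set: R] (EFin \o (fun x => t ^+ 2 / 2 * x ^+ 2)).
  exact: (integrableZl measurableT _ integrable_normal_X2).
have i4 : N1.-integrable [set: R] (EFin \o (fun x => x ^+ 4 / 8)).
  by under eq_fun do rewrite /= mulrC; exact: (integrableZl measurableT _ integrable_normal_X4).
have i3 : N1.-integrable [set: R] (EFin \o (fun x => 1 - t ^+ 2 / 2 * x ^+ 2)).
  exact: (integrableB measurableT i1 i2).
have ic : N1.-integrable [set: R] (EFin \o (fun x => cos (t * x))).
  by apply: bmfun_integrable; apply: bmfun_cos; exact: measurable_funM.
have -> : \int[N1]_x cos (t * x) - (1 - t ^+ 2 / 2) =
    \int[N1]_x (cos (t * x) - (1 - t ^+ 2 / 2 * x ^+ 2)).
  rewrite RintegralB// (RintegralB _ i1 i2)// RintegralT_cst RintegralZl//; last exact: integrable_normal_X2.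
  by rewrite normal_X2 mulr1.
have id : N1.-integrable [set: R] (EFin \o (fun x => cos (t * x) - (1 - t ^+ 2 / 2 * x ^+ 2))).
  exact: (integrableB measurableT ic i3).
rewrite (le_trans (le_normr_Rintegral _ id))// -RintegralZl//; apply: le_Rintegral => //.
- exact: integrable_norm.
- exact: (integrableZl measurableT _ i4).
move=> x _; have /andP[h1 h2] := cos_taylor2 (t * x).
have -> : t ^+ 2 / 2 * x ^+ 2 = (t * x) ^+ 2 / 2 by field.
by rewrite ger0_norm// (le_trans h2)// exprMn mulrA.
Qed.

End standard_normal_moments.

#[local] Opaque normal_law0.

(** * Characteristic functions of centered normal laws *)

Section normal_characteristic_function.
Variable R : realType.
Implicit Types v w t : R.

Lemma Rintegral_normal_scale v (c : R) (f : R -> R) : 0 <= v -> bmfun f ->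
  \int[normal_law0 v]_x f (c * x) = \int[normal_law0 (c ^+ 2 * v)]_x f x.
Proof.
move=> v0 bf; apply/eqP; rewrite -subr_eq0.
pose L (g : R -> R) := \int[normal_law0 v]_x (g (c * x) * 1) -
  \int[normal_law0 (c ^+ 2 * v)]_x (g x * 1).
have <- : L f = \int[normal_law0 v]_x f (c * x) - \int[normal_law0 (c ^+ 2 * v)]_x f x.
  by congr (_ - _); apply: eq_Rintegral => t _; rewrite mulr1.
apply/eqP; apply: bclinear_eq0 bf.
  apply: bclinearB; apply: bclinear_integral => //; exact: bmfun_cst.
move=> A mA; apply/eqP; rewrite subr_eq0; apply/eqP.
have mpre : measurable ((fun x => c * x) @^-1` A).
  by rewrite -[X in measurable X]setTI; apply: measurable_funM.
transitivity (fine (normal_law0 v ((fun x => c * x) @^-1` A))).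
  by rewrite -bRintegral_indic//; apply: eq_Rintegral => t _; rewrite mulr1.
rewrite (normal_law0E v) normal_law_scale// -normal_law0E.
by rewrite -bRintegral_indic//; apply: eq_Rintegral => t _; rewrite mulr1.
Qed.

Lemma Rintegral_normal_conv v w (f : R -> R) : 0 <= v -> 0 <= w -> bmfun f ->
  \int[normal_law0 v]_x \int[normal_law0 w]_y f (x + y) = \int[normal_law0 (v + w)]_x f x.
Proof.
move=> v0 w0 bf; apply/eqP; rewrite -subr_eq0.
pose L (g : R -> R) := \int[normal_law0 v]_x ((\int[normal_law0 w]_y g (x + y)) * 1) -
  \int[normal_law0 (v + w)]_x (g x * 1).
have <- : L f = \int[normal_law0 v]_x \int[normal_law0 w]_y f (x + y) -
    \int[normal_law0 (v + w)]_x f x.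
  by congr (_ - _); apply: eq_Rintegral => t _; rewrite mulr1.
have madd : measurable_fun [set: measurableTypeR R * measurableTypeR R] (fun xy => xy.1 + xy.2 : R).
  exact: measurable_funD.
have badd g : bmfun g -> bmfun (fun xy : measurableTypeR R * measurableTypeR R => g (xy.1 + xy.2) : R).
  by move=> [mg gK]; exact: bmfun_comp.
apply/eqP; apply: bclinear_eq0 bf.
  apply: bclinearB; last by apply: bclinear_integral => //; exact: bmfun_cst.
  (* The functional of [g] is the iterated integral of (x, y) -> g (x + y) on the product space. *)
  have [LD LZ Lc] := bclinear_iterated (normal_law0 v) (normal_law0 w)
    (Z := id) (@measurable_id _ _ _) (bmfun_cst _ (1 : R)).
  split.
  - by move=> g h bg bh; rewrite -(LD _ _ (badd _ bg) (badd _ bh)).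
  - by move=> a g bg; rewrite -(LZ a _ (badd _ bg)).
  - move=> g h K mg gK gh; apply: (Lc (fun n xy => g n (xy.1 + xy.2)) (fun xy => h (xy.1 + xy.2)) K).
    + by move=> n; apply: measurableT_comp.
    + by move=> n xy; exact: gK.
    + by move=> xy; exact: gh.
move=> A mA; apply/eqP; rewrite subr_eq0; apply/eqP.
transitivity (fine (normal_law0 (v + w) A)); last first.
  by rewrite -bRintegral_indic//; apply: eq_Rintegral => t _; rewrite mulr1.
rewrite (normal_law0E (v + w)) -integral_normal_law_conv//.
congr fine; apply: eq_integral => x _; rewrite mulr1.
have mpre : measurable ((fun y => x + y) @^-1` A).
  by rewrite -[X in measurable X]setTI; apply: measurable_funD.
have -> : \int[normal_law0 w]_y \1_A (x + y) = fine (normal_law0 w ((fun y => x + y) @^-1` A)).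
  by rewrite -bRintegral_indic.
by rewrite fineK ?fin_num_measure// normal_law0E.
Qed.

Let g v := \int[normal_law0 v]_x cos x.

(** Scaling by -1 preserves the law, and the sine is odd. *)
Let sin_normal v : 0 <= v -> \int[normal_law0 v]_x sin x = 0.
Proof.
move=> v0; have bs : bmfun (@sin R) by apply: bmfun_sin; exact: measurable_id.
have := Rintegral_normal_scale (-1) v0 bs; rewrite sqrrN expr1n mul1r.
under eq_Rintegral do rewrite mulN1r sinN -mulN1r.
rewrite bRintegralZl// mulN1r => h; lra.
Qed.

Let g_add v w : 0 <= v -> 0 <= w -> g (v + w) = g v * g w.
Proof.
move=> v0 w0; have bc : bmfun (@cos R) by apply: bmfun_cos; exact: measurable_id.
have bs : bmfun (@sin R) by apply: bmfun_sin; exact: measurable_id.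
apply: etrans (esym (Rintegral_normal_conv v0 w0 bc)) _.
transitivity (\int[normal_law0 v]_x (cos x * g w)); last exact: bRintegralZr.
apply: eq_Rintegral => x _.
transitivity (\int[normal_law0 w]_y (cos x * cos y - sin x * sin y)).
  by apply: eq_Rintegral => y _; rewrite cosD.
by rewrite bRintegralB ?bRintegralZl ?sin_normal ?mulr0 ?subr0//; exact: bmfunZ.
Qed.

Let g_pow v n : 0 <= v -> g (v *+ n) = g v ^+ n.
Proof.
move=> v0; elim: n => [|n IH]; last by rewrite mulrSr g_add ?mulrn_wge0// IH exprSr.
rewrite mulr0n expr0 /g /Rintegral integral_normal_law0 eqxx integral_dirac//.
  by rewrite diracT mul1e cos0.
apply/measurable_EFinP; have [] // : bmfun (@cos R).
by apply: bmfun_cos; exact: measurable_id.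
Qed.

(** The first term comes from the Taylor remainder of the cosine, the second from that of the
    exponential at v / 2. *)
Let C : R := \int[normal_prob 0 1]_x (x ^+ 4 / 8) + 4^-1.

Let g_approx v : 0 <= v -> `|g v - expR (- (v / 2))| <= v ^+ 2 * C.
Proof.
move=> v0; have bc : bmfun (@cos R) by apply: bmfun_cos; exact: measurable_id.
have := normal_cos_approx (Num.sqrt v).
have -> : \int[normal_prob 0 1]_x cos (Num.sqrt v * x) = g v.
  have <- : \int[normal_law0 (Num.sqrt v ^+ 2 * 1)]_x cos x = g v by rewrite mulr1 sqr_sqrtr.
  rewrite -(Rintegral_normal_scale (Num.sqrt v) ler01 bc).
  by rewrite /Rintegral integral_normal_law0 oner_eq0 sqrtr1.
rewrite (exprM _ 2 2) sqr_sqrtr// => h.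
have /expRN_taylor1/andP[e1 e2] : 0 <= v / 2 by rewrite divr_ge0.
have -> : g v - expR (- (v / 2)) = (g v - (1 - v / 2)) - (expR (- (v / 2)) - (1 - v / 2)) by ring.
rewrite (le_trans (ler_normB _ _))// mulrDr lerD//.
by rewrite ger0_norm// (le_trans e2)// expr_div_n -natrX.
Qed.

(** By [Rintegral_normal_conv] the transform [g] satisfies [g v = g (v / n) ^ n],
    and [g w = expR (- w / 2) + O (w ^ 2)] by Taylor expansion of the cosine. *)
Lemma normal_char v : 0 <= v ->
  \int[normal_law0 v]_x cos x = expR (- (v / 2)) /\ \int[normal_law0 v]_x sin x = 0.
Proof.
move=> v0; split; last exact: sin_normal.
have C0 : 0 <= C.
  rewrite addr_ge0 ?invr_ge0//; apply: Rintegral_ge0 => x _.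
  by rewrite divr_ge0// exprn_even_ge0.
apply/eqP; rewrite -subr_eq0 -normr_eq0 eq_le normr_ge0 andbT.
apply/ler_addgt0Pl => e e0; rewrite addr0.
(* The total error n (v/n)^2 C = v^2 C / n is then at most [e]; the successor keeps [n] positive. *)
pose n := (Num.bound (v ^+ 2 * C / e)).+1.
have n0 : 0 < n%:R :> R by rewrite ltr0n.
have vn0 : 0 <= v / n%:R by rewrite divr_ge0// ltW.
have vE : v = (v / n%:R) *+ n by rewrite -[_ *+ n]mulr_natr divfK// gt_eqF.
pose q := expR (- (v / n%:R / 2)).
have qE : q ^+ n = expR (- (v / 2)).
  by rewrite /q -expRM_natl; congr expR; field; rewrite gt_eqF.
have g1 w : 0 <= w -> `|g w| <= 1.
  move=> w0; apply: bRintegral_norm_le; last by move=> x; exact: cos_max.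
  by have [] : bmfun (@cos R) by apply: bmfun_cos; exact: measurable_id.
have q1 : `|q| <= 1.
  by rewrite ger0_norm ?expR_ge0// -[leRHS]expR0 ler_expR oppr_le0 divr_ge0.
(* [cpow_approx] with zero imaginary part compares powers of two real numbers. *)
have gq1 : g (v / n%:R) ^+ 2 + 0 ^+ 2 <= 1.
  by rewrite expr0n addr0 -real_normK ?num_real// exprn_ile1// g1.
have := (cpow_approx n gq1 q1).1.
have cpowE m : cpow (g (v / n%:R)) 0 m = (g (v / n%:R) ^+ m, 0).
  by elim: m => [|m IH] //=; rewrite IH/= !mulr0 mul0r subr0 addr0 exprSr.
rewrite cpowE/= -g_pow// -vE qE normr0 addr0 => h.
rewrite (le_trans h)// (le_trans (ler_wpM2l (ltW n0) (g_approx vn0)))//.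
have -> : n%:R * ((v / n%:R) ^+ 2 * C) = v ^+ 2 * C / n%:R by field; rewrite gt_eqF.
rewrite ler_pdivrMr// [leRHS]mulrC -ler_pdivrMr// ltW// (lt_le_trans (archi_boundP _))//.
  by rewrite divr_ge0 ?mulr_ge0 ?sqr_ge0// ltW.
by rewrite ler_nat leqnSn.
Qed.

End normal_characteristic_function.

(** * Existence of multivariate normal laws *)

Section mvnormal_existence.
Variable R : realType.

Let dotC n (x y : 'rV[R]_n) : (x *m y^T) 0 0 = (y *m x^T) 0 0.
Proof. by rewrite !mxE; apply: eq_bigr => i _; rewrite !mxE mulrC. Qed.

Let mxD (A B : 'M[R]_1) : (A + B) 0 0 = A 0 0 + B 0 0.
Proof. by rewrite mxE. Qed.

Let mxZ (k : R) (A : 'M[R]_1) : (k *: A) 0 0 = k * A 0 0.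
Proof. by rewrite mxE. Qed.

Let quad_block n (a : R) (b : 'rV[R]_n) (C : 'M[R]_n) (s : R) (u : 'rV[R]_n) :
  let w : 'rV[R]_(1 + n) := row_mx (s%:M : 'M[R]_1) u in
  (w *m block_mx (a%:M : 'M[R]_1) b b^T C *m w^T) 0 0 =
  a * s ^+ 2 + 2 * s * (b *m u^T) 0 0 + (u *m C *m u^T) 0 0.
Proof.
rewrite /= mul_row_block tr_row_mx mul_row_col tr_scalar_mx -scalar_mxM.
rewrite mul_mx_scalar mulmxDl mul_scalar_mx -scalemxAl !mxD !mxZ mxD dotC.
by rewrite [_%:M 0 0]mxE eqxx mulr1n; ring.
Qed.

Let dot_row_mx n (x s : R) (w v : 'rV[R]_n) :
  ((row_mx (const_mx x : 'M[R]_1) w : 'rV[R]_(1 + n)) *m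
   (row_mx (s%:M : 'M[R]_1) v : 'rV[R]_(1 + n))^T) 0 0 = x * s + (w *m v^T) 0 0.
Proof.
by rewrite tr_row_mx mul_row_col mxD tr_scalar_mx mul_mx_scalar mxZ mxE mulrC.
Qed.

(** One row of a Cholesky factorization per step: for [S = [a, b; b^T, C]], if
    [x] is normal of variance [a] and [v] is normal of covariance the Schur
    complement [C - b^T b / a], independent of [x], then
    [(x, v + (x / a) b)] has covariance [S]; if [a = 0] then [b = 0] and the junk
    value [0^-1 = 0] gives the right vector. *)
Lemma mvnormal_exists n (S : 'M[R]_n) : S^T = S ->
  (forall u : 'rV[R]_n, 0 <= (u *m S *m u^T) 0 0) ->
  exists nu : probability 'rV[R]_n R, is_mvnormal nu 0 S.
Proof.
elim: n S => [|n IH] S ST S0.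
  exists (\d_(0 : 'rV[R]_0)); split => // u A mA.
  have S00 : (u *m S *m u^T) 0 0 = 0 by rewrite mxE big_ord0.
  have u0 : ((0 : 'rV[R]_0) *m u^T) 0 0 = 0 by rewrite mul0mx mxE.
  rewrite S00 u0 /normal_law eqxx.
  exact: (@dirac_preimage _ _ 'rV[R]_0 (measurableTypeR R) R _ _ _ _ u0).
pose a := S 0 0; pose b : 'rV[R]_n := @ursubmx _ 1 n 1 n S; pose C : 'M[R]_n := @drsubmx _ 1 n 1 n S.
have SE : S = block_mx (a%:M : 'M[R]_1) b b^T C :> 'M[R]_(1 + n).
  rewrite -[LHS](@submxK _ 1 n 1 n S); congr block_mx.
    by rewrite [LHS]mx11_scalar; congr (_%:M); rewrite !mxE; congr (S _ _); apply: val_inj.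
  by rewrite /b trmx_ursub ST.
have bC (u : 'rV[R]_n) : 0 <= (u *m C *m u^T) 0 0.
  have := S0 (row_mx (0%:M : 'M[R]_1) u : 'rV[R]_(1 + n)).
  by rewrite SE quad_block expr0n/= !mulr0 mul0r !add0r.
have a0 : 0 <= a.
  have := S0 (row_mx (1%:M : 'M[R]_1) 0 : 'rV[R]_(1 + n)).
  by rewrite SE quad_block expr1n mulr1 trmx0 !mulmx0 !mxE mulr0 !addr0.
have b0 : a = 0 -> b = 0.
  move=> az; apply/rowP => i; rewrite [RHS]mxE.
  pose e : 'rV[R]_n := delta_mx 0 i.
  have be : (b *m e^T) 0 0 = b 0 i.
    by rewrite trmx_delta -colE mxE.
  have h s : 0 <= 2 * s * b 0 i + (e *m C *m e^T) 0 0.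
    have := S0 (row_mx (s%:M : 'M[R]_1) e : 'rV[R]_(1 + n)).
    by rewrite SE quad_block az mul0r add0r be.
  (* For [a = 0] the quadratic form is affine in [s]; this [s] makes it equal to -1 unless [b 0 i]
     is zero. *)
  apply/eqP/negP => /negP bi; have := h (- ((e *m C *m e^T) 0 0 + 1) / (2 * b 0 i)).
  have -> : 2 * (- ((e *m C *m e^T) 0 0 + 1) / (2 * b 0 i)) * b 0 i = - ((e *m C *m e^T) 0 0 + 1).
    by field.
  by rewrite opprD addrAC addNr sub0r oppr_ge0 leNgt ltr01.
pose C' := C - a^-1 *: (b^T *m b).
have C'E (u : 'rV[R]_n) : (u *m C' *m u^T) 0 0 = (u *m C *m u^T) 0 0 - a^-1 * ((b *m u^T) 0 0) ^+ 2.
  rewrite mulmxBr mulmxBl -scalemxAr -scalemxAl [LHS]mxE; congr (_ + _).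
  rewrite [LHS]mxE mxZ; congr (- (_ * _)).
  have -> : u *m (b^T *m b) *m u^T = (u *m b^T) *m (b *m u^T) by rewrite !mulmxA.
  by rewrite [LHS]mxE big_ord1 dotC expr2.
have C'T : C'^T = C'.
  rewrite linearB linearZ/= trmx_mul trmxK; congr (_ - _).
  by rewrite /C trmx_drsub ST.
have C'0 (u : 'rV[R]_n) : 0 <= (u *m C' *m u^T) 0 0.
  rewrite C'E; have [az|an] := eqVneq a 0.
    by rewrite az invr0 mul0r subr0 bC.
  (* For fixed [u] this first coordinate minimizes the form of [S], and the minimum is the Schur
     complement form at [u]. *)
  have := S0 (row_mx ((- (a^-1 * (b *m u^T) 0 0))%:M : 'M[R]_1) u : 'rV[R]_(1 + n)).
  rewrite SE quad_block; congr (_ <= _); move: ((b *m u^T) 0 0) => k; by field.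
have [nu' [_ _ nu'E]] := IH C' C'T C'0.
pose phi (xv : measurableTypeR R * 'rV[R]_n) : 'rV[R]_n.+1 :=
  rV_cons (xv.1, xv.2 + (a^-1 * xv.1) *: b).
have mphi : measurable_fun [set: measurableTypeR R * 'rV[R]_n] phi.
  apply: measurableT_comp (@measurable_rV_cons R n) _.
  apply: measurable_fun_pair => //; apply/measurable_fun_mxP => i j.
  under eq_fun do rewrite !mxE.
  apply: measurable_funD.
    exact: (measurableT_comp (measurable_mx_coord i j)).
  by apply: measurable_funM => //; apply: measurable_funM.
pose phiRV : {mfun (measurableTypeR R * 'rV[R]_n)%type >-> 'rV[R]_n.+1} := HB.pack phi
  (@isMeasurableFun.Build _ _ (measurableTypeR R * 'rV[R]_n)%type 'rV[R]_n.+1 phi mphi).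
exists (distribution (normal_law0 a \x nu')%E phiRV); split => // u A mA.
have -> : ((0 : 'rV[R]_n.+1) *m u^T) 0 0 = 0 by rewrite mul0mx mxE.
pose s := @lsubmx _ 1 1 n u 0 0; pose v : 'rV[R]_n := @rsubmx _ 1 1 n u.
have uE : u = row_mx (s%:M : 'M[R]_1) v :> 'rV[R]_(1 + n).
  by rewrite -[LHS](@hsubmxK _ 1 1 n u); congr row_mx; exact: mx11_scalar.
(* [c] is the total coefficient of the scalar variable in the projection of [phi] on [u]: the
   projection is [c] times a normal variable of variance [a] plus an independent one of variance
   [q]. *)
pose c := s + a^-1 * (b *m v^T) 0 0.
have phiE xv : (phi xv *m u^T) 0 0 = c * xv.1 + (xv.2 *m v^T) 0 0.
  rewrite uE; apply: etrans (dot_row_mx _ _ _ _) _.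
  by rewrite /= mulmxDl mxD -scalemxAl mxZ /c; ring.
have varE : (u *m S *m u^T) 0 0 = c ^+ 2 * a + (v *m C' *m v^T) 0 0.
  rewrite SE uE quad_block C'E /c; have [az|an] := eqVneq a 0.
    rewrite (b0 az) az mul0mx mxE; ring.
  by move: ((b *m v^T) 0 0) => k; field.
rewrite varE /distribution/= /pushforward/=.
have q0 := C'0 v; set q := (v *m C' *m v^T) 0 0 in q0 *.
pose g x := normal_law 0 q ((fun y => x + y) @^-1` A).
transitivity (\int[normal_law0 a]_x g (c * x)%R)%E.
  apply: eq_integral => x _ /=.
  have mAx : measurable ((fun y => c * x + y) @^-1` A : set (measurableTypeR R)).
    by rewrite -[X in measurable X]setTI; apply: measurable_funD.
  have := nu'E v _ mAx; rewrite mul0mx [X in normal_law X]mxE => h.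
  refine (etrans _ h); congr (nu' _).
  by apply/seteqP; split => x'; rewrite /xsection/= inE/= phiE.
rewrite ge0_integral_normal_scale//.
- by rewrite integral_normal_law_conv// mulr_ge0// sqr_ge0.
- exact: measurable_normal_law_shift.
- by move=> x; rewrite /g -normal_law0E.
Qed.

End mvnormal_existence.

(** * Trigonometric polynomials and convergence in law *)

Section bernstein.
Variable R : realType.
Implicit Types (s : R) (f : nat -> R).

(** The weight at [k] of the binomial distribution with parameters [N] and [s]. *)
Fixpoint binw (N k : nat) (s : R) : R :=
  if N is N'.+1 then
    (1 - s) * binw N' k s + s * (if k is k'.+1 then binw N' k' s else 0)
  else (k == 0)%:R.

Lemma binw_ge0 N k s : 0 <= s <= 1 -> 0 <= binw N k s.
Proof.
move=> /andP[s0 s1]; elim: N k => [|N IH] k /=; first exact: ler0n.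
by rewrite addr_ge0 ?mulr_ge0 ?subr_ge0//; case: k.
Qed.

Let binw_gt N k s : (N < k)%N -> binw N k s = 0.
Proof.
elim: N k => [|N IH] [|k]//=; rewrite ltnS => Nk.
by rewrite (IH k)// (IH k.+1) ?mulr0 ?addr0// ltnW.
Qed.

(** Conditioning the binomial expectation of [f] on the outcome of one trial. *)
Let binwS N s f : \sum_(k < N.+2) binw N.+1 k s * f k =
  (1 - s) * (\sum_(k < N.+1) binw N k s * f k) +
  s * (\sum_(k < N.+1) binw N k s * f k.+1).
Proof.
under eq_bigr do rewrite /= mulrDl -!mulrA.
rewrite big_split/= -!mulr_sumr; congr (_ * _ + _ * _).
  by rewrite big_ord_recr/= binw_gt// mul0r addr0.
by rewrite big_ord_recl/= mul0r add0r.
Qed.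

Lemma sum_binw N s : \sum_(k < N.+1) binw N k s = 1.
Proof.
under eq_bigr do rewrite -[binw _ _ _]mulr1.
elim: N => [|N IH]; first by rewrite big_ord1 /= mulr1.
by rewrite (binwS _ _ (fun=> 1)) IH; ring.
Qed.

(** Moments of a shifted variable. One more trial shifts the centered count by -s or 1 - s, so with
    [binwS] this gives the recurrences for the mean and the variance. *)
Let shiftE N s (c : R) f :
  (forall k, f k = (k%:R - N%:R * s) + c) ->
  \sum_(k < N.+1) binw N k s * f k =
    \sum_(k < N.+1) binw N k s * (k%:R - N%:R * s) + c /\
  \sum_(k < N.+1) binw N k s * f k ^+ 2 =
    \sum_(k < N.+1) binw N k s * (k%:R - N%:R * s) ^+ 2 +
    2 * c * (\sum_(k < N.+1) binw N k s * (k%:R - N%:R * s)) + c ^+ 2.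
Proof.
move=> fE; have cE x : \sum_(k < N.+1) binw N k s * x = x.
  by rewrite -mulr_suml sum_binw mul1r.
split.
  rewrite -[X in _ = _ + X]cE -big_split/=; apply: eq_bigr => k _.
  by rewrite fE; ring.
rewrite -[X in _ = _ + X]cE mulr_sumr -!big_split/=; apply: eq_bigr => k _.
by rewrite fE; ring.
Qed.

Let mean_binw N s : \sum_(k < N.+1) binw N k s * (k%:R - N%:R * s) = 0.
Proof.
elim: N => [|N IH]; first by rewrite big_ord1 /= mul0r subr0 mulr0.
rewrite (binwS _ _ (fun k => k%:R - N.+1%:R * s)).
have e1 k : k%:R - N.+1%:R * s = (k%:R - N%:R * s) + - s by rewrite -natr1; ring.
have e2 k : k.+1%:R - N.+1%:R * s = (k%:R - N%:R * s) + (1 - s) by rewrite -!natr1; ring.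
by rewrite (shiftE e1).1 (shiftE e2).1 IH; ring.
Qed.

Lemma var_binw N s :
  \sum_(k < N.+1) binw N k s * (k%:R - N%:R * s) ^+ 2 = N%:R * (s * (1 - s)).
Proof.
elim: N => [|N IH]; first by rewrite big_ord1 /= !mul0r subr0 expr0n mulr0.
rewrite (binwS _ _ (fun k => (k%:R - N.+1%:R * s) ^+ 2)).
have e1 k : k%:R - N.+1%:R * s = (k%:R - N%:R * s) + - s by rewrite -natr1; ring.
have e2 k : k.+1%:R - N.+1%:R * s = (k%:R - N%:R * s) + (1 - s) by rewrite -!natr1; ring.
rewrite (shiftE e1).2 (shiftE e2).2 IH mean_binw -natr1.
by ring.
Qed.

End bernstein.

Section uniform_continuity.
Variable R : realType.

Lemma continuous_map_mx m n (phi : R -> R) : continuous phi ->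
  continuous (fun M : 'M[R]_(m, n) => map_mx phi M).
Proof.
move=> cphi M A [Q MQ QA]; exists (fun i j => phi @^-1` Q i j).
  by move=> i j; apply: cphi; have := MQ i j; rewrite mxE.
by move=> N NQ; apply: QA => i j; rewrite mxE; exact: NQ.
Qed.

(** Only [x] is confined to the cube: compactness is used in its near-covering form, with closeness
    to a neighbor [y] anywhere in the space. *)
Lemma box_unif_continuous n (F : 'rV[R]_n -> R) (a b e : R) : continuous F -> 0 < e ->
  exists2 h : R, 0 < h & forall x y : 'rV[R]_n, (forall i, a <= x 0 i <= b) ->
    (forall i, `|x 0 i - y 0 i| < h) -> `|F x - F y| <= e.
Proof.
move=> cF e0.
have cK : compact [set x : 'rV[R]_n | forall i, `[a, b]%classic (x ord0 i)].
  by apply: (@rV_compact R n (fun=> `[a, b]%classic)) => i; exact: segment_compact.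
pose Q (h : R) (x : 'rV[R]_n) := forall y, ball x h y -> `|F x - F y| <= e.
have cov : \forall h \near (0 : R)^'+, [set x : 'rV[R]_n | forall i, `[a, b]%classic (x ord0 i)] `<=` Q h.
  apply: ((compact_near_coveringP _).1 cK R ((0 : R)^'+) Q _) => x Kx.
  have /cvgrPdist_le/(_ (e / 2)) := cF x.
  have e2 : 0 < e / 2 by rewrite divr_gt0.
  move=> /(_ e2) /nbhs_ballP[r /= r0 rP].
  exists (ball x (r / 2), [set h | 0 < h < r / 2]).
    split; first by apply: nbhsx_ballx; rewrite divr_gt0.
    near=> h; apply/andP; split; near: h; first exact: nbhs_right_gt.
    by apply: nbhs_right_lt; rewrite divr_gt0.
  move=> [z h] /= [xz /andP[h0 hr]] y zy.
  have xy : ball x r y.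
    rewrite (splitr r); apply: ball_triangle xz _.
    exact: le_ball (ltW hr) _ zy.
  have xz' : ball x r z by apply: le_ball xz; lra.
  have := rP _ xy; have := rP _ xz'; rewrite (distrC (F x) (F z)) => h1 h2.
  rewrite (splitr e) (_ : F z - F y = (F z - F x) + (F x - F y)); last by ring.
  by rewrite (le_trans (ler_normD _ _))// lerD.
have /filter_ex[h [h0 hP]] : \forall h \near (0 : R)^'+, 0 < h /\
    [set x : 'rV[R]_n | forall i, `[a, b]%classic (x ord0 i)] `<=` Q h.
  by near=> h; split; near: h => //; exact: nbhs_right_gt.
exists h => // x y xab xy; apply: (hP x) => [i|].
  by rewrite /= in_itv /=; exact: xab.
by split=> // i j; rewrite (ord1 i); exact: xy.
Unshelve. all: by end_near. Qed.

End uniform_continuity.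

Section bernstein_rV.
Variable R : realType.

(** Distributing the product over the sums leaves a factor 1 for each coordinate other than [i0]. *)
Let binw_marginal n N (s : 'rV[R]_n) (i0 : 'I_n) (phi : 'I_N.+1 -> R) :
  \sum_(j : {ffun 'I_n -> 'I_N.+1}) (\prod_i binw N (j i) (s 0 i)) * phi (j i0) =
  \sum_(k < N.+1) binw N k (s 0 i0) * phi k.
Proof.
pose G i (k : 'I_N.+1) := binw N k (s 0 i) * (if i == i0 then phi k else 1).
transitivity (\sum_(j : {ffun 'I_n -> 'I_N.+1}) \prod_i G i (j i)).
  apply: eq_bigr => j _; rewrite big_split/=; congr (_ * _).
  by rewrite -big_mkcond/= big_pred1_eq.
rewrite -(bigA_distr_bigA G) (bigD1 i0)//= [X in _ * X]big1 ?mulr1.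
  by apply: eq_bigr => k _; rewrite /G eqxx.
move=> i /negbTE ii0; under eq_bigr do rewrite /G ii0 mulr1.
exact: sum_binw.
Qed.

Let sum_binw_rV n N (s : 'rV[R]_n) :
  \sum_(j : {ffun 'I_n -> 'I_N.+1}) \prod_i binw N (j i) (s 0 i) = 1.
Proof.
rewrite -(bigA_distr_bigA (fun i (k : 'I_N.+1) => binw N k (s 0 i))).
by rewrite big1// => i _; exact: sum_binw.
Qed.

(** Chebyshev's argument. Grid points within [h] of [s] cost e/2 by uniform continuity. At the
    others some coordinate is off by at least [h], so 2 K <= C (s_i - j_i / N)^2 with C = 2 K / h^2.
    Each coordinate has variance at most 1 / N, whence a total of n C / N <= e/2. *)
Lemma bernstein_approx n (F : 'rV[R]_n -> R) (K e : R) : continuous F ->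
  (forall x, `|F x| <= K) -> 0 < e ->
  exists N (c : {ffun 'I_n -> 'I_N.+1} -> R),
    forall s : 'rV[R]_n, (forall i, 0 <= s 0 i <= 1) ->
    `|F s - \sum_(j : {ffun 'I_n -> 'I_N.+1}) (\prod_i binw N (j i) (s 0 i)) * c j| <= e.
Proof.
move=> cF FK e0; have e2 : 0 < e / 2 by rewrite divr_gt0.
have [h h0 hP] := box_unif_continuous 0 1 cF e2.
have K0 : 0 <= K := le_trans (normr_ge0 _) (FK 0).
pose C := 2 * K / h ^+ 2.
have C0 : 0 <= C by rewrite !mulr_ge0// invr_ge0 sqr_ge0.
have [N Npos hN] : exists2 N, 0 < N%:R :> R & n%:R * C / (e / 2) < N%:R.
  by exists (Num.truncn (n%:R * C / (e / 2))).+1; rewrite ?ltr0n ?truncnS_gt.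
exists N, (fun j : {ffun 'I_n -> 'I_N.+1} => F (\row_i ((j i)%:R / N%:R))) => s s01.
have -> : F s = \sum_(j : {ffun 'I_n -> 'I_N.+1}) (\prod_i binw N (j i) (s 0 i)) * F s.
  by rewrite -mulr_suml sum_binw_rV mul1r.
rewrite -sumrB; apply: le_trans (ler_norm_sum _ _ _) _.
have W0 (j : {ffun 'I_n -> 'I_N.+1}) : 0 <= \prod_i binw N (j i) (s 0 i).
  by apply: prodr_ge0 => i _; exact: binw_ge0.
apply: (@le_trans _ _ (\sum_(j : {ffun 'I_n -> 'I_N.+1})
    ((\prod_i binw N (j i) (s 0 i)) * (e / 2) +
     \sum_i0 C * ((\prod_i binw N (j i) (s 0 i)) * (s 0 i0 - (j i0)%:R / N%:R) ^+ 2)))).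
  apply: ler_sum => j _; rewrite -mulrBr normrM (ger0_norm (W0 j)).
  rewrite (_ : \sum_i0 _ = (\prod_i binw N (j i) (s 0 i)) *
    (\sum_i0 C * (s 0 i0 - (j i0)%:R / N%:R) ^+ 2)); last first.
    by rewrite mulr_sumr; apply: eq_bigr => i _; ring.
  rewrite -mulrDr ler_wpM2l//.
  have T0 i : 0 <= C * (s 0 i - (j i)%:R / N%:R) ^+ 2 by rewrite mulr_ge0// sqr_ge0.
  have [far|near_] := pselect (exists i, h <= `|s 0 i - (j i)%:R / N%:R|).
    have [i hi] := far.
    apply: (@le_trans _ _ (2 * K)).
      by rewrite (le_trans (ler_normB _ _))// mulr_natl mulr2n lerD.
    have S0 : C * (s 0 i - (j i)%:R / N%:R) ^+ 2 <=
        \sum_i0 C * (s 0 i0 - (j i0)%:R / N%:R) ^+ 2.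
      by rewrite (bigD1 i)//= lerDl sumr_ge0.
    apply: (le_trans (le_trans _ S0)); last by rewrite lerDr ltW.
    rewrite -real_normK ?num_real// /C -mulrA ler_peMr ?mulr_ge0//.
    by rewrite mulrC ler_pdivlMr ?exprn_gt0// mul1r ler_sqr ?nnegrE// ltW.
  rewrite -[X in X <= _]addr0 lerD ?sumr_ge0//.
  apply: hP => // i; rewrite mxE ltNge; apply/negP => hi; apply: near_; by exists i.
rewrite big_split/= -mulr_suml sum_binw_rV mul1r [leRHS]splitr lerD2l.
rewrite exchange_big.
apply: (@le_trans _ _ (\sum_(i0 < n) (C / N%:R))); last first.
  rewrite sumr_const card_ord -[_ *+ n]mulr_natl mulrA ler_pdivrMr// [leRHS]mulrC -ler_pdivrMr//.
  exact: ltW.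
apply: ler_sum => i _; rewrite -mulr_sumr ler_wpM2l//.
rewrite (binw_marginal s i (fun k : 'I_N.+1 => (s 0 i - k%:R / N%:R) ^+ 2)).
have N0' : N%:R != 0 :> R by rewrite gt_eqF.
rewrite (_ : \sum_(k < N.+1) _ = N%:R ^- 2 *
    \sum_(k < N.+1) binw N k (s 0 i) * (k%:R - N%:R * s 0 i) ^+ 2); last first.
  by rewrite mulr_sumr; apply: eq_bigr => k _; field.
rewrite var_binw (_ : _ * _ = N%:R^-1 * (s 0 i * (1 - s 0 i))); last by field.
rewrite ler_piMr ?invr_ge0 ?ltW//.
by have /andP[s0 s1] := s01 i; nra.
Qed.

End bernstein_rV.

(** * Trigonometric polynomials and uniform approximation on cubes *)

Section trigonometric_polynomials.
Variables (R : realType) (n : nat).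
Implicit Types f g : 'rV[R]_n -> R.

(** The phase makes one generator enough: [th] = -pi/2 gives sines and [u] = 0 gives constants. *)
Inductive trigpoly : ('rV[R]_n -> R) -> Prop :=
| trigpoly_cos (u : 'rV[R]_n) (th : R) : trigpoly (fun x : 'rV[R]_n => cos ((x *m u^T) 0 0 + th))
| trigpolyD f g : trigpoly f -> trigpoly g -> trigpoly (fun x => f x + g x)
| trigpolyZ c f : trigpoly f -> trigpoly (fun x => c * f x).

Lemma trigpoly_cst (c : R) : trigpoly (fun=> c).
Proof.
rewrite (_ : (fun=> c) = fun x : 'rV[R]_n => c * cos ((x *m (0 : 'rV[R]_n)^T) 0 0 + 0)).
  by apply: trigpolyZ; exact: trigpoly_cos.
by apply/funext => x; rewrite trmx0 mulmx0 mxE addr0 cos0 mulr1.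
Qed.

(** Bilinearity reduces to two cosines, where the product is half the sum of the cosines of the sum
    and the difference of the angles. *)
Lemma trigpolyM f g : trigpoly f -> trigpoly g -> trigpoly (fun x => f x * g x).
Proof.
move=> tf; elim: tf g => {f}.
- move=> u th g; elim => {g}.
  + move=> v ph.
    rewrite (_ : (fun _ => _) = fun x => 2^-1 * (cos ((x *m (u + v)^T) 0 0 + (th + ph)) +
        cos ((x *m (u - v)^T) 0 0 + (th - ph)))).
      by apply: trigpolyZ; apply: trigpolyD; exact: trigpoly_cos.
    apply/funext => x.
    have dD : (x *m (u + v)^T) 0 0 = (x *m u^T) 0 0 + (x *m v^T) 0 0.
      by rewrite linearD mulmxDr mxE.
    have dB : (x *m (u - v)^T) 0 0 = (x *m u^T) 0 0 - (x *m v^T) 0 0.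
      by rewrite linearB mulmxBr !mxE.
    rewrite dD dB; move: ((x *m u^T) 0 0) ((x *m v^T) 0 0) => a b.
    have -> : a + b + (th + ph) = (a + th) + (b + ph) by ring.
    have -> : a - b + (th - ph) = (a + th) - (b + ph) by ring.
    move: (a + th) (b + ph) => {}a {}b.
    by rewrite cosD cosB; field.
  + move=> f g _ hf _ hg.
    by under eq_fun do rewrite mulrDr; exact: trigpolyD.
  + move=> c f _ hf.
    by under eq_fun do rewrite mulrCA; exact: trigpolyZ.
- move=> f1 f2 _ h1 _ h2 g tg.
  by under eq_fun do rewrite mulrDl; apply: trigpolyD; [exact: h1|exact: h2].
- move=> c f _ hf g tg.
  by under eq_fun do rewrite -mulrA; apply: trigpolyZ; exact: hf.
Qed.

Lemma trigpoly_sum (I : Type) (r : seq I) (F : I -> 'rV[R]_n -> R) :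
  (forall i, trigpoly (F i)) -> trigpoly (fun x => \sum_(i <- r) F i x).
Proof.
move=> tF; elim: r => [|i r IH].
  by under eq_fun do rewrite big_nil; exact: trigpoly_cst.
by under eq_fun do rewrite big_cons; exact: trigpolyD.
Qed.

Lemma trigpoly_prod (I : Type) (r : seq I) (F : I -> 'rV[R]_n -> R) :
  (forall i, trigpoly (F i)) -> trigpoly (fun x => \prod_(i <- r) F i x).
Proof.
move=> tF; elim: r => [|i r IH].
  by under eq_fun do rewrite big_nil; exact: trigpoly_cst.
by under eq_fun do rewrite big_cons; exact: trigpolyM.
Qed.

Lemma trigpoly_binw N k f : trigpoly f -> trigpoly (fun x => binw N k (f x)).
Proof.
move=> tf; elim: N k => [|N IH] k /=; first exact: trigpoly_cst.
apply: trigpolyD; apply: trigpolyM => //.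
  apply: trigpolyD; first exact: trigpoly_cst.
  by under eq_fun do rewrite -mulN1r; exact: trigpolyZ.
by case: k => [|k]; [exact: trigpoly_cst|exact: IH].
Qed.

Lemma measurable_dot d (T : measurableType d) (X : T -> 'rV[R]_n) (u : 'rV[R]_n) :
  measurable_fun [set: T] X -> measurable_fun [set: T] (fun t => (X t *m u^T) 0 0).
Proof.
move=> mX; under eq_fun do rewrite mxE.
apply: measurable_sum => i; apply: measurable_funM; last exact: measurable_cst.
by have /measurable_fun_mxP := mX; apply.
Qed.

Lemma trigpoly_bmfun f : trigpoly f -> bmfun f.
Proof.
elim => {f} => [u th|f g _ bf _ bg|c f _ bf].
- by apply: bmfun_cos; apply: measurable_funD => //; apply: measurable_dot; exact: measurable_id.
- exact: bmfunD.
- exact: bmfunZ.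
Qed.

End trigonometric_polynomials.

Section trigonometric_approximation.
Variables (R : realType) (n : nat).

Let clip (c r : R) : R := Num.max (- c) (Num.min c r).

Let clip_bound (c r : R) : 0 <= c -> - c <= clip c r <= c.
Proof.
by move=> c0; rewrite /clip le_max lexx/= ge_max ge_min lexx/= andbT; lra.
Qed.

Let clip_id (c r : R) : - c <= r <= c -> clip c r = r.
Proof. by move=> /andP[h1 h2]; rewrite /clip min_r// max_r. Qed.

Let continuous_clip (c : R) : continuous (clip c).
Proof.
move=> r; apply: (@continuous_max R R (fun=> - c) (fun x => Num.min c x) r).
  exact: cvg_cst.
apply: (@continuous_min R R (fun=> c) (fun x => x) r); first exact: cvg_cst.
exact: cvg_id.
Qed.

(** Keeps the arguments of [asin] away from -1 and 1, so that it is continuous there; this is why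
    the cube is rescaled to angles in [-1, 1] rather than up to pi/2. *)
Let sin1_bound : 0 <= sin (1 : R) < 1.
Proof.
have pi1 := @pihalf_ge1 R; rewrite sin_ge0_pi/=; last first.
  by rewrite ler01/=; have := @pi_ge2 R; lra.
have c1 := @cos1_gt0 R; have := cos2Dsin2 (1 : R); rewrite ltNge; apply: contra_eqN => s1.
by nra.
Qed.

(** Clipping extends the inverse of x -> (1 + sin (x / L)) / 2 to a continuous function on the whole
    line. *)
Let unwind (L r : R) : R := L * asin (clip (sin 1) (2 * r - 1)).

Let continuous_unwind (L : R) : continuous (unwind L).
Proof.
move=> r; have /andP[s0 s1] := sin1_bound.
have c1 : {for r, continuous (fun r : R => 2 * r - 1)}.
  by apply: cvgB; [apply: cvgMr; exact: cvg_id|exact: cvg_cst].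
have c2 : {for r, continuous (fun r : R => clip (sin 1) (2 * r - 1))}.
  exact: (continuous_comp c1 (@continuous_clip (sin 1) _)).
apply: cvgMr; apply: (continuous_comp c2); apply: continuous_asin.
by have /andP[h1 h2] := clip_bound (2 * r - 1) s0; apply/andP; split; lra.
Qed.

Let unwindK (L x : R) : 0 < L -> `|x| <= L -> unwind L (2^-1 * (1 + sin (x / L))) = x.
Proof.
move=> L0 xL; have pi1 := @pihalf_ge1 R.
have /andP[y1 y2] : -1 <= x / L <= 1.
  by rewrite -ler_norml normrM normfV (gtr0_norm L0) ler_pdivrMr ?mul1r.
rewrite /unwind mulrA divff// mul1r addrAC subrr add0r clip_id; last first.
  rewrite -sinN; apply/andP; split; rewrite leNgt ltr_sin ?in_itv/= -?leNgt//;
  by apply/andP; split; lra.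
rewrite sinK; last by rewrite in_itv/=; apply/andP; split; lra.
by rewrite mulrC divfK// gt_eqF.
Qed.

Lemma measurable_coord_gt (L : R) i : measurable [set x : 'rV[R]_n | L < `|x 0 i|].
Proof.
rewrite -[X in measurable X]setTI.
have -> : [set x : 'rV[R]_n | L < `|x 0 i|] = (fun x : 'rV[R]_n => `|x 0 i|) @^-1` `]L, +oo[.
  by apply/seteqP; split => x /=; rewrite in_itv/= andbT.
have mc : measurable_fun [set: 'rV[R]_n] (fun x : 'rV[R]_n => `|x 0 i|).
  by apply: measurableT_comp => //; exact: measurable_mx_coord.
exact: mc.
Qed.

(** The map [x |-> ((1 + sin (x_i / L)) / 2)_i] is injective on [[-L, L]^n], with
    left inverse [unwind]: compose it with a Bernstein polynomial of
    [f \o unwind].  Outside of the cube only boundedness is used. *)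
Lemma trigpoly_approx (f : 'rV[R]_n -> R) (K L e : R) : continuous f ->
  (forall x, `|f x| <= K) -> 0 < L -> 0 < e ->
  exists2 g, trigpoly g & forall x,
    `|f x - g x| <= e + 2 * K * \sum_(i < n) \1_[set x : 'rV[R]_n | L < `|x 0 i|] x.
Proof.
move=> cf fK L0 e0; pose F (s : 'rV[R]_n) := f (map_mx (unwind L) s).
have cF : continuous F.
  move=> s; apply: (@continuous_comp _ _ _ (map_mx (unwind L)) f); last exact: cf.
  by apply: continuous_map_mx; exact: continuous_unwind.
have [N [c gP]] := bernstein_approx cF (fun s => fK _) e0.
pose w (x : 'rV[R]_n) : 'rV[R]_n := \row_i (2^-1 * (1 + sin (x 0 i / L))).
exists (fun x => \sum_(j : {ffun 'I_n -> 'I_N.+1})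
    (\prod_i binw N (j i) (2^-1 * (1 + sin (x 0 i / L)))) * c j).
  apply: trigpoly_sum => j; apply: trigpolyM; last exact: trigpoly_cst.
  apply: trigpoly_prod => i; apply: trigpoly_binw; apply: trigpolyZ.
  apply: trigpolyD; first exact: trigpoly_cst.
  rewrite (_ : (fun x : 'rV[R]_n => sin (x 0 i / L)) = fun x : 'rV[R]_n =>
      cos ((x *m (L^-1 *: (delta_mx 0 i : 'rV[R]_n))^T) 0 0 + (- (pi / 2)))).
    exact: trigpoly_cos.
  apply/funext => x; rewrite cosBpihalf linearZ/= -scalemxAr mxE trmx_delta -colE mxE.
  by rewrite mulrC.
move=> x; have := gP (w x) _.
rewrite (eq_bigr (fun j : {ffun 'I_n -> 'I_N.+1} =>
   (\prod_i binw N (j i) (2^-1 * (1 + sin (x 0 i / L)))) * c j)); last first.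
  by move=> j _; congr (_ * _); apply: eq_bigr => i _; rewrite mxE.
set g := \sum_j _ => /(_ _)/[dup] gx.
have {}gx : `|F (w x) - g| <= e.
  apply: gx => i; rewrite mxE.
  by have := sin_geN1 (x 0 i / L); have := sin_le1 (x 0 i / L) => h1 h2; apply/andP; split; lra.
move=> _; have K0 : 0 <= K := le_trans (normr_ge0 _) (fK 0).
have I0 (i : 'I_n) : 0 <= \1_[set x : 'rV[R]_n | L < `|x 0 i|] x :> R.
  by rewrite indicE ler0n.
(* Outside the cube [f x] and [F (w x)] are unrelated values of [f], so they differ by at most 2 K,
   and the sum of indicators is at least 1. *)
have [[i xi]|small] := pselect (exists i, L < `|x 0 i|).
  apply: (@le_trans _ _ (2 * K + e)).
    rewrite (_ : f x - g = (f x - F (w x)) + (F (w x) - g)); last by ring.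
    rewrite (le_trans (ler_normD _ _))// lerD// (le_trans (ler_normB _ _))//.
    by rewrite mulr_natl mulr2n lerD// fK.
  rewrite addrC lerD2l ler_peMr ?mulr_ge0// (bigD1 i)//= indicE mem_set//.
  by rewrite lerDl sumr_ge0.
have -> : f x = F (w x).
  congr (f _); apply/rowP => i; rewrite !mxE unwindK// leNgt; apply/negP => xi.
  by apply: small; exists i.
by rewrite (le_trans gx)// lerDl !mulr_ge0// sumr_ge0.
Qed.

End trigonometric_approximation.

(** * From cosine transforms to convergence in law *)

Section weak_convergence.
Context d (T : measurableType d) (R : realType) (P : probability T R) (n : nat).
Variables (X : nat -> T -> 'rV[R]_n) (nu : probability 'rV[R]_n R) (C : R).

Lemma norm_bRintegral_le d' (T' : measurableType d') (Q : probability T' R) (f g : T' -> R) :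
  bmfun f -> bmfun g -> (forall x, `|f x| <= g x) -> `|\int[Q]_x f x| <= \int[Q]_x g x.
Proof.
move=> bf bg fg; rewrite ler_norml; apply/andP; split.
  rewrite -[X in - X]mul1r -mulNr -bRintegralZl// le_bRintegral//; first exact: bmfunZ.
  by move=> x; rewrite mulN1r; have := fg x; rewrite ler_norml => /andP[].
by apply: le_bRintegral => // x; rewrite (le_trans (ler_norm _)).
Qed.

Hypothesis bX : forall k i, bmfun (fun t => X k t 0 i).
Hypothesis X2 : forall k i, \int[P]_t (X k t 0 i ^+ 2) <= C.
Hypothesis cos_cvg : forall (u : 'rV[R]_n) (th : R),
  \int[P]_t cos ((X k t *m u^T) 0 0 + th) @[k --> \oo] -->
  \int[nu]_x cos ((x *m u^T) 0 0 + th).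

Let mX k : measurable_fun [set: T] (X k).
Proof. by apply/measurable_fun_mxP => i j; rewrite (ord1 i); have [] := bX k j. Qed.

Let bcomp k (f : 'rV[R]_n -> R) : bmfun f -> bmfun (fun t => f (X k t)).
Proof. by move=> [mf Kf]; exact: bmfun_comp. Qed.

Let trigpoly_cvg g : trigpoly g ->
  \int[P]_t g (X k t) @[k --> \oo] --> \int[nu]_x g x.
Proof.
elim => {g} [u th|f g tf hf tg hg|c f tf hf]; first exact: cos_cvg.
- have [bf bg] := (trigpoly_bmfun tf, trigpoly_bmfun tg).
  rewrite bRintegralD//; under eq_fun do rewrite (bRintegralD P (bcomp _ bf) (bcomp _ bg)); exact: cvgD.
- have bf := trigpoly_bmfun tf.
  by rewrite bRintegralZl//; under eq_fun do rewrite (bRintegralZl P _ (bcomp _ bf)); exact: cvgMr.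
Qed.

Lemma continuous_measurable_rV (f : 'rV[R]_n -> R) : continuous f ->
  measurable_fun [set: 'rV[R]_n] f.
Proof.
move=> cf; apply: (measurability _ (RGenOInfty.measurableE R)) => _ [_ [a ->] <-].
rewrite setTI; apply: sub_sigma_algebra.
by apply: open_comp; last exact: interval_open.
Qed.

Lemma cvg_in_law_cos : cvg_in_law P X nu.
Proof.
move=> f cf [M [Mreal fM]].
(* [bounded_fun] gives a bound for every real above [M], hence M + 1. *)
pose K := Num.max 0 (M + 1).
have fK x : `|f x| <= K.
  by rewrite /K le_max; apply/orP; right; apply: fM => //; rewrite ltrDl.
have K0 : 0 <= K by rewrite /K le_max lexx.
have bf : bmfun f by split; [exact: continuous_measurable_rV|exists K].
rewrite -(EFin_Rintegral nu bf).
rewrite (_ : (fun k => 'E_P[f \o X k])%E = fun k => (\int[P]_t f (X k t))%:E); last first.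
  by apply/funext => k; rewrite unlock EFin_Rintegral//; exact: bcomp.
apply: cvg_EFin; first by apply: nearW.
pose ind (m : nat) i := \1_[set x : 'rV[R]_n | m.+1%:R < `|x 0 i|] : 'rV[R]_n -> R.
have bind m i : bmfun (ind m i) by apply: bmfun_indic; exact: measurable_coord_gt.
(* Tightness: the tails of [nu] vanish by dominated convergence, those of [X k] uniformly in [k] by
   Chebyshev and the second moment bound [C]. *)
have tail_nu : 2 * K * \sum_i \int[nu]_x ind m i x @[m --> \oo] --> (0 : R).
  rewrite -[X in _ --> X](mulr0 (2 * K)); apply: cvgMr.
  rewrite [X in _ --> X](_ : 0 = \sum_(i < n) (0 : R)); last by rewrite big1.
  apply: cvg_big => [|i _]; first exact: add_continuous.
  rewrite -[X in _ --> X](@RintegralT_cst _ _ _ nu).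
  have [] := @bRintegral_cvg _ _ _ nu (fun m => ind m i) (fun=> 0) 1; last by [].
  - by move=> m; have [] := bind m i.
  - by move=> m x; rewrite /ind indicE; case: (_ \in _); rewrite ?normr1 ?normr0.
  - move=> x; apply: cvg_near_cst; near=> m; rewrite /ind indicE memNset//= => xm.
    have : m.+1%:R <= `|x 0 i| by exact: ltW.
    apply/negP; rewrite -ltNge; near: m.
    by exists (Num.truncn `|x 0 i|) => // m /= hm; rewrite (lt_le_trans (truncnS_gt _))// ler_nat.
have tail_P : 2 * K * \sum_(i < n) (C / m.+1%:R ^+ 2) @[m --> \oo] --> (0 : R).
  rewrite -[X in _ --> X](mulr0 (2 * K)); apply: cvgMr.
  rewrite [X in _ --> X](_ : 0 = \sum_(i < n) (0 : R)); last by rewrite big1.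
  apply: cvg_big => [|i _]; first exact: add_continuous.
  rewrite -[X in _ --> X](mulr0 C); apply: cvgMr.
  rewrite (_ : (fun m => _) = fun m => (m.+1%:R : R)^-1 * m.+1%:R^-1); last first.
    by apply/funext => m; rewrite expr2 invfM.
  by rewrite -[X in _ --> X](mulr0 0); apply: cvgM; exact: cvg_harmonic.
apply/cvgrPdist_le => e e0; have e5 : 0 < e / 5 by rewrite divr_gt0.
have [m [hN hP]] : exists m, `|2 * K * \sum_i \int[nu]_x ind m i x| <= e / 5 /\
    `|2 * K * \sum_(i < n) (C / m.+1%:R ^+ 2)| <= e / 5.
  apply: (@filter_ex _ \oo); near=> m; split; near: m.
    by move/cvgrPdist_le : tail_nu => /(_ _ e5); apply: filterS => m; rewrite sub0r normrN.
  by move/cvgrPdist_le : tail_P => /(_ _ e5); apply: filterS => m; rewrite sub0r normrN.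
have [g tg fg] := trigpoly_approx cf fK (ltr0Sn R m) e5.
have bg := trigpoly_bmfun tg.
pose h x := e / 5 + 2 * K * \sum_i ind m i x.
have bh : bmfun h.
  by apply: bmfunD; [exact: bmfun_cst|apply: bmfunZ; apply: bmfun_sum].
have bfg : bmfun (fun x => f x - g x) by exact: bmfunB.
have nuh : `|\int[nu]_x f x - \int[nu]_x g x| <= e / 5 + e / 5.
  rewrite -bRintegralB// (le_trans (norm_bRintegral_le nu bfg bh fg))//.
  rewrite bRintegralD; [|exact: bmfun_cst|by apply: bmfunZ; apply: bmfun_sum].
  rewrite RintegralT_cst lerD2l bRintegralZl; last exact: bmfun_sum.
  by rewrite bRintegral_sum// (le_trans (ler_norm _)).
have Ph k : `|\int[P]_t f (X k t) - \int[P]_t g (X k t)| <= e / 5 + e / 5.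
  rewrite -bRintegralB//; [|exact: bcomp..].
  rewrite (le_trans (norm_bRintegral_le P (bcomp k bfg) (bcomp k bh) (fun t => fg _)))//.
  have bs : bmfun (fun t => \sum_(i < n) ind m i (X k t)).
    by apply: bmfun_sum => i _; exact: (bcomp k (bind m i)).
  rewrite bRintegralD; [|exact: bmfun_cst|exact: bmfunZ].
  rewrite RintegralT_cst lerD2l bRintegralZl//.
  rewrite bRintegral_sum; last by move=> i _; exact: (bcomp k (bind m i)).
  rewrite (le_trans _ (le_trans (ler_norm _) hP))// ler_wpM2l ?mulr_ge0//.
  (* Chebyshev: the indicator of |x_i| > m + 1, times (m + 1)^2, is at most x_i^2. *)
  apply: ler_sum => i _; rewrite ler_pdivlMr ?exprn_gt0// -bRintegralZr; last exact: (bcomp k (bind m i)).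
  apply: le_trans (X2 k i); apply: le_bRintegral.
  - by apply: bmfunM; [exact: (bcomp k (bind m i))|exact: bmfun_cst].
  - exact: bmfunX.
  - move=> t; rewrite /ind indicE; have [|_] := boolP (_ \in _); rewrite ?mul0r ?sqr_ge0//.
    rewrite inE/= mul1r -[leRHS]real_normK ?num_real// => /ltW Xm.
    by rewrite ler_sqr ?nnegrE.
(* The budget in fifths: under each of the two laws, one for approximation on the cube and one for
   the tail, and a last one for the convergence of the integrals of [g]. *)
have tri (a b c c' : R) : `|a - b| <= e / 5 + e / 5 -> `|c - c'| <= e / 5 + e / 5 ->
    `|b - c'| <= e / 5 -> `|a - c| <= e.
  by rewrite !ler_norml; lra.
have /cvgrPdist_le/(_ _ e5) := trigpoly_cvg tg.
apply: filterS => k gk.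
exact: (tri _ _ _ _ nuh (Ph k) gk).
Unshelve. all: by end_near. Qed.

End weak_convergence.

(** * The Hoeffding decomposition of a U-statistic *)

Lemma norm_cosB_le (R : realType) (a b : R) : `|cos a - cos b| <= `|a - b|.
Proof.
have -> : cos a - cos b = - 2 * (sin ((a + b) / 2) * sin ((a - b) / 2)).
  have aE : a = (a + b) / 2 + (a - b) / 2 by field.
  have bE : b = (a + b) / 2 - (a - b) / 2 by field.
  by rewrite [in LHS]aE [in X in _ - X]bE cosD cosB; ring.
rewrite mulrCA normrM (le_trans (ler_piMl _ (sin_max _)))// normrM normrN.
rewrite (@ger0_norm _ 2)// -ler_pdivlMl// (le_trans (norm_sin_le _))//.
by rewrite normrM (@ger0_norm _ 2^-1)// mulrC.
Qed.

Section ustatistic.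
Context d d' (T : measurableType d) (T' : measurableType d') (R : realType).
Variables (P : probability T R) (y : nat -> {RV P >-> T'}) (F : probability T' R).
Hypothesis y_dist : forall i (A : set T'), measurable A -> distribution P (y i) A = F A.
Hypothesis y_indep : mutually_independent y.

Let prod_single n i (phi : nat -> R) : (i < n)%N ->
  \prod_(m < n) (if (m : nat) == i then phi m else 1) = phi i.
Proof.
move=> i_n; rewrite (bigD1 (Ordinal i_n))//= eqxx big1 ?mulr1// => m.
by rewrite -val_eqE/= => /negbTE ->.
Qed.

(** The indices [i], [k], [l] may coincide. Independence is stated for one factor per index, so
    [sel] attaches each function to its own index and 1 elsewhere, and coinciding indices collect
    the product. *)
Let Rintegral_factor i j k l (a b c e : T' -> R) : j != i -> j != k -> j != l ->
  bmfun a -> bmfun b -> bmfun c -> bmfun e ->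
  \int[P]_t (a (y i t) * e (y j t) * (b (y k t) * c (y l t))) =
  (\int[P]_t (a (y i t) * (b (y k t) * c (y l t)))) * \int[F]_x e x.
Proof.
move=> ji jk jl ba bb bc be.
pose sel i (phi : T' -> R) (m : nat) x : R := if m == i then phi x else 1.
have bsel i' phi m : bmfun phi -> bmfun (sel i' phi m).
  by move=> bphi; rewrite /sel; case: eqP => // _; exact: bmfun_cst.
pose n := (i + j + k + l).+1.
have [i_n j_n k_n l_n] : [/\ (i < n)%N, (j < n)%N, (k < n)%N & (l < n)%N].
  by rewrite /n; split; lia.
pose f m x := sel i a m x * sel j e m x * (sel k b m x * sel l c m x).
pose f' m x := sel i a m x * (sel k b m x * sel l c m x).
have bf m : bmfun (f m) by do 2 apply: bmfunM => //; try (apply: bmfunM => //); exact: bsel.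
have bf' m : bmfun (f' m) by apply: bmfunM; [exact: bsel|apply: bmfunM; exact: bsel].
have selE i' phi t : (i' < n)%N -> \prod_(m < n) sel i' phi m (y m t) = phi (y i' t).
  by move=> i'n; rewrite -(prod_single (fun m => phi (y m t)) i'n); apply: eq_bigr.
transitivity (\int[P]_t \prod_(m < n) f m (y m t)).
  by apply: eq_Rintegral => t _; rewrite !big_split/= !selE.
rewrite [X in _ = X * _](_ : _ = \int[P]_t \prod_(m < n) f' m (y m t)); last first.
  by apply: eq_Rintegral => t _; rewrite !big_split/= !selE.
rewrite !(Rintegral_prod_indep y_indep)// (bigD1 (Ordinal j_n))//=.
rewrite [in RHS](bigD1 (Ordinal j_n))//=.
rewrite (_ : \int[P]_t f j (y j t) = \int[F]_x e x); last first.
  rewrite -(Rintegral_law y_dist j be); apply: eq_Rintegral => t _.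
  by rewrite /f /sel eqxx !ifN// !mul1r mulr1.
rewrite (_ : \int[P]_t f' j (y j t) = 1); last first.
  rewrite -[RHS](RintegralT_cst P); apply: eq_Rintegral => t _.
  by rewrite /f' /sel !ifN// !mul1r.
rewrite mul1r mulrC; congr (_ * _); apply: eq_bigr => m.
rewrite -val_eqE/= => mj; apply: eq_Rintegral => t _.
by rewrite /f /f' /sel (ifN _ _ mj) mulr1.
Qed.

Let mpair k l : measurable_fun [set: T] (fun t => (y k t, y l t)).
Proof. exact: measurable_fun_pair. Qed.

Let bpair (f : (T' * T')%type -> R) k l : bmfun f -> bmfun (fun t => f (y k t, y l t)).
Proof. by move=> [mf Kf]; exact: (bmfun_comp mf Kf (mpair k l)). Qed.

(** Conditioning on all observations but [y j]. Reduce [g] to a rectangle first, so that its factors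
    become the weight [W] of [Rintegral_integrate_out]; the reduction of [f] to rectangles then
    leaves [Rintegral_factor]. *)
Lemma Rintegral_pair_condition i j k l (f g : (T' * T')%type -> R) :
  j != i -> j != k -> j != l -> bmfun f -> bmfun g ->
  \int[P]_t (f (y i t, y j t) * g (y k t, y l t)) =
  \int[P]_t ((\int[F]_x f (y i t, x)) * g (y k t, y l t)).
Proof.
move=> ji jk jl bf bg; apply/eqP; rewrite -subr_eq0; apply/eqP.
have bf1 : bmfun (fun t => \int[F]_x f (y i t, x)).
  exact: (bmfun_RV y i (bmfun_Rintegral F bf)).
have L1 := bclinear_integral P (mpair k l) (bpair i j bf).
have L2 := bclinear_integral P (mpair k l) bf1.
have := bclinear_pair_eq0 (bclinearB L1 L2) _ bg.
under eq_Rintegral do rewrite mulrC.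
under [X in _ - X]eq_Rintegral do rewrite mulrC.
apply=> A B mA mB /=; apply/eqP; rewrite subr_eq0; apply/eqP.
under eq_Rintegral do rewrite mulrC.
under [RHS]eq_Rintegral do rewrite mulrC.
have bi (C : set T') m : measurable C -> bmfun (fun t => \1_C (y m t) : R).
  by move=> mC; apply: bmfun_RV; exact: bmfun_indic.
apply: (@Rintegral_integrate_out _ _ _ P _ _ _ _ F (fun t => y i t) (fun t => y j t)
  (fun t => \1_A (y k t) * \1_B (y l t))) => //.
  by apply: bmfunM; exact: bi.
move=> A' B' mA' mB'; apply: Rintegral_factor => //; exact: bmfun_indic.
Qed.

Lemma Rintegral_pair i j (f : (T' * T')%type -> R) : i != j -> bmfun f ->
  \int[P]_t f (y i t, y j t) = \int[F]_x \int[F]_x' f (x, x').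
Proof.
rewrite eq_sym => ji bf.
have := Rintegral_pair_condition ji ji ji bf (bmfun_cst _ 1).
under eq_Rintegral do rewrite mulr1.
under [X in _ = X]eq_Rintegral do rewrite mulr1.
by move=> ->; rewrite (Rintegral_law y_dist i (bmfun_Rintegral F bf)).
Qed.

Variables (k : (T' * T')%type -> R) (K : R).
Hypothesis mk : measurable_fun [set: (T' * T')%type] k.
Hypothesis kK : forall x, `|k x| <= K.
Hypothesis k_sym : forall x x', k (x, x') = k (x', x).

Let k1 x := \int[F]_x' k (x, x').

Let bk : bmfun k. Proof. by split=> //; exists K. Qed.

Let bk1 : bmfun k1. Proof. exact: bmfun_Rintegral. Qed.

Hypothesis k_mean : \int[F]_x k1 x = 0.

(** The degenerate part of the kernel in its Hoeffding decomposition. *)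
Let kt (x : (T' * T')%type) := k x - k1 x.1 - k1 x.2.

Let bfst : bmfun (fun x : (T' * T')%type => k1 x.1).
Proof. by have [m K1] := bk1; exact: (bmfun_comp m K1 measurable_fst). Qed.

Let bsnd : bmfun (fun x : (T' * T')%type => k1 x.2).
Proof. by have [m K1] := bk1; exact: (bmfun_comp m K1 measurable_snd). Qed.

Let bkt : bmfun kt. Proof. by do 2 apply: bmfunB => //. Qed.

Let kt_sym x x' : kt (x, x') = kt (x', x).
Proof. by rewrite /kt/= k_sym; ring. Qed.

Let bsection (f : (T' * T')%type -> R) x : bmfun f -> bmfun (fun x' => f (x, x')).
Proof. by move=> [mf Kf]; exact: (bmfun_comp mf Kf (measurable_pair1 x)). Qed.

Let kt_degenerate x : \int[F]_x' kt (x, x') = 0.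
Proof.
have bx := bsection x bk.
rewrite /kt/= bRintegralB//; last by apply: bmfunB => //; exact: bmfun_cst.
rewrite bRintegralB//; last exact: bmfun_cst.
by rewrite RintegralT_cst k_mean subrr subr0.
Qed.

Let kt_bound x : `|kt x| <= 3 * K.
Proof.
have k1K u : `|k1 u| <= K.
  by apply: bRintegral_norm_le => [|u']; [have [] := bsection u bk|exact: kK].
rewrite /kt (le_trans (ler_normB _ _))// (le_trans (lerD (ler_normB _ _) (lexx _)))//.
by have := kK x; have := k1K x.1; have := k1K x.2; lra.
Qed.

(** One of the four indices differs from the other three: integrate it out. *)
Let kt_orthogonal i j m l : (i < j)%N -> (m < l)%N -> ~~ ((i == m) && (j == l)) ->
  \int[P]_t (kt (y i t, y j t) * kt (y m t, y l t)) = 0.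
Proof.
have key i' j' m' l' : j' != i' -> j' != m' -> j' != l' ->
    \int[P]_t (kt (y i' t, y j' t) * kt (y m' t, y l' t)) = 0.
  move=> h1 h2 h3; rewrite Rintegral_pair_condition//.
  under eq_Rintegral do rewrite kt_degenerate mul0r.
  exact: RintegralT_cst.
move=> ij ml ne; have [jml|] := boolP ((j == m) || (j == l)); last first.
  by rewrite negb_or => /andP[? ?]; apply: key => //; lia.
(* Here [i] is the isolated index: it is below [j], and [i = m] would force [j = l] and make the
   pairs equal. Symmetry moves it to the slot that [key] integrates. *)
under eq_Rintegral do rewrite kt_sym.
by apply: key; lia.
Qed.

Let rem n t := \sum_(i < n) \sum_(j < n | (i < j)%N) kt (y i t, y j t).

Let bktp i j : bmfun (fun t => kt (y i t, y j t)). Proof. exact: bpair. Qed.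

Let brem n : bmfun (rem n).
Proof. by apply: bmfun_sum => i _; apply: bmfun_sum => j _. Qed.

(** In the expanded square only the products of a pair with itself survive: at most n^2 terms, each
    bounded by [(3 * K) ^+ 2]. Without orthogonality the order would be n^4. *)
Let rem2_le n : \int[P]_t (rem n t ^+ 2) <= n%:R ^+ 2 * (3 * K) ^+ 2.
Proof.
have K0 : 0 <= K.
  by have /bRintegral_norm_le : measurable_fun [set: T] (fun t => k (y 0 t, y 0 t));
    [have [] := bpair 0 0 bk|move=> /(_ _ K) h; apply: le_trans (h P _)].
pose M := (3 * K) ^+ 2; have M0 : 0 <= M by exact: sqr_ge0.
have b4 i j m l : bmfun (fun t => kt (y i t, y j t) * kt (y m t, y l t)).
  exact: bmfunM.
rewrite (_ : \int[P]_t _ = \sum_(i < n) \sum_(j < n | (i < j)%N)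
    \sum_(m < n) \sum_(l < n | (m < l)%N)
    \int[P]_t (kt (y i t, y j t) * kt (y m t, y l t))); last first.
  under eq_Rintegral do rewrite expr2 mulr_suml.
  rewrite bRintegral_sum; last first.
    by move=> i _; apply: bmfunM => //; exact: bmfun_sum.
  apply: eq_bigr => i _.
  under eq_Rintegral do rewrite mulr_suml.
  rewrite bRintegral_sum; last by move=> j _; exact: bmfunM.
  apply: eq_bigr => j _.
  under eq_Rintegral do rewrite mulr_sumr.
  rewrite bRintegral_sum; last first.
    by move=> m _; apply: bmfunM => //; exact: bmfun_sum.
  apply: eq_bigr => m _.
  under eq_Rintegral do rewrite mulr_sumr.
  by rewrite bRintegral_sum// => l _; exact: bmfunM.
apply: (@le_trans _ _ (\sum_(i < n) \sum_(j < n) M)); last first.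
  by rewrite !sumr_const card_ord -mulrnA -[M *+ _]mulr_natl natrM.
apply: ler_sum => i _; rewrite big_mkcond; apply: ler_sum => j _.
case: ifPn => // ij.
rewrite (bigD1 i)//= (bigD1 j)//= big1 ?addr0 => [|l /andP[il lj]]; last first.
  by apply: kt_orthogonal => //; rewrite eqxx/= eq_sym.
rewrite big1 ?addr0 => [|m mi]; last first.
  rewrite big1// => l ml; apply: kt_orthogonal => //.
  by rewrite negb_and eq_sym mi.
apply: le_trans (ler_norm _) _; apply: bRintegral_norm_le => [|t]; first by have [] := b4 i j i j.
by rewrite normrM /M expr2 ler_pM.
Qed.

(** Each index lies in n - 1 pairs. *)
Let sum_pairs n (a : nat -> R) :
  \sum_(i < n) \sum_(j < n | (i < j)%N) (a i + a j) = (n%:R - 1) * \sum_(i < n) a i.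
Proof.
elim: n => [|n IH]; first by rewrite !big_ord0 mulr0.
rewrite big_ord_recr/= [X in _ + X]big_pred0 ?addr0; last first.
  by move=> j; apply/negbTE; rewrite -leqNgt -ltnS.
under eq_bigr do rewrite big_mkcond big_ord_recr/= -big_mkcond/= ltn_ord.
rewrite big_split/= IH big_split/= sumr_const card_ord -[_ *+ n]mulr_natl.
by rewrite big_ord_recr/= -natr1; ring.
Qed.

Let U n t := Num.sqrt n%:R * ('C(n, 2)%:R^-1 *
  \sum_(i < n) \sum_(j < n | (i < j)%N) k (y i t, y j t)).

(** The Hajek projection of [U n]; the factor 2 counts the two arguments of the kernel. *)
Let A n t := (Num.sqrt n%:R)^-1 * \sum_(i < n) (2 * k1 (y i t)).

Let bin2E n : 'C(n, 2)%:R = n%:R * (n%:R - 1) / 2 :> R.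
Proof.
case: n => [|n]; first by rewrite !mul0r.
have := mul_bin_diag n.+1 1; rewrite bin1 => /(congr1 (fun m => m%:R : R)).
by rewrite !natrM -natr1/= => h; rewrite addrK h; field.
Qed.

(** By [sum_pairs] the linear part of the kernel sums to (n - 1) times the sum of [k1], and sqrt n
    (n - 1) / C(n, 2) = 2 / sqrt n. *)
Let hajek n t : (1 < n)%N -> U n t - A n t = Num.sqrt n%:R * ('C(n, 2)%:R^-1 * rem n t).
Proof.
move=> n1; have n0 : n%:R != 0 :> R by rewrite pnatr_eq0; lia.
have n10 : n%:R - 1 != 0 :> R by rewrite subr_eq0 -[1]/(1%:R) eqr_nat; lia.
have s0 : Num.sqrt n%:R != 0 :> R by rewrite sqrtr_eq0 -ltNge ltr0n; lia.
have -> : rem n t = \sum_(i < n) \sum_(j < n | (i < j)%N) k (y i t, y j t) -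
    (n%:R - 1) * \sum_(i < n) k1 (y i t).
  rewrite -(sum_pairs n (fun i => k1 (y i t))) -sumrB; apply: eq_bigr => i _.
  by rewrite -sumrB; apply: eq_bigr => j _; rewrite /kt/=; ring.
rewrite /U /A -mulr_sumr !mulrBr; congr (_ - _).
rewrite bin2E; set S := \sum_(_ < _) _.
have sE : n%:R = Num.sqrt n%:R ^+ 2 :> R by rewrite sqr_sqrtr// ler0n.
apply: (mulfI s0); rewrite !mulrA divff// mul1r -expr2 -sE.
by field; rewrite n0 n10.
Qed.

Let bU n : bmfun (U n).
Proof.
do 2 apply: bmfunZ; apply: bmfun_sum => i _; apply: bmfun_sum => j _.
exact: (bpair i j bk).
Qed.

Let b2k1 i : bmfun (fun t => 2 * k1 (y i t)).
Proof. by apply: bmfunZ; exact: bmfun_RV. Qed.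

Let bA n : bmfun (A n). Proof. by apply: bmfunZ; apply: bmfun_sum. Qed.

Let UA2_le n : (1 < n)%N -> \int[P]_t ((U n t - A n t) ^+ 2) <= 144 * K ^+ 2 / n%:R.
Proof.
move=> n1; have n0 : 0 < n%:R :> R by rewrite ltr0n; lia.
have n2 : 2 <= n%:R :> R by rewrite -[2]/(2%:R) ler_nat.
under eq_Rintegral do rewrite hajek// mulrA exprMn.
rewrite bRintegralZl; last exact: bmfunX.
apply: (@le_trans _ _ ((Num.sqrt n%:R * 'C(n, 2)%:R^-1) ^+ 2 * (n%:R ^+ 2 * (3 * K) ^+ 2))).
  by rewrite ler_wpM2l ?sqr_ge0.
rewrite exprMn sqr_sqrtr ?ler0n// bin2E.
(* 36 = 4 * 9 comes from the squared factor 2 of 1 / C(n, 2) and the bound 3 K; then n - 1 >= n / 2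
   contributes the 4 that leads to 144. *)
have -> : n%:R * (n%:R * (n%:R - 1) / 2)^-1 ^+ 2 * (n%:R ^+ 2 * (3 * K) ^+ 2) =
  36 * K ^+ 2 * (n%:R / (n%:R - 1) ^+ 2) :> R.
  by field; rewrite !gt_eqF//; lra.
rewrite (_ : 144 * K ^+ 2 / n%:R = 36 * K ^+ 2 * (4 / n%:R)); last by ring.
have K20 : 0 <= 36 * K ^+ 2 by rewrite mulr_ge0// sqr_ge0.
rewrite ler_wpM2l// ler_pdivrMr; last by rewrite exprn_gt0//; lra.
by rewrite mulrAC ler_pdivlMr//; nra.
Qed.

Let v := \int[F]_x ((2 * k1 x) ^+ 2).

(** The off-diagonal terms vanish by independence and centering, leaving n equal terms [v] divided
    by n. *)
Let A2_le n : \int[P]_t (A n t ^+ 2) <= v.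
Proof.
have v0 : 0 <= v by apply: Rintegral_ge0 => x _; exact: sqr_ge0.
have [->|n_gt0] := posnP n.
  under eq_Rintegral do rewrite /A big_ord0 mulr0 expr0n.
  by rewrite RintegralT_cst.
have n0 : 0 < n%:R :> R by rewrite ltr0n.
have b2 : bmfun (fun x => 2 * k1 x) by exact: bmfunZ.
under eq_Rintegral do rewrite /A exprMn exprVn sqr_sqrtr ?ler0n// expr2 mulr_suml.
rewrite bRintegralZl; last first.
  by apply: bmfun_sum => i _; apply: bmfunM => //; exact: bmfun_sum.
rewrite bRintegral_sum; last by move=> i _; apply: bmfunM => //; exact: bmfun_sum.
rewrite (eq_bigr (fun=> v)) => [|i _].
  by rewrite sumr_const card_ord -[v *+ n]mulr_natl mulKf// gt_eqF.
under eq_Rintegral do rewrite mulr_sumr.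
rewrite bRintegral_sum; last by move=> j _; exact: bmfunM.
rewrite (bigD1 i)//= big1 ?addr0 => [|j ji].
  apply: etrans (Rintegral_law y_dist i (bmfunX 2 b2)).
  by apply: eq_Rintegral => t _; rewrite expr2.
pose f (x : (T' * T')%type) := (2 * k1 x.1) * (2 * k1 x.2).
have bf : bmfun f by apply: bmfunM; exact: bmfunZ.
have -> : \int[P]_t (2 * k1 (y i t) * (2 * k1 (y j t))) = \int[P]_t f (y i t, y j t) by [].
rewrite Rintegral_pair//; last by rewrite eq_sym.
rewrite /f/=; under eq_Rintegral do rewrite bRintegralZl// bRintegralZl// k_mean !mulr0.
exact: RintegralT_cst.
Qed.

Lemma ustatistic_clt :
  (forall th : R, \int[P]_t cos (U n t + th) @[n --> \oo] --> expR (- (v / 2)) * cos th) /\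
  exists C, forall n, \int[P]_t (U n t ^+ 2) <= C.
Proof.
have UA0 : 144 * K ^+ 2 / n%:R @[n --> \oo] --> (0 : R).
  rewrite -[X in _ --> X](mulr0 (144 * K ^+ 2)); apply: cvgMr.
  rewrite (_ : (fun n => n%:R^-1) =
      fun n => (Num.sqrt (n%:R : R))^-1 * (Num.sqrt n%:R)^-1); last first.
    by apply/funext => n; rewrite -invfM -expr2 sqr_sqrtr ?ler0n.
  by rewrite -[X in _ --> X](mulr0 0); apply: cvgM; exact: cvg_sqrtV.
split=> [th|].
  have bcosU n : bmfun (fun t => cos (U n t + th)).
    by apply: bmfun_cos; apply: measurable_funD => //; have [] := bU n.
  have bcosA n : bmfun (fun t => cos (A n t + th)).
    by apply: bmfun_cos; apply: measurable_funD => //; have [] := bA n.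
  have A_cvg : \int[P]_t cos (A n t + th) @[n --> \oo] --> expR (- (v / 2)) * cos th.
    have b2 : bmfun (fun x => 2 * k1 x) by exact: bmfunZ.
    have mean0 : \int[F]_x (2 * k1 x) = 0 by rewrite bRintegralZl// k_mean mulr0.
    have [cc cs] := clt_cos_sin y_dist y_indep b2 mean0 (erefl v).
    rewrite (_ : (fun n => _) = fun n => (\int[P]_t cos (A n t)) * cos th -
        (\int[P]_t sin (A n t)) * sin th); last first.
      apply/funext => n; have [mA _] := bA n.
      have [bc bs] := (bmfun_cos mA, bmfun_sin mA).
      under eq_Rintegral do rewrite cosD.
      rewrite bRintegralB; [|by apply: bmfunM => //; exact: bmfun_cst..].
      by rewrite !bRintegralZr.
    rewrite -[X in _ --> X]subr0 -[X in _ --> _ - X](mul0r (sin th)).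
    by apply: cvgB; apply: cvgM => //; exact: cvg_cst.
  have diff0 : \int[P]_t cos (U n t + th) - \int[P]_t cos (A n t + th) @[n --> \oo] --> (0 : R).
    apply/cvgrPdist_le => e e0.
    have e20 : 0 < e ^+ 2 by rewrite exprn_gt0.
    move/cvgrPdist_le : UA0 => /(_ _ e20) UA0; near=> n.
    have n1 : (1 < n)%N by near: n; exact: nbhs_infty_gt.
    rewrite sub0r normrN -ler_sqr ?nnegrE ?(ltW e0)// real_normK ?num_real//.
    rewrite -bRintegralB// (le_trans (sqr_bRintegral_le P (bmfunB (bcosU n) (bcosA n))))//.
    (* The cosine is 1-Lipschitz, so closeness in L^2 passes to the transforms. *)
    apply: (@le_trans _ _ (\int[P]_t ((U n t - A n t) ^+ 2))).
      apply: le_bRintegral => [||t]; first by apply: bmfunX; exact: bmfunB.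
        by apply: bmfunX; exact: bmfunB.
      have -> : U n t - A n t = (U n t + th) - (A n t + th) by ring.
      move: (U n t + th) (A n t + th) => a b.
      rewrite -real_normK ?num_real// -[leRHS]real_normK ?num_real//.
      rewrite ler_sqr ?nnegrE// .
      exact: norm_cosB_le.
    rewrite (le_trans (UA2_le n1))// (le_trans (ler_norm _))// -normrN -sub0r.
    by near: n.
  rewrite -[X in _ --> X]add0r.
  rewrite (_ : (fun n => \int[P]_t cos (U n t + th)) =
    fun n => (\int[P]_t cos (U n t + th) - \int[P]_t cos (A n t + th)) +
      \int[P]_t cos (A n t + th)); last by apply/funext => n; rewrite subrK.
  exact: cvgD.
(* From U^2 <= 2 A^2 + 2 (U - A)^2, whose defect is (2 A - U)^2. *)
exists (2 * v + 144 * K ^+ 2 * 2) => n.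
have v0 : 0 <= v by apply: Rintegral_ge0 => x _; exact: sqr_ge0.
have [n1|n1] := leqP n 1.
  (* For n <= 1 the binomial coefficient is 0, and so is its inverse by convention: [U n] is
     identically 0. *)
  under eq_Rintegral do rewrite /U bin_small// invr0 mul0r mulr0 expr0n.
  by rewrite RintegralT_cst/= mulr0n; have := sqr_ge0 K; move: v0; lra.
apply: (@le_trans _ _ (\int[P]_t (2 * A n t ^+ 2 + 2 * (U n t - A n t) ^+ 2))).
  apply: le_bRintegral => [||t]; first exact: bmfunX.
    by apply: bmfunD; apply: bmfunZ; apply: bmfunX => //; exact: bmfunB.
  by have := sqr_ge0 (2 * A n t - U n t); nra.
rewrite bRintegralD; [|by apply: bmfunZ; apply: bmfunX => //; exact: bmfunB..].
rewrite !bRintegralZl; [|by apply: bmfunX => //; exact: bmfunB..].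
rewrite lerD ?ler_wpM2l// mulrC ler_wpM2r// (le_trans (UA2_le n1))//.
rewrite ler_pdivrMr ?ltr0n; last by lia.
have n1R : 1 <= n%:R :> R by rewrite ler1n; lia.
by have := sqr_ge0 K; nra.
Unshelve. all: by end_near. Qed.

End ustatistic.

(** * The spatial median and the signed-rank statistic *)

Section euclidean_norm.
Variables (R : realType) (p : nat).
Implicit Types x u : 'rV[R]_p.

Lemma enorm_ge0 x : 0 <= enorm x.
Proof. exact: sqrtr_ge0. Qed.

Lemma sqr_enorm x : enorm x ^+ 2 = \sum_(i < p) x 0 i ^+ 2.
Proof. by rewrite sqr_sqrtr// sumr_ge0// => i _; exact: sqr_ge0. Qed.

Lemma le_enorm x i : `|x 0 i| <= enorm x.
Proof.
rewrite -ler_sqr ?nnegrE ?enorm_ge0// real_normK ?num_real// sqr_enorm.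
by rewrite (bigD1 i)//= lerDl sumr_ge0// => j _; exact: sqr_ge0.
Qed.

Lemma enorm_eq0 x : enorm x = 0 -> x = 0.
Proof.
move=> x0; apply/rowP => i; rewrite mxE; apply/normr0_eq0/eqP.
by rewrite eq_le normr_ge0 andbT -x0 le_enorm.
Qed.

Lemma enorm0 : enorm (0 : 'rV[R]_p) = 0.
Proof. by rewrite /enorm big1 ?sqrtr0// => i _; rewrite mxE expr0n. Qed.

Lemma enormZ (c : R) x : enorm (c *: x) = `|c| * enorm x.
Proof.
rewrite /enorm -sqrtr_sqr -sqrtrM ?sqr_ge0// mulr_sumr; congr Num.sqrt.
by apply: eq_bigr => i _; rewrite mxE exprMn.
Qed.

(** The difference quotients of [enorm] in a fixed direction, rationalized; when
    the denominator vanishes both sides are [0]. *)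
Lemma enorm_quotient x u (h : R) : h != 0 ->
  (enorm (x - h *: u) - enorm x) / h =
  - (\sum_i u 0 i * (x 0 i + (x - h *: u) 0 i)) / (enorm (x - h *: u) + enorm x).
Proof.
move=> h0; set w := x - h *: u.
have [d0|d0] := eqVneq (enorm w + enorm x) 0.
  have [w0 x0] : enorm w = 0 /\ enorm x = 0.
    by have := enorm_ge0 w; have := enorm_ge0 x; move: d0; split; lra.
  by rewrite w0 x0 addr0 subrr invr0 mulr0 mul0r.
apply: (mulIf d0); rewrite divfK// mulrAC -subr_sqr !sqr_enorm -sumrB.
apply: (mulIf h0); rewrite divfK// mulNr mulr_suml -sumrN; apply: eq_bigr => i _.
by rewrite /w !mxE; ring.
Qed.

(** The bound does not depend on [x] or [h]: it dominates the quotients when the expectation is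
    differentiated. *)
Lemma enorm_quotient_le x u (h : R) : h != 0 ->
  `|(enorm (x - h *: u) - enorm x) / h| <= \sum_i `|u 0 i|.
Proof.
move=> h0; rewrite enorm_quotient// normrM normfV normrN; set w := x - _.
have D0 : 0 <= enorm w + enorm x by rewrite addr_ge0 ?enorm_ge0.
rewrite (ger0_norm D0); have [->|d0] := eqVneq (enorm w + enorm x) 0.
  by rewrite invr0 mulr0 sumr_ge0.
rewrite ler_pdivrMr ?lt_neqAle 1?eq_sym ?d0// (le_trans (ler_norm_sum _ _ _))// mulr_suml.
apply: ler_sum => i _; rewrite normrM ler_wpM2l//.
by rewrite (le_trans (ler_normD _ _))// addrC lerD ?le_enorm.
Qed.

Lemma measurable_enorm : measurable_fun [set: 'rV[R]_p] (@enorm R p).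
Proof.
apply: measurableT_comp.
  by apply: continuous_measurable_fun; exact: sqrt_continuous.
apply: measurable_sum => i; apply: measurable_funX; exact: measurable_mx_coord.
Qed.

Lemma spatial_signE x i : spatial_sign x 0 i = (enorm x)^-1 * x 0 i.
Proof. by rewrite mxE. Qed.

Lemma bmfun_spatial_sign i : bmfun (fun x => spatial_sign x 0 i).
Proof.
split.
  under eq_fun do rewrite spatial_signE -powR_inv1 ?enorm_ge0//.
  apply: measurable_funM; last exact: measurable_mx_coord.
  exact: (measurableT_comp (measurable_powR (-1)) measurable_enorm).
exists 1 => x; rewrite spatial_signE normrM normfV (ger0_norm (enorm_ge0 x)).
have [->|x0] := eqVneq (enorm x) 0; first by rewrite invr0 mul0r ler01.
by rewrite mulrC ler_pdivrMr ?mul1r ?le_enorm// lt_neqAle eq_sym x0 enorm_ge0.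
Qed.

Lemma dotE x u : (x *m u^T) 0 0 = \sum_i x 0 i * u 0 i.
Proof. by rewrite mxE; apply: eq_bigr => i _; rewrite mxE. Qed.

Lemma norm_spatial_sign_dot x u : `|(spatial_sign x *m u^T) 0 0| <= \sum_i `|u 0 i|.
Proof.
rewrite dotE (le_trans (ler_norm_sum _ _ _))//; apply: ler_sum => i _.
rewrite normrM ler_piMl// spatial_signE normrM normfV (ger0_norm (enorm_ge0 x)).
have [->|x0] := eqVneq (enorm x) 0; first by rewrite invr0 mul0r ler01.
by rewrite mulrC ler_pdivrMr ?mul1r ?le_enorm// lt_neqAle eq_sym x0 enorm_ge0.
Qed.

Lemma bmfun_spatial_sign_dot u : bmfun (fun x => (spatial_sign x *m u^T) 0 0).
Proof.
under eq_fun do rewrite dotE; apply: bmfun_sum => i _.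
by apply: bmfunM; [exact: bmfun_spatial_sign|exact: bmfun_cst].
Qed.

(** In the rationalized quotient the denominator tends to twice the norm of [x], which is not zero;
    continuity of the norm along the sequence follows from [enorm_quotient_le]. *)
Lemma enorm_quotient_cvg x u : x != 0 ->
  (enorm (x - (n.+1%:R)^-1 *: u) - enorm x) / (n.+1%:R)^-1 @[n --> \oo] -->
  - (spatial_sign x *m u^T) 0 0.
Proof.
move=> x0; pose h n : R := (n.+1%:R)^-1.
have h0 n : h n != 0 by rewrite invr_eq0 pnatr_eq0.
have hc : h n @[n --> \oo] --> (0 : R) by exact: cvg_harmonic.
rewrite (_ : (fun n => _) = fun n =>
  - (\sum_i u 0 i * (x 0 i + (x - h n *: u) 0 i)) / (enorm (x - h n *: u) + enorm x)); last first.
  by apply/funext => n; rewrite -enorm_quotient.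
have ex0 : enorm x != 0 by apply: contra_neq x0; exact: enorm_eq0.
have wc : enorm (x - h n *: u) @[n --> \oo] --> enorm x.
  rewrite (_ : (fun n => _) = fun n =>
    (enorm (x - h n *: u) - enorm x) / h n * h n + enorm x); last first.
    by apply/funext => n; rewrite divfK// subrK.
  rewrite -[X in _ --> X]add0r; apply: cvgD; last exact: cvg_cst.
  apply/cvgr0Pnorm_le => e e0; pose M := \sum_i `|u 0 i| + 1.
  have M0 : 0 < M by rewrite ltr_wpDl// sumr_ge0.
  have eM : 0 < e / M by rewrite divr_gt0.
  move/cvgr0Pnorm_le : hc => /(_ _ eM); apply: filterS => n hn.
  rewrite normrM -[e](divfK (lt0r_neq0 M0)) mulrC ler_pM//.
  by rewrite (le_trans (enorm_quotient_le x u (h0 n)))// lerDl.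
have -> : - (spatial_sign x *m u^T) 0 0 =
    - (\sum_i u 0 i * (x 0 i + x 0 i)) / (enorm x + enorm x).
  rewrite dotE mulNr; congr (- _); rewrite mulr_suml; apply: eq_bigr => i _.
  rewrite spatial_signE; field.
  by rewrite ex0 andbT -mulr2n mulrn_eq0.
apply: cvgM; last first.
  apply: cvgV; first by rewrite -mulr2n mulrn_eq0.
  by apply: cvgD => //; exact: cvg_cst.
apply: cvgN; apply: cvg_big => [|i _]; first exact: add_continuous.
apply: cvgMr; apply: cvgD; first exact: cvg_cst.
rewrite (_ : (fun n => _) = fun n => x 0 i - h n * u 0 i); last first.
  by apply/funext => n; rewrite !mxE.
rewrite -[X in _ --> X]subr0 -[X in _ --> _ - X](mul0r (u 0 i)).
by apply: cvgB; [exact: cvg_cst|apply: cvgM => //; exact: cvg_cst].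
Qed.

End euclidean_norm.

(** * First-order condition at the spatial median *)

Section spatial_median.
Context d (T : measurableType d) (R : realType) (P : probability T R) (p : nat).
Variable Z : T -> 'rV[R]_p.
Hypothesis mZ : measurable_fun [set: T] Z.

(** The origin is a box with sides {0}, so its Lebesgue measure has a zero factor as soon as there
    is a coordinate. *)
Lemma has_density_neq0 (f : 'rV[R]_p -> R) : (0 < p)%N -> has_density P Z f ->
  P (Z @^-1` [set 0]) = 0%E.
Proof.
have S0 : [set 0] = [set x : 'rV[R]_p | forall i, [set (0 : R)] (x ord0 i)].
  apply/seteqP; split => x /=; first by move=> -> i; rewrite mxE.
  by move=> x0; apply/rowP => i; rewrite mxE; exact: x0.
have m0 : measurable [set (0 : 'rV[R]_p)].
  rewrite S0 [X in measurable X](_ : _ = \bigcap_i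
      ((fun x : 'rV[R]_p => x ord0 i) @^-1` [set 0])).
    apply: fin_bigcap_measurable => // i _; rewrite -[X in measurable X]setTI.
    by apply: measurable_mx_coord.
  by apply/seteqP; split => x /= x0 i => [_|]; exact: x0.
move=> p0 [_ mf ->//]; apply: null_set_integral => //.
  by apply/measurable_EFinP; exact: measurable_funTS.
rewrite S0; apply: etrans (@lebesgue_rV_box R p (fun=> [set 0]) _) _ => //.
by rewrite (bigD1 (Ordinal p0))//= lebesgue_measure_set1 mul0e.
Qed.

Lemma spatial_median_mean : P (Z @^-1` [set 0]) = 0%E -> is_spatial_median P Z 0 ->
  forall u : 'rV[R]_p, \int[P]_t (spatial_sign (Z t) *m u^T) 0 0 = 0.
Proof.
move=> Z0 med.
have bD (u : 'rV[R]_p) h : h != 0 ->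
    bmfun (fun t => (enorm (Z t - h *: u) - enorm (Z t)) / h).
  move=> h0; split; last by exists (\sum_i `|u 0 i|) => t; exact: enorm_quotient_le.
  apply: measurable_funM => //; apply: measurable_funB.
    apply: (measurableT_comp (@measurable_enorm R p)); apply/measurable_fun_mxP => i j.
    under eq_fun do rewrite !mxE; apply: measurable_funB => //.
    by have /measurable_fun_mxP := mZ; exact.
  exact: (measurableT_comp (@measurable_enorm R p)).
(* Moving away from the minimizer along [u] gives one inequality; the direction [- u] gives the
   other. *)
suff le0 (u : 'rV[R]_p) : \int[P]_t (spatial_sign (Z t) *m u^T) 0 0 <= 0.
  move=> u; apply/eqP; rewrite eq_le le0/= -oppr_le0.
  have := le0 (- u); under eq_Rintegral do rewrite linearN mulmxN mxE -mulN1r.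
  rewrite bRintegralZl ?mulN1r//.
  by have [m K] := bmfun_spatial_sign_dot u; exact: (bmfun_comp m K mZ).
have b0 : bmfun (fun t => - (spatial_sign (Z t) *m u^T) 0 0).
  by apply: bmfunN; have [m K] := bmfun_spatial_sign_dot u; exact: (bmfun_comp m K mZ).
have mZ0 : measurable (Z @^-1` [set 0]).
  rewrite (_ : _ @^-1` _ = (fun t => enorm (Z t)) @^-1` [set 0]).
    rewrite -[X in measurable X]setTI.
    exact: (measurableT_comp (@measurable_enorm R p) mZ).
  apply/seteqP; split => t /=; first by move=> ->; exact: enorm0.
  exact: enorm_eq0.
(* The one-sided directional derivative of the norm: at the origin it is the norm of [u], a term
   that [Z0] makes negligible. *)
pose L t := - (spatial_sign (Z t) *m u^T) 0 0 + enorm u * \1_(Z @^-1` [set 0]) t.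
have hn0 n : (n.+1%:R)^-1 != 0 :> R by rewrite invr_eq0 pnatr_eq0.
have [_ cL] : bmfun L /\ \int[P]_t ((enorm (Z t - (n.+1%:R)^-1 *: u) - enorm (Z t)) / (n.+1%:R)^-1)
    @[n --> \oo] --> \int[P]_t L t.
  apply: (@bRintegral_cvg _ _ _ _ _ _ (\sum_i `|u 0 i|)) => [n|n t|t].
  - by have [] := bD u _ (hn0 n).
  - exact: enorm_quotient_le.
  - rewrite /L indicE; have [Zt|Zt] := eqVneq (Z t) 0.
      rewrite mem_set//= Zt /spatial_sign scaler0 mul0mx mxE oppr0 add0r mulr1.
      apply: cvg_near_cst; apply: nearW => n.
      rewrite sub0r -scaleNr enormZ enorm0 subr0 normrN gtr0_norm ?invr_gt0//.
      by rewrite mulrC mulKf.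
    rewrite memNset/=; last by move=> Zt'; rewrite Zt' eqxx in Zt.
    by rewrite mulr0 addr0; exact: enorm_quotient_cvg.
have EL : \int[P]_t L t = - \int[P]_t (spatial_sign (Z t) *m u^T) 0 0.
  rewrite bRintegralD//; last by apply: bmfunZ; exact: bmfun_indic.
  rewrite bRintegralZl; last exact: bmfun_indic.
  rewrite bRintegral_indic// Z0 mulr0 addr0.
  under eq_Rintegral do rewrite -mulN1r.
  rewrite bRintegralZl ?mulN1r//.
  by have [m K] := bmfun_spatial_sign_dot u; exact: (bmfun_comp m K mZ).
rewrite -oppr_ge0 -EL.
have D0 n : 0 <= \int[P]_t ((enorm (Z t - (n.+1%:R)^-1 *: u) - enorm (Z t)) / (n.+1%:R)^-1).
  have := med ((n.+1%:R)^-1 *: u).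
  under eq_fun do rewrite subr0 subrr.
  rewrite unlock integral0.
  (* The increment is rewritten as the step times the bounded quotient, and the positive step is
     then divided out. *)
  under eq_integral => t _ do rewrite -[enorm _ - _](@divfK _ (n.+1%:R)^-1)// mulrC.
  rewrite -EFin_Rintegral; last exact: bmfunZ (bD u _ (hn0 n)).
  by rewrite lee_fin bRintegralZl; [rewrite pmulr_rge0// invr_gt0|exact: bD].
rewrite -(cvg_lim _ cL)//; apply: limr_ge; first exact: cvgP cL.
exact: nearW.
Qed.

End spatial_median.

Lemma mvnormal_cos (R : realType) n (nu : probability 'rV[R]_n R) (S : 'M[R]_n) :
  is_mvnormal nu 0 S -> forall (u : 'rV[R]_n) (th : R),
  \int[nu]_x cos ((x *m u^T) 0 0 + th) =
  expR (- ((u *m S *m u^T) 0 0 / 2)) * cos th.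
Proof.
move=> [_ S0 nuE] u th; set v := (u *m S *m u^T) 0 0.
pose phi (x : 'rV[R]_n) : R := (x *m u^T) 0 0.
have mphi : measurable_fun [set: 'rV[R]_n] phi by exact: measurable_dot.
have law (f : R -> R) : bmfun f -> \int[nu]_x f (phi x) = \int[normal_law0 v]_x f x.
  move=> bf; apply/eqP; rewrite -subr_eq0.
  pose L (g : R -> R) := \int[nu]_x (g (phi x) * 1) - \int[normal_law0 v]_x (g x * 1).
  have <- : L f = \int[nu]_x f (phi x) - \int[normal_law0 v]_x f x.
    by congr (_ - _); apply: eq_Rintegral => t _; rewrite mulr1.
  apply/eqP; apply: bclinear_eq0 bf.
    by apply: bclinearB; apply: bclinear_integral => //; exact: bmfun_cst.
  move=> A mA; apply/eqP; rewrite subr_eq0; apply/eqP.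
  have mpre : measurable (phi @^-1` A).
    by rewrite -[X in measurable X]setTI; apply: mphi.
  transitivity (fine (nu (phi @^-1` A))).
    by rewrite -bRintegral_indic//; apply: eq_Rintegral => t _; rewrite mulr1.
  rewrite nuE// mul0mx mxE -normal_law0E.
  by rewrite -bRintegral_indic//; apply: eq_Rintegral => t _; rewrite mulr1.
have [cc cs] := normal_char (S0 u).
have bc : bmfun (fun x : R => cos x) by exact: bmfun_cos.
have bs : bmfun (fun x : R => sin x) by exact: bmfun_sin.
have bcth : bmfun (fun x : R => cos (x + th)).
  by apply: bmfun_cos; exact: measurable_funD.
rewrite (law _ bcth); under eq_Rintegral do rewrite cosD.
rewrite bRintegralB; [|by apply: bmfunM => //; exact: bmfun_cst..].
by rewrite !bRintegralZr// cc cs mul0r subr0.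
Qed.

(** * The kernel of the signed-rank statistic and the limit theorem *)

Section signed_rank_kernel.
Variables (R : realType) (p : nat).
Implicit Types u : 'rV[R]_p.

Definition srkernel u (x : ('rV[R]_p * 'rV[R]_p)%type) : R :=
  (spatial_sign (2^-1 *: (x.1 + x.2)) *m u^T) 0 0.

Lemma srkernel_sym u x x' : srkernel u (x, x') = srkernel u (x', x).
Proof. by rewrite /srkernel/= addrC. Qed.

Lemma norm_srkernel u x : `|srkernel u x| <= \sum_i `|u 0 i|.
Proof. exact: norm_spatial_sign_dot. Qed.

Lemma measurable_srkernel u : measurable_fun setT (srkernel u).
Proof.
have [m _] := bmfun_spatial_sign_dot u; apply: (measurableT_comp m).
apply/measurable_fun_mxP => i j; under eq_fun do rewrite !mxE.
apply: measurable_funM => //; apply: measurable_funD.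
  exact: (measurableT_comp (measurable_mx_coord i j) measurable_fst).
exact: (measurableT_comp (measurable_mx_coord i j) measurable_snd).
Qed.

Lemma bmfun_srkernel u : bmfun (srkernel u).
Proof.
by split; [exact: measurable_srkernel|exists (\sum_i `|u 0 i|); exact: norm_srkernel].
Qed.

End signed_rank_kernel.

Section signed_rank.
Context d (T : measurableType d) (R : realType) (P : probability T R) (p : nat).
Variables (F : probability 'rV[R]_p R) (y : nat -> {RV P >-> 'rV[R]_p}).
Hypothesis y_indep : mutually_independent y.
Hypothesis y_dist : forall (i : nat) (A : set 'rV[R]_p), measurable A ->
  distribution P (y i) A = F A.

Let z (i j : nat) : T -> 'rV[R]_p := midpoint (y i) (y j).

Let B : 'M[R]_p := expectation_mx P
  (fun t => (spatial_sign (z 0%N 1%N t))^T *m spatial_sign (z 1%N 2%N t)).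

Let proj (u x : 'rV[R]_p) := \int[F]_x' srkernel u (x, x').

Let bproj u : bmfun (proj u).
Proof. exact: (bmfun_Rintegral F (bmfun_srkernel u)). Qed.

Let dot_z i j (u : 'rV[R]_p) t : (spatial_sign (z i j t) *m u^T) 0 0 = srkernel u (y i t, y j t).
Proof. by []. Qed.

Lemma measurable_midpoint i j : measurable_fun [set: T] (z i j).
Proof.
apply/measurable_fun_mxP => k l; under eq_fun do rewrite !mxE.
have my m : measurable_fun [set: T] (y m) by [].
apply: measurable_funM => //.
by apply: measurable_funD; have /measurable_fun_mxP := my i; have /measurable_fun_mxP := my j.
Qed.

Let bz i j k : bmfun (fun t => spatial_sign (z i j t) 0 k).
Proof. by have [m K] := @bmfun_spatial_sign R p k; exact: (bmfun_comp m K (measurable_midpoint i j)). Qed.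

Let bzu i j (u : 'rV[R]_p) : bmfun (fun t => (spatial_sign (z i j t) *m u^T) 0 0).
Proof.
by have [m K] := bmfun_spatial_sign_dot u; exact: (bmfun_comp m K (measurable_midpoint i j)).
Qed.

(** The two signs in [B] share only the middle observation. Symmetry of the kernel puts it in the
    first slot; then the two outer observations are integrated out one after the other. *)
Let quadB (u w : 'rV[R]_p) : (u *m B *m w^T) 0 0 = \int[F]_x (proj u x * proj w x).
Proof.
transitivity (\int[P]_t (srkernel u (y 1 t, y 0 t) * srkernel w (y 1 t, y 2 t))).
  have BE i j : B i j = \int[P]_t (spatial_sign (z 0 1 t) 0 i * spatial_sign (z 1 2 t) 0 j).
    rewrite mxE unlock /Rintegral; congr fine; apply: eq_integral => t _; congr (_%:E).
    by rewrite mxE big_ord1 mxE.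
  have bzz i j : bmfun (fun t => spatial_sign (z 0 1 t) 0 i * spatial_sign (z 1 2 t) 0 j).
    by apply: bmfunM.
  rewrite dotE; transitivity (\sum_j \sum_i \int[P]_t
    (u 0 i * w 0 j * (spatial_sign (z 0 1 t) 0 i * spatial_sign (z 1 2 t) 0 j))).
    apply: eq_bigr => j _; rewrite mxE mulr_suml; apply: eq_bigr => i _.
    by rewrite bRintegralZl// BE; ring.
  under eq_Rintegral do rewrite srkernel_sym -!dot_z !dotE mulr_sumr.
  rewrite bRintegral_sum; last first.
    move=> j _; apply: bmfunM; last by apply: bmfunM => //; exact: bmfun_cst.
    by apply: bmfun_sum => i _; apply: bmfunM => //; exact: bmfun_cst.
  apply: eq_bigr => j _; under [RHS]eq_Rintegral do rewrite mulr_suml.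
  rewrite bRintegral_sum; last first.
    by move=> i _; apply: bmfunM; apply: bmfunM => //; exact: bmfun_cst.
  by apply: eq_bigr => i _; apply: eq_Rintegral => t _; ring.
rewrite (Rintegral_pair_condition y_dist y_indep) => //; [|exact: bmfun_srkernel..].
have b1 : bmfun (fun x : ('rV[R]_p * 'rV[R]_p)%type => proj u x.1).
  by have [m K] := bproj u; exact: (bmfun_comp m K measurable_fst).
under eq_Rintegral do rewrite mulrC.
have := @Rintegral_pair_condition _ _ _ _ _ _ _ _ y_dist y_indep 1 2 1 1 _ _
  isT isT isT (bmfun_srkernel w) b1.
move=> /= ->; under eq_Rintegral do rewrite mulrC.
have bM : bmfun (fun x => proj u x * proj w x) by exact: bmfunM.
exact: (Rintegral_law y_dist 1 bM).
Qed.

Let B_sym : B^T = B.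
Proof.
have entry i j : B i j = ((delta_mx 0 i : 'rV[R]_p) *m B *m (delta_mx 0 j : 'rV[R]_p)^T) 0 0.
  by rewrite trmx_delta -(rowE i B) -colE !mxE.
apply/matrixP => i j; rewrite mxE !entry !quadB.
by apply: eq_Rintegral => x _; rewrite mulrC.
Qed.

Hypothesis z_neq0 : P (z 0 1 @^-1` [set 0]) = 0%E.
Hypothesis z_median : is_spatial_median P (z 0 1) 0.

Let stat n : T -> 'rV[R]_p := fun t => Num.sqrt (n%:R : R) *: signed_rank_stat z n t.

Let stat_dot n (u : 'rV[R]_p) t : (stat n t *m u^T) 0 0 = Num.sqrt n%:R * ('C(n, 2)%:R^-1 *
  \sum_(i < n) \sum_(j < n | (i < j)%N) srkernel u (y i t, y j t)).
Proof.
rewrite /stat /signed_rank_stat -scalemxAl mxE -scalemxAl mxE; congr (_ * (_ * _)).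
rewrite mulmx_suml summxE; apply: eq_bigr => i _.
by rewrite mulmx_suml summxE.
Qed.

Lemma signed_rank_clt : exists nu : probability 'rV[R]_p R,
  is_mvnormal nu 0 (4 *: B) /\ cvg_in_law P stat nu.
Proof.
(* This is the limit variance in [ustatistic_clt], and as an integral of a square it is nonnegative,
   as [mvnormal_exists] requires. *)
have vE (u : 'rV[R]_p) : (u *m (4 *: B) *m u^T) 0 0 = \int[F]_x ((2 * proj u x) ^+ 2).
  rewrite -scalemxAr -scalemxAl mxE quadB -bRintegralZl; last exact: bmfunM.
  by apply: eq_Rintegral => x _; ring.
have S0 (u : 'rV[R]_p) : 0 <= (u *m (4 *: B) *m u^T) 0 0.
  by rewrite vE; apply: Rintegral_ge0 => x _; exact: sqr_ge0.
have ST : (4 *: B)^T = 4 *: B by rewrite linearZ/= B_sym.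
have [nu nuP] := mvnormal_exists ST S0; exists nu; split=> //.
have mean0 u : \int[F]_x proj u x = 0.
  rewrite -(Rintegral_pair y_dist y_indep (isT : 0%N != 1%N) (bmfun_srkernel u)).
  exact: (spatial_median_mean (measurable_midpoint 0 1) z_neq0 z_median u).
have clt u := ustatistic_clt y_dist y_indep (measurable_srkernel u) (@norm_srkernel R p u)
  (@srkernel_sym R p u) (mean0 u).
(* Each coordinate direction has its own second moment bound; the sum of their absolute values
   serves for all. *)
have [C hC] : exists C, forall i n, \int[P]_t ((stat n t *m (delta_mx 0 i : 'rV[R]_p)^T) 0 0 ^+ 2) <= C.
  pose c i := projT1 (cid (clt (delta_mx 0 i)).2).
  exists (\sum_i `|c i|) => i n.
  rewrite (le_trans (_ : _ <= c i))//.
    rewrite /c; case: cid => a /= ha; apply: le_trans (ha n).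
    by under eq_Rintegral do rewrite stat_dot.
  by rewrite (le_trans (ler_norm _))// (bigD1 i)//= lerDl sumr_ge0.
have coord (x : 'rV[R]_p) i : (x *m (delta_mx 0 i : 'rV[R]_p)^T) 0 0 = x 0 i.
  by rewrite trmx_delta -colE mxE.
apply: (cvg_in_law_cos (C := C)).
- move=> n i; under eq_fun do rewrite -coord stat_dot.
  do 2 apply: bmfunZ; apply: bmfun_sum => k _; apply: bmfun_sum => l _.
  exact: bzu.
- by move=> n i; under eq_Rintegral do rewrite -coord.
- move=> u th; rewrite (mvnormal_cos nuP) vE.
  under eq_fun do under eq_Rintegral do rewrite stat_dot.
  exact: (clt u).1.
Qed.

End signed_rank.

(* The observations y_1, y_2, ... are indexed from 0, vectors are rows. *)
Theorem theorem8 (d : measure_display) (T : measurableType d) (R : realType)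
    (P : probability T R) (p : nat) (hp : (1 < p)%N)
    (F : probability 'rV[R]_p R) (y : nat -> {RV P >-> 'rV[R]_p})
    (y_indep : mutually_independent y)
    (y_dist : forall (i : nat) (A : set 'rV[R]_p), measurable A ->
       distribution P (y i) A = F A) :
  let z (i j : nat) : T -> 'rV[R]_p := midpoint (y i) (y j) in
  forall
    (z_density : forall i j : nat, (i < j)%N ->
       exists f : 'rV[R]_p -> R,
         [/\ has_density P (z i j) f, continuous f & bounded_fun f])
    (z_median : forall i j : nat, (i < j)%N ->
       forall mu : 'rV[R]_p, is_spatial_median P (z i j) mu <-> mu = 0),
  let B : 'M[R]_p := expectation_mx P
    (fun t => (spatial_sign (z 0%N 1%N t))^T *m spatial_sign (z 1%N 2%N t)) in
  exists nu : probability 'rV[R]_p R,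
    is_mvnormal nu 0 (4 *: B) /\
    cvg_in_law P (fun n t => Num.sqrt (n%:R : R) *: signed_rank_stat z n t) nu.
Proof.
move=> z z_density z_median B.
have [f [f_density _ _]] := z_density 0%N 1%N isT.
apply: (signed_rank_clt y_indep y_dist).
  exact: (has_density_neq0 (ltnW hp) f_density).
exact: (z_median 0%N 1%N isT 0).2.
Qed.
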